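(* Let $(\Omega,\mathcal H,\overline{\mathbf E})$ be a sublinear expectation space and let $X_1,X_2,\dots$ be random variables that are i.i.d. with $X_0$ under $\overline{\mathbf E}$, where $X_0,X_0^2\in\mathcal H$ and $0<\underline\sigma\le\overline\sigma<\infty$. Let $n\ge1$ be an integer and $p\in[2,3]$. Then the Prokhorov distance $\overline\Pi(S_n,B)$ under the sublinear expectation satisfies $$\overline{\Pi}(S_n,B)\le \frac{C_3\big(\gamma_p(\sqrt n)\big)^{1/(p+1)}}{n^{(p-2)/(2p+2)}}\le\frac{C_3\,\gamma_p^{1/(p+1)}}{n^{(p-2)/(2p+2)}},\qquad C_3=4.7 .$$
   Context: Sublinear expectation space: $\mathcal H$ is a linear space of real-valued random variables on $\Omega$ containing the constants, and $\overline{\mathbf E}:\mathcal H\to\mathbb R$ satisfies for $X,Y\in\mathcal H$: (i) $\overline{\mathbf E}[X]\le\overline{\mathbf E}[Y]$ if $X\le Y$; (ii) $\overline{\mathbf E}[c]=c$ for constants $c$; (iii) $\overline{\mathbf E}[X+Y]\le\overline{\mathbf E}[X]+\overline{\mathbf E}[Y]$; (iv) $\overline{\mathbf E}[\lambda X]=\lambda\overline{\mathbf E}[X]$ for constants $\lambda\ge0$. Put $\underline{\mathbf E}[X]:=-\overline{\mathbf E}[-X]$. Independence: a random vector $\vec Y\in\mathbb R^l$ is independent to $\vec X\in\mathbb R^m$ if for all bounded continuous $\psi:\mathbb R^{l+m}\to\mathbb R$ one has $\psi(\vec X,\vec Y)\in\mathcal H$ and $\overline{\mathbf E}[\psi(\vec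 X,\vec Y)]=\overline{\mathbf E}\big[\overline{\mathbf E}[\psi(\vec x,\vec Y)]|_{\vec x=\vec X}\big]$. The sequence $X_1,X_2,\dots$ is i.i.d. with $X_0$ if for each $k\ge2$, $X_k$ is independent to $\vec X_{k-1}=(X_1,\dots,X_{k-1})$, and for every $k\ge1$, $\overline{\mathbf E}[\psi(X_k)]=\overline{\mathbf E}[\psi(X_0)]$ for every bounded continuous $\psi:\mathbb R\to\mathbb R$. In particular $\psi(\vec X_k)\in\mathcal H$ for all bounded continuous $\psi:\mathbb R^k\to\mathbb R$. Parameters: $\underline\mu=\underline{\mathbf E}[X_0]\le\overline\mu=\overline{\mathbf E}[X_0]$; for $\mu\in[\underline\mu,\overline\mu]$, $\underline\sigma^2(\mu)=\underline{\mathbf E}[(X_0-\mu)^2]$, $\overline\sigma^2(\mu)=\overline{\mathbf E}[(X_0-\mu)^2]$ (with nonnegative square roots $\underline\sigma(\mu),\overline\sigma(\mu)$); $\underline\sigma=\inf_{\mu\in[\underline\mu,\overline\mu]}\underline\sigma(\mu)$, $\overline\sigma=\sup_{\mu\in[\underline\mu,\overline\mu]}\overline\sigma(\mu)$. Extended expectation: for any $\phi:\mathbb R\to\mathbb R$, $\overline{\mathbf E}[\phi(X_0)]:=\inf\{\overline{\mathbf E}[X]: X\ge\phi(X_0),\ X\in\mathcal H\}\le\infty$, with $\inf\emptyset=\infty$. Moments: $\xi_0(\mu):=(X_0-\mu)/\underline\sigma(\mu)$; for $C>0$, $p\ge2$, $\gamma_p(C):=\sup_{\mu\in[\underline\mu,\overline\mu]}\overline{\mathbf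 E}\big[\min\{|\xi_0(\mu)|^p,\,C^{p-2}\xi_0^2(\mu)\}\big]$ and $\gamma_p:=\sup_{\mu\in[\underline\mu,\overline\mu]}\overline{\mathbf E}[|\xi_0(\mu)|^p]\le\infty$. Normalizations: $\mathcal M_n$ is the set of all sequences $\{(\mu_i,\sigma_i)\}_{i=1}^n$ such that for each $i$, $\mu_i$ and $\sigma_i$ are continuous functions of $\vec X_{i-1}=(X_1,\dots,X_{i-1})$ (constants for $i=1$) with $\underline\mu\le\mu_i\le\overline\mu$ and $\underline\sigma\le\underline\sigma(\mu_i)\le\sigma_i\le\overline\sigma(\mu_i)\le\overline\sigma$. Given such a sequence, $S_n=S_n(\cdot)$ is the random continuous broken line on $[0,1]$, linear on each $[\frac{k-1}n,\frac kn]$, with $S_n(0)=0$ and $S_n(\frac kn)=\frac1{\sqrt n}\sum_{i=1}^k\frac{X_i-\mu_i}{\sigma_i}$, $k=1,\dots,n$. Upper probability: $\overline{\mathbf P}(S_n\in D):=\inf\{\overline{\mathbf E}\psi(\vec X_n):\ \psi(\vec X_n)\ge \mathbf I(S_n\in D),\ \psi(\vec X_n)\in\mathcal H\}$, $\mathbf I$ denoting the indicator. $\mathbb C[0,1]$ is the space of continuous real functions on $[0,1]$ with the uniform norm $\|\cdot\|$, and $D^\varepsilon=\{x\in\mathbb C[0,1]:\exists y\in D,\ \|x-y\|<\varepsilon\}$. $B$ is a standard Wiener process on $[0,1]$ on a classical probability space with probability $\mathbf P$. Prokhorov distance under the sublinear expectation: for arbitrary (not necessarily measurable) $D\subset\mathbb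 C[0,1]$ and $\varepsilon>0$ let $$\overline\Delta_n(D,\varepsilon):=\inf_{\{(\mu_i,\sigma_i)\}\in\mathcal M_n}\overline{\mathbf P}(S_n\in D)-\mathbf P(B\in D^\varepsilon),\qquad \overline\Pi(S_n,B):=\inf\Big\{\varepsilon>0:\sup_{D\subset\mathbb C[0,1]}\overline\Delta_n(D,\varepsilon)\le\varepsilon\Big\}.$$ *)

(* Defs.v *)
From HB Require Import structures.
From mathcomp Require Import all_boot all_order all_algebra.
From mathcomp Require Import all_classical all_reals all_analysis.

Set Implicit Arguments.
Unset Strict Implicit.
Unset Printing Implicit Defensive.

Import Order.TTheory GRing.Theory Num.Theory.
Import numFieldNormedType.Exports.

Local Open Scope classical_set_scope.
Local Open Scope ring_scope.

Section sublinear_expectation.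
Context {R : realType} {Omega : Type}.
Implicit Types (H : set (Omega -> R)) (E : (Omega -> R) -> R).

(* [E] is a total function, but only its values on [H] are constrained. *)
Record sublinear_expectation H E : Prop := SublinearExpectation {
  sle_memcst : forall c : R, H (fun=> c) ;
  sle_memD : forall X Y, H X -> H Y -> H (fun w => X w + Y w) ;
  sle_memZ : forall (c : R) X, H X -> H (fun w => c * X w) ;
  sle_mono : forall X Y, H X -> H Y -> (forall w, X w <= Y w) -> E X <= E Y ;
  sle_cst : forall c : R, E (fun=> c) = c ;
  sle_subadd : forall X Y, H X -> H Y -> E (fun w => X w + Y w) <= E X + E Y ;
  sle_poshom : forall (c : R) X, H X -> 0 <= c ->
    E (fun w => c * X w) = c * E X }.

Definition lower_expectation E (X : Omega -> R) : R := - E (fun w => - X w).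

Definition extended_expectation H E (Z : Omega -> R) : \bar R :=
  ereal_inf [set (E Y)%:E | Y in [set Y | H Y /\ forall w, Z w <= Y w]].

Definition bounded_continuous k (psi : 'rV[R]_k -> R) : Prop :=
  continuous psi /\ exists M : R, forall x, `|psi x| <= M.

(* The third conjunct is the requirement that the outer expectation on the
   right-hand side of the last one be defined. *)
Definition independent_to H E l m
    (Y : Omega -> 'rV[R]_l) (X : Omega -> 'rV[R]_m) : Prop :=
  forall psi : 'rV[R]_(m + l) -> R, bounded_continuous psi ->
  let inner x := E (fun w => psi (row_mx x (Y w))) in
  [/\ H (fun w => psi (row_mx (X w) (Y w))),
      H (fun w => inner (X w)) &
      E (fun w => psi (row_mx (X w) (Y w))) = E (fun w => inner (X w))].

Definition same_distribution H E (Y X : Omega -> R) : Prop :=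
  forall psi : R -> R, continuous psi ->
  (exists M : R, forall x, `|psi x| <= M) ->
  [/\ H (psi \o Y), H (psi \o X) & E (psi \o Y) = E (psi \o X)].

(* [X 0] is the reference variable; the sequence itself is X 1, X 2, ... *)
Definition history (X : nat -> Omega -> R) k (w : Omega) : 'rV[R]_k :=
  \row_(j < k) X j.+1 w.

Definition iid_with_X0 H E (X : nat -> Omega -> R) : Prop :=
  (forall k, (2 <= k)%N ->
     independent_to H E (fun w => \row_(j < 1) X k w) (history X k.-1)) /\
  (forall k, (1 <= k)%N -> same_distribution H E (X k) (X 0%N)).

Definition mean_low E (X0 : Omega -> R) : R := lower_expectation E X0.
Definition mean_up E (X0 : Omega -> R) : R := E X0.

Definition mean_range E X0 : set R := `[mean_low E X0, mean_up E X0].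

Definition sd_low_at E (X0 : Omega -> R) (mu : R) : R :=
  Num.sqrt (lower_expectation E (fun w => (X0 w - mu) ^+ 2)).
Definition sd_up_at E (X0 : Omega -> R) (mu : R) : R :=
  Num.sqrt (E (fun w => (X0 w - mu) ^+ 2)).

Definition sd_low E X0 : \bar R :=
  ereal_inf [set (sd_low_at E X0 mu)%:E | mu in mean_range E X0].
Definition sd_up E X0 : \bar R :=
  ereal_sup [set (sd_up_at E X0 mu)%:E | mu in mean_range E X0].

Definition standardized E X0 (mu : R) (w : Omega) : R :=
  (X0 w - mu) / sd_low_at E X0 mu.

Definition gamma_trunc H E X0 (p C : R) : \bar R :=
  ereal_sup [set extended_expectation H E (fun w =>
      Num.min (`|standardized E X0 mu w| `^ p)
              (C `^ (p - 2) * standardized E X0 mu w ^+ 2))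
    | mu in mean_range E X0].

Definition gamma H E X0 (p : R) : \bar R :=
  ereal_sup [set extended_expectation H E (fun w =>
      `|standardized E X0 mu w| `^ p)
    | mu in mean_range E X0].

Definition continuous_function_of k (V : Omega -> 'rV[R]_k) (Z : Omega -> R) :=
  exists2 f : 'rV[R]_k -> R, continuous f & forall w, Z w = f (V w).

(* Only the indices 1 <= i <= n of the two components are relevant; for i = 1
   the history is the unique element of 'rV_0, so that mu_1 and sigma_1 are
   constants. *)
Definition normalizations E (X : nat -> Omega -> R) n :
    set ((nat -> Omega -> R) * (nat -> Omega -> R)) :=
  [set ms | forall i, (1 <= i <= n)%N ->
    [/\ continuous_function_of (history X i.-1) (ms.1 i),
        continuous_function_of (history X i.-1) (ms.2 i),
        forall w, mean_low E (X 0%N) <= ms.1 i w <= mean_up E (X 0%N) &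
        forall w,
          [/\ (sd_low E (X 0%N) <= (sd_low_at E (X 0%N) (ms.1 i w))%:E)%E,
              sd_low_at E (X 0%N) (ms.1 i w) <= ms.2 i w,
              ms.2 i w <= sd_up_at E (X 0%N) (ms.1 i w) &
              ((sd_up_at E (X 0%N) (ms.1 i w))%:E <= sd_up E (X 0%N))%E]]].

End sublinear_expectation.

(* A genuine subtype of R, carrying the induced topology. *)
Notation unit_interval R := (set_type (`[0%R, 1%R]%classic : set R)).

Section paths.
Context {R : realType}.

Definition time (t : unit_interval R) : R := set_val t.

Definition C01 : set (unit_interval R -> R) := [set x | continuous x].

Definition uniform_dist (x y : unit_interval R -> R) : R :=
  sup [set `|x t - y t| | t in [set: unit_interval R]].

Definition enlargement (D : set (unit_interval R -> R)) (eps : R) :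
    set (unit_interval R -> R) :=
  [set x | C01 x /\ exists2 y, D y & uniform_dist x y < eps].

(* Linear interpolation of the values s k at the points k / n.  At t = 1 the
   slope term vanishes, so s n.+1 is irrelevant. *)
Definition broken_line n (s : nat -> R) (t : unit_interval R) : R :=
  let k := Num.truncn (n%:R * time t) in
  s k + (n%:R * time t - k%:R) * (s k.+1 - s k).

(* Surely continuous paths; B_0 = 0 almost surely.  Independence of the
   increments over t_0 <= ... <= t_k is the product rule for arbitrary Borel
   sets, which covers subfamilies by taking some A i := setT. *)
Definition standard_wiener d (T : measurableType d) (P : probability T R)
    (B : T -> unit_interval R -> R) : Prop :=
  [/\ forall w, C01 (B w),
      forall t, measurable_fun [set: T] (fun w => B w t),
      forall t, time t = 0 -> {ae P, forall w, B w t = 0},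
      forall s t, time s < time t -> forall A : set R, measurable A ->
        P [set w | A (B w t - B w s)] =
        normal_prob 0 (Num.sqrt (time t - time s)) A &
      forall (k : nat) (t : nat -> unit_interval R) (A : nat -> set R),
        (forall i, (i < k)%N -> time (t i) <= time (t i.+1)) ->
        (forall i, measurable (A i)) ->
        P [set w | forall i, (i < k)%N -> A i (B w (t i.+1) - B w (t i))] =
        (\prod_(i < k) P [set w | A i (B w (t i.+1) - B w (t i))%R])%E].

End paths.

Section prokhorov.
Context {R : realType} {Omega : Type}.
Variables (H : set (Omega -> R)) (E : (Omega -> R) -> R).
Variable X : nat -> Omega -> R.

Definition S_path n (ms : (nat -> Omega -> R) * (nat -> Omega -> R))
    (w : Omega) : unit_interval R -> R :=
  broken_line n (fun k => (Num.sqrt n%:R)^-1 *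
    \sum_(1 <= i < k.+1) (X i w - ms.1 i w) / ms.2 i w).

Definition upper_prob n ms (D : set (unit_interval R -> R)) : \bar R :=
  ereal_inf [set (E (psi \o history X n))%:E
    | psi in [set psi : 'rV[R]_n -> R | H (psi \o history X n) /\
        forall w, \1_[set w | D (S_path n ms w)] w <= psi (history X n w)]].

Variables (d : measure_display) (T : measurableType d) (P : probability T R).
Variable B : T -> unit_interval R -> R.

(* For continuous B the event in the last term is measurable, since the
   enlargement is open. *)
Definition Delta n (D : set (unit_interval R -> R)) (eps : R) : \bar R :=
  (ereal_inf [set upper_prob n ms D | ms in normalizations E X n]
   - P [set w | enlargement D eps (B w)])%E.

Definition prokhorov_dist n : \bar R :=
  ereal_inf [set eps%:E | eps in [set eps : R | 0 < eps /\
    (ereal_sup [set Delta n D eps | D in [set D | D `<=` C01]] <= eps%:E)%E]].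

End prokhorov.

(* Main.v *)
Require Import Defs.
From HB Require Import structures.
From mathcomp Require Import all_boot all_order all_algebra.
From mathcomp Require Import all_classical all_reals all_analysis.
From mathcomp Require Import measurable_realfun ring lra.

Set Implicit Arguments.
Unset Strict Implicit.
Unset Printing Implicit Defensive.

Import Order.TTheory GRing.Theory Num.Theory.
Import numFieldNormedType.Exports.

Local Open Scope classical_set_scope.
Local Open Scope ring_scope.

(* The sublinear expectation is compared with a Gaussian random walk by Lindeberg's
   replacement of one increment at a time. Let V_k be the probability that a walk
   with Gaussian increments, started from the first k values of the broken line,
   ends close to D. V_k is only Lipschitz, so it is averaged over a box kernel of
   width delta in its last argument; the average has a second order Taylor
   expansion with remainder of order min((z/delta)^2, (z/delta)^3). Allowing the
   path a tolerance delta from time k on makes these averages monotone along the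
   walk, so the smoothing is paid only once. If (mu, sigma) is chosen by the signs
   of the first and second order coefficients, the sublinear expectation of one
   step does not exceed the Gaussian one by more than the remainders, whose sum is
   controlled by gamma_p. Finally the Gaussian walk is embedded in the Wiener process, whose
   oscillation between grid points is estimated by dyadic chaining. *)

(** * Gaussian moments *)

(** The accuracy eps = 4.7 gamma^(1/(p+1)) n^(-(p-2)/(2p+2)) is spent twice. As a radius it covers 2
    delta + eta + 5 x: the tolerance, the shifted starting point, the Lipschitz layer of the
    indicator and the oscillation of the Wiener path in a grid cell. As a probability it covers n
    remainders of order gamma / (delta sqrt n)^p, n Gaussian ones of order (delta sqrt n)^(-3), the
    cost of a continuous choice and the probability of a rough Wiener path. Equating n gamma / (eps
    sqrt n)^p with eps gives the exponents; delta = 3/8 eps leaves room in both budgets. The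
    Gaussian remainder carries no gamma, so it is absorbed through the lower bound gamma >= 23/27.
    Two obstacles shape the rest. The set D is arbitrary, so its indicator is replaced by a
    Lipschitz function of the grid values, which is continuous and measurable whatever D is. And
    mu_k, sigma_k must be continuous in the history, so signs are replaced by ramps; their width may
    depend on n, which makes their total cost as small as desired. *)

Section gaussian_moments.
Context {R : realType}.
Variable s : R.
Hypothesis s0 : 0 < s.
Local Notation mu := (@lebesgue_measure R).
Local Notation phi := (normal_prob 0 s).

(** The Radon-Nikodym derivative of [normal_prob] agrees with [normal_pdf] almost everywhere,
    because both have the same integral over every measurable set. *)
Lemma integral_normal_prob (f : measurableTypeR R -> \bar R) :
  (forall x, (0 <= f x)%E) -> measurable_fun [set: measurableTypeR R] f ->
  (\int[phi]_x f x = \int[mu]_x (f x * (normal_pdf 0 s x)%:E))%E.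
Proof.
move=> f0 mf; have dom := @normal_prob_dominates R 0 s.
rewrite -(Radon_Nikodym_SigmaFinite.change_of_variables dom)//.
have mg := measurable_int _ (Radon_Nikodym_SigmaFinite.f_integrable dom).
have mpdf : measurable_fun [set: R] (fun x => (normal_pdf 0 s x)%:E).
  by apply/measurable_EFinP; exact: measurable_normal_pdf.
apply: ae_eq_integral => //; [exact: emeasurable_funM..|].
apply: ae_eqe_mul2l; apply: integral_ae_eq => //=.
  exact: Radon_Nikodym_SigmaFinite.f_integrable.
by move=> E _ mE; rewrite -Radon_Nikodym_SigmaFinite.f_integral.
Qed.

(** No integral is computed: completing the square turns the weighted density into a multiple of
    another normal density, whose total mass is 1. *)
Lemma integral_normal_prob_density (f : R -> R) (c m' s' : R) : 0 <= c ->
  (forall x, 0 <= f x) -> measurable_fun [set: R] f ->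
  (forall x, f x * normal_pdf 0 s x = c * normal_pdf m' s' x) ->
  (\int[phi]_x (f x)%:E = c%:E)%E.
Proof.
move=> c0 f0 mf fE; rewrite integral_normal_prob; last 2 first.
- by move=> x; rewrite lee_fin.
- exact/measurable_EFinP.
under eq_integral do rewrite -EFinM fE EFinM.
rewrite ge0_integralZl//.
- by rewrite integral_normal_pdf mule1.
- by apply/measurable_EFinP; exact: measurable_normal_pdf.
- by move=> x _; rewrite lee_fin normal_pdf_ge0.
Qed.

Lemma measurable_expR_sqr (h : R) :
  measurable_fun [set: R] (fun x : R => expR (h * x ^+ 2)).
Proof. by apply: measurableT_comp => //; exact: measurable_funM. Qed.

Lemma measurable_expR_lin (h : R) :
  measurable_fun [set: R] (fun x : R => expR (h * x)).
Proof. by apply: measurableT_comp => //; exact: measurable_funM. Qed.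

Lemma normal_mgf_sqr (h : R) : 2 * h * s ^+ 2 < 1 ->
  (\int[phi]_x (expR (h * x ^+ 2))%:E =
   ((Num.sqrt (1 - 2 * h * s ^+ 2))^-1)%:E)%E.
Proof.
move=> h1; pose k : R := 1 - 2 * h * s ^+ 2; rewrite -/k.
have k0 : 0 < k by rewrite subr_gt0.
have sk0 : 0 < Num.sqrt k by rewrite sqrtr_gt0.
apply: (@integral_normal_prob_density _ _ 0 (s / Num.sqrt k)).
- by rewrite invr_ge0 ltW.
- by move=> x; exact: expR_ge0.
- exact: measurable_expR_sqr.
move=> x; rewrite !normal_pdfE ?gt_eqF// ?divr_gt0//.
rewrite /normal_peak /normal_fun subr0 exprMn exprVn sqr_sqrtr ?(ltW k0)//.
rewrite mulrCA -expRD [RHS]mulrA; congr (_ * expR _).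
  rewrite -invfM; congr (_^-1).
  rewrite -[in RHS]sqrtrM ?(ltW k0)//; congr Num.sqrt.
  by rewrite -!mulrnAr; field; rewrite gt_eqF.
have -> : h = (1 - k) / (2 * s ^+ 2) by rewrite /k; field; rewrite gt_eqF.
have : s ^+ 2 != 0 by rewrite expf_neq0// gt_eqF.
move: (s ^+ 2) (x ^+ 2) k k0 {sk0 h1} => v y k k0 v0.
rewrite !mulr2n; field.
by rewrite v0 (gt_eqF k0) -mulr2n mulrn_eq0 negb_or v0.
Qed.

Lemma normal_mgf (h : R) :
  (\int[phi]_x (expR (h * x))%:E = (expR (h ^+ 2 * s ^+ 2 / 2))%:E)%E.
Proof.
apply: (@integral_normal_prob_density _ _ (h * s ^+ 2) s).
- exact: expR_ge0.
- by move=> x; exact: expR_ge0.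
- exact: measurable_expR_lin.
move=> x; rewrite !normal_pdfE ?gt_eqF//.
rewrite /normal_fun subr0 mulrCA -expRD [RHS]mulrCA -expRD; congr (_ * expR _).
have s20 : s ^+ 2 + s ^+ 2 != 0 by rewrite gt_eqF// addr_gt0 ?exprn_gt0.
by rewrite mulr2n; field; rewrite s20.
Qed.

(** Markov inequality for exp(h x^2) with h = 1/(4 s^2), where its mean is sqrt 2. *)
Lemma normal_tail (a : R) : 0 <= a ->
  (phi [set x | (a < `|x|)%R] <=
   (Num.sqrt 2 * expR (- (a ^+ 2 / (4 * s ^+ 2))))%:E)%E.
Proof.
move=> a0; set h := (4 * s ^+ 2)^-1.
have s20 : 0 < s ^+ 2 by rewrite exprn_gt0.
have h0 : 0 < h by rewrite invr_gt0 mulr_gt0.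
have hs : 2 * h * s ^+ 2 = 2^-1 by rewrite /h; field; rewrite gt_eqF.
have mA : measurable [set x : R | (a < `|x|)%R].
  rewrite -[X in measurable X]setTI.
  by apply: (@measurable_fun_ltr _ _ _ _ (cst a) (fun x : R => `|x|)) => //.
rewrite -[X in (X <= _)%E]mul1e -(integral_cst phi mA 1%E).
apply: (@le_trans _ _ (\int[phi]_(x in [set x | (a < `|x|)%R])
   (expR (- (a ^+ 2 * h)) * expR (h * x ^+ 2))%:E))%E.
  apply: ge0_le_integral => //.
  - apply/measurable_EFinP; apply: measurable_funTS.
    by apply: measurable_funM => //; exact: measurable_expR_sqr.
  - move=> x /= ax; rewrite lee_fin -expRD -expR0 ler_expR.
    rewrite addrC mulrC -mulrBl mulr_ge0 ?(ltW h0)// subr_ge0.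
    by rewrite -[x ^+ 2]real_normK ?num_real// lerXn2r ?nnegrE// ltW.
apply: (@le_trans _ _ (\int[phi]_x
   (expR (- (a ^+ 2 * h)) * expR (h * x ^+ 2))%:E))%E.
  apply: ge0_subset_integral => //.
  apply/measurable_EFinP.
  by apply: measurable_funM => //; exact: measurable_expR_sqr.
under eq_integral do rewrite EFinM.
rewrite ge0_integralZl//; last first.
  by apply/measurable_EFinP; exact: measurable_expR_sqr.
rewrite normal_mgf_sqr ?hs; last lra.
rewrite -EFinM lee_fin mulrC ler_wpM2r ?expR_ge0//.
have -> : 1 - 2^-1 = 2^-1 :> R by field.
by rewrite sqrtrV// invrK.
Qed.

Lemma normal_prob_integrable (f g : R -> R) : measurable_fun [set: R] f ->
  (forall x, `|f x| <= g x) -> measurable_fun [set: R] g ->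
  (\int[phi]_x (g x)%:E < +oo)%E -> phi.-integrable [set: R] (EFin \o f).
Proof.
move=> mf fg mg goo; apply/integrableP; split; first exact/measurable_EFinP.
apply: le_lt_trans goo; apply: ge0_le_integral => //.
- by apply: measurableT_comp => //; apply/measurable_EFinP.
- exact/measurable_EFinP.
- by move=> x _ /=; rewrite lee_fin.
Qed.

Lemma integrable_expR_sqr (h : R) : 2 * h * s ^+ 2 < 1 ->
  phi.-integrable [set: R] (EFin \o (fun x => expR (h * x ^+ 2))).
Proof.
move=> h1; apply: (@normal_prob_integrable _ (fun x => expR (h * x ^+ 2))).
- exact: measurable_expR_sqr.
- by move=> x; rewrite ger0_norm ?expR_ge0.
- exact: measurable_expR_sqr.
- by rewrite normal_mgf_sqr// ltry.
Qed.

Lemma integrable_expR_lin (h : R) :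
  phi.-integrable [set: R] (EFin \o (fun x => expR (h * x))).
Proof.
apply: (@normal_prob_integrable _ (fun x => expR (h * x))).
- exact: measurable_expR_lin.
- by move=> x; rewrite ger0_norm ?expR_ge0.
- exact: measurable_expR_lin.
- by rewrite normal_mgf ltry.
Qed.

Lemma Rintegral_expR_sqr (h : R) : 2 * h * s ^+ 2 < 1 ->
  \int[phi]_x expR (h * x ^+ 2) = (Num.sqrt (1 - 2 * h * s ^+ 2))^-1.
Proof. by move=> h1; rewrite /Rintegral normal_mgf_sqr. Qed.

Lemma Rintegral_expR_lin (h : R) :
  \int[phi]_x expR (h * x) = expR (h ^+ 2 * s ^+ 2 / 2).
Proof. by rewrite /Rintegral normal_mgf. Qed.

Lemma integrable_normal_cst (c : R) : phi.-integrable [set: R] (EFin \o cst c).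
Proof. exact: finite_measure_integrable_cst. Qed.

Lemma Rintegral_normal_cst (c : R) : \int[phi]_x c = c.
Proof.
by rewrite Rintegral_cst// [X in fine X](@probability_setT _ _ _ phi) mulr1.
Qed.

Let hs : R := (4 * s ^+ 2)^-1.
Let hs0 : 0 < hs. Proof. by rewrite invr_gt0 mulr_gt0// exprn_gt0. Qed.
Let hsE : 2 * hs * s ^+ 2 = 2^-1.
Proof. by rewrite /hs; field; rewrite gt_eqF. Qed.
Let hs1 : 2 * hs * s ^+ 2 < 1. Proof. rewrite hsE; lra. Qed.

(** With y = [hs * x ^+ 2] one has (1 + y)^2 <= 4 (1 + y/2)^2 <= 4 exp y, and exp y is integrable
    because [hs] lies below 1/(2 s^2). *)
Lemma integrable_normal_le_sqr (f : R -> R) (c : R) : 0 <= c ->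
  measurable_fun [set: R] f -> (forall x, `|f x| <= c * (1 + hs * x ^+ 2) ^+ 2) ->
  phi.-integrable [set: R] (EFin \o f).
Proof.
move=> c0 mf fc.
apply: (@normal_prob_integrable _ (fun x => 4 * c * expR (hs * x ^+ 2))) => //.
- move=> x; apply: (le_trans (fc x)); rewrite (mulrC 4) -mulrA ler_wpM2l//.
  have y0 : 0 <= hs * x ^+ 2 by rewrite mulr_ge0 ?sqr_ge0// ltW.
  have := @expR_ge1Dx R (hs * x ^+ 2 / 2).
  have -> : expR (hs * x ^+ 2) = expR (hs * x ^+ 2 / 2) ^+ 2.
    by rewrite [RHS]expr2 -expRD -splitr.
  move: (hs * x ^+ 2) y0 (expR _) => y y0 e e1.
  by nra.
- by apply: measurable_funM => //; exact: measurable_expR_sqr.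
- under eq_integral do rewrite EFinM.
  rewrite ge0_integralZl//; first by rewrite normal_mgf_sqr// -EFinM ltry.
  + by apply/measurable_EFinP; exact: measurable_expR_sqr.
  + by rewrite lee_fin mulr_ge0.
Qed.

Lemma integrable_normal_id : phi.-integrable [set: R] (EFin \o (fun x : R => x)).
Proof.
apply: (@integrable_normal_le_sqr _ (1 + hs^-1)) => //.
  by rewrite addr_ge0// invr_ge0 ltW.
move=> x; have k0 : 0 <= hs^-1 by rewrite invr_ge0 ltW.
have y0 : 0 <= hs * x ^+ 2 by rewrite mulr_ge0 ?sqr_ge0// ltW.
have x2E : `|x| ^+ 2 = hs^-1 * (hs * x ^+ 2).
  by rewrite mulKf ?gt_eqF// real_normK ?num_real.
have : 0 <= `|x| by [].
move: (hs^-1) (hs * x ^+ 2) (`|x|) k0 y0 x2E => k y z k0 y0 z2 z0.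
have : z <= 1 + k * y by rewrite -z2; nra.
have : 0 <= k * y by exact: mulr_ge0.
have : 0 <= k * y ^+ 2 by rewrite mulr_ge0// sqr_ge0.
nra.
Qed.

Lemma integrable_normal_sqr :
  phi.-integrable [set: R] (EFin \o (fun x : R => x ^+ 2)).
Proof.
apply: (@integrable_normal_le_sqr _ hs^-1) => //.
  by rewrite invr_ge0 ltW.
move=> x; rewrite ger0_norm ?sqr_ge0// ler_pdivlMl//.
have : 0 <= hs * x ^+ 2 by rewrite mulr_ge0 ?sqr_ge0// ltW.
by move: (hs * _) => y; nra.
Qed.

Lemma integrable_normal_exp4 :
  phi.-integrable [set: R] (EFin \o (fun x : R => x ^+ 4)).
Proof.
apply: (@integrable_normal_le_sqr _ (hs ^+ 2)^-1) => //.
  by rewrite invr_ge0 sqr_ge0.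
move=> x; rewrite ger0_norm ?exprn_even_ge0//.
rewrite ler_pdivlMl ?exprn_gt0// (_ : hs ^+ 2 * x ^+ 4 = (hs * x ^+ 2) ^+ 2);
    last by rewrite exprMn -exprM.
have : 0 <= hs * x ^+ 2 by rewrite mulr_ge0 ?sqr_ge0// ltW.
by move: (hs * _) => y; nra.
Qed.

Lemma integrable_normal_abs3 :
  phi.-integrable [set: R] (EFin \o (fun x : R => `|x| ^+ 3)).
Proof.
apply: (@integrable_normal_le_sqr _ (hs^-1 + (hs ^+ 2)^-1)) => //.
- by rewrite addr_ge0// invr_ge0 ?sqr_ge0// ltW.
- by apply: measurable_funX; exact: normr_measurable.
move=> x; rewrite ger0_norm ?exprn_ge0//.
apply: (@le_trans _ _ (x ^+ 2 + x ^+ 4)).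
  rewrite -[x ^+ 2]real_normK ?num_real// (_ : x ^+ 4 = `|x| ^+ 4); last first.
    by rewrite (exprM x 2 2) (exprM `|x| 2 2) real_normK ?num_real.
  have : 0 <= `|x| by []. move: `|x| => y y0. nra.
rewrite mulrDl lerD//.
- rewrite ler_pdivlMl//.
  have : 0 <= hs * x ^+ 2 by rewrite mulr_ge0 ?sqr_ge0// ltW.
  by move: (hs * _) => y; nra.
- rewrite ler_pdivlMl ?exprn_gt0// (_ : hs ^+ 2 * x ^+ 4 = (hs * x ^+ 2) ^+ 2);
    last by rewrite exprMn -exprM.
  have : 0 <= hs * x ^+ 2 by rewrite mulr_ge0 ?sqr_ge0// ltW.
  by move: (hs * _) => y; nra.
Qed.


(** Integrating 1 + h x <= exp(h x) bounds h times the mean by exp(h^2 s^2 / 2) - 1 <= h^2 s^2.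
    Dividing by |h|, for small h of either sign, leaves 0. *)
Lemma normal_mean : \int[phi]_x (x : R) = 0.
Proof.
have H (h : R) : 0 < `|h| -> h ^+ 2 * s ^+ 2 < 1 ->
    h * \int[phi]_x (x : R) <= `|h| * (`|h| * s ^+ 2).
  move=> h0 h1; have v0 : 0 <= h ^+ 2 * s ^+ 2 by rewrite mulr_ge0 ?sqr_ge0.
  have : 1 + h * \int[phi]_x (x : R) <= expR (h ^+ 2 * s ^+ 2 / 2).
    rewrite -Rintegral_expR_lin -{1}(Rintegral_normal_cst 1).
    rewrite -RintegralZl//; last exact: integrable_normal_id.
    have iZ : phi.-integrable [set: R] (EFin \o (fun x : R => h * x)).
      exact: (integrableZl measurableT h integrable_normal_id).
    rewrite -RintegralD//; last exact: integrable_normal_cst.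
    apply: le_Rintegral => //.
    - exact: (integrableD measurableT (integrable_normal_cst 1) iZ).
    - exact: integrable_expR_lin.
    - by move=> x _; exact: expR_ge1Dx.
  have : expR (h ^+ 2 * s ^+ 2 / 2) <= 1 + h ^+ 2 * s ^+ 2.
    move: (h ^+ 2 * s ^+ 2) v0 h1 => v v0 h1.
    have := @expR_ge1Dx R (- (v / 2)); rewrite expRN.
    have := expR_gt0 (v / 2); move: (expR _) => e e0 ev.
    have : (1 - v / 2) * e <= 1 by rewrite -ler_pdivlMr// mul1r.
    nra.
  rewrite mulrA -expr2 real_normK ?num_real//; lra.
apply/eqP; rewrite -normr_le0; apply/ler_addgt0Pl => e e0; rewrite addr0.
have s20 : 0 < s ^+ 2 by rewrite exprn_gt0.
pose h := Num.min (e / s ^+ 2) (2 * s)^-1.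
have h0 : 0 < h by rewrite lt_min divr_gt0//= invr_gt0 mulr_gt0.
have hs1' : h ^+ 2 * s ^+ 2 < 1.
  rewrite -exprMn expr_lt1//; last by rewrite mulr_ge0// ltW.
  rewrite -ltr_pdivlMr//; apply: (@le_lt_trans _ _ (2 * s)^-1).
    by rewrite ge_min lexx orbT.
  by rewrite mul1r ltf_pV2 ?posrE ?mulr_gt0// ltr_pMl// ltr1n.
have he : h * s ^+ 2 <= e by rewrite -ler_pdivlMr// ge_min lexx.
have hn : `|h| = h by rewrite ger0_norm// ltW.
rewrite ler_norml; apply/andP; split.
- have := H (- h); rewrite normrN hn sqrrN => /(_ h0 hs1').
  rewrite mulNr -mulrN ler_pM2l// => le1; rewrite lerNl.
  exact: le_trans le1 he.
- have := H h; rewrite hn => /(_ h0 hs1').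
  by rewrite ler_pM2l// => le1; exact: le_trans le1 he.
Qed.

(** The argument for the mean, applied to 1 + h x^2 <= exp(h x^2). In [H], [b] is any upper bound of
    (1 - 2 h s^2)^(-1/2). *)
Lemma normal_second_moment : \int[phi]_x (x ^+ 2) = s ^+ 2.
Proof.
have s20 : 0 < s ^+ 2 by rewrite exprn_gt0.
have H (h b : R) : h != 0 -> 2 * h * s ^+ 2 < 1 -> 0 <= b ->
    1 <= (1 - 2 * h * s ^+ 2) * b ^+ 2 -> h * \int[phi]_x (x ^+ 2) <= b - 1.
  move=> h0 h1 b0 hb.
  have k0 : 0 < 1 - 2 * h * s ^+ 2 by rewrite subr_gt0.
  have : 1 + h * \int[phi]_x (x ^+ 2) <= (Num.sqrt (1 - 2 * h * s ^+ 2))^-1.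
    rewrite -Rintegral_expR_sqr// -{1}(Rintegral_normal_cst 1).
    rewrite -RintegralZl//; last exact: integrable_normal_sqr.
    have iZ : phi.-integrable [set: R] (EFin \o (fun x : R => h * x ^+ 2)).
      exact: (integrableZl measurableT h integrable_normal_sqr).
    rewrite -RintegralD//; last exact: integrable_normal_cst.
    apply: le_Rintegral => //.
    - exact: (integrableD measurableT (integrable_normal_cst 1) iZ).
    - exact: integrable_expR_sqr.
    - by move=> x _; exact: expR_ge1Dx.
  suff : (Num.sqrt (1 - 2 * h * s ^+ 2))^-1 <= b by lra.
  rewrite -div1r ler_pdivrMr ?sqrtr_gt0// mulrC.
  by move/ler_wsqrtr : hb; rewrite sqrtr1 sqrtrM ?(ltW k0)// sqrtr_sqr ger0_norm.
set I := \int[phi]_x (x ^+ 2) in H *.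
(* For h = t/(2 s^2) and its negative, b = 1 + t/2 + t^2 and b = 1 - t/2 + t^2 exceed (1 - t)^(-1/2)
   and (1 + t)^(-1/2) up to second order only. *)
have K (t : R) : 0 < t -> t <= 1 / 4 -> `|I - s ^+ 2| <= 2 * s ^+ 2 * t.
  move=> t0 t4.
  have e1 : 2 * (t / (2 * s ^+ 2)) * s ^+ 2 = t by field; rewrite gt_eqF.
  have e2 : 2 * (- (t / (2 * s ^+ 2))) * s ^+ 2 = - t by field; rewrite gt_eqF.
  have := H (t / (2 * s ^+ 2)) (1 + t / 2 + t ^+ 2).
  have := H (- (t / (2 * s ^+ 2))) (1 - t / 2 + t ^+ 2).
  rewrite e1 e2 => H1 H2.
  have tn0 : t / (2 * s ^+ 2) != 0 by rewrite gt_eqF// divr_gt0// mulr_gt0.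
  have {}H1 : - (t / (2 * s ^+ 2)) * I <= 1 - t / 2 + t ^+ 2 - 1.
    apply: H1; rewrite ?oppr_eq0//; [lra|nra|].
    have -> : (1 - - t) * (1 - t / 2 + t ^+ 2) ^+ 2 =
      1 + (5 / 4 * t ^+ 2 + 5 / 4 * t ^+ 3 + t ^+ 5) by field.
    by rewrite lerDl !addr_ge0// ?mulr_ge0 ?exprn_ge0// ltW.
  have {}H2 : t / (2 * s ^+ 2) * I <= 1 + t / 2 + t ^+ 2 - 1.
    apply: H2 => //; [lra|nra|].
    have -> : (1 - t) * (1 + t / 2 + t ^+ 2) ^+ 2 =
      1 + t ^+ 2 * (5 / 4 - 5 / 4 * t - t ^+ 3) by field.
    rewrite lerDl mulr_ge0 ?sqr_ge0//.
    have : t ^+ 3 <= t by rewrite ler_iXnr// ltW//; lra.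
    lra.
  have {}H1 : - t * I <= (- t / 2 + t ^+ 2) * (2 * s ^+ 2).
    by rewrite -ler_pdivrMr ?mulr_gt0// mulrAC mulNr; lra.
  have {}H2 : t * I <= (t / 2 + t ^+ 2) * (2 * s ^+ 2).
    by rewrite -ler_pdivrMr ?mulr_gt0// mulrAC; lra.
  rewrite -(ler_pM2l t0) -{1}(gtr0_norm t0) -normrM ler_norml.
  apply/andP; split; lra.
apply/eqP; rewrite -subr_eq0 -normr_le0; apply/ler_addgt0Pl => e e0.
rewrite addr0.
pose t := Num.min (1 / 4) (e / (2 * s ^+ 2)).
have t0 : 0 < t by rewrite lt_min !divr_gt0// mulr_gt0.
apply: (le_trans (K t t0 _)); first by rewrite ge_min lexx.
by rewrite mulrC -ler_pdivlMr ?mulr_gt0// ge_min lexx orbT.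
Qed.

(** Integrating (1 + y/2)^2 <= exp y for y = [hs * x ^+ 2] gives 1 + 1/4 + m4 / (64 s^4) <= sqrt 2
    for the fourth moment m4. The third moment is interpolated as |x|^3 <= (a s / 2) x^2 + x^4 / (2
    a s), where a = 13/4 is close to the optimal sqrt 10.52. The exact constant is 2 sqrt(2/pi); the
    cruder one suffices below. *)
Lemma normal_abs_third_moment : \int[phi]_x (`|x| ^+ 3) <= 13 / 4 * s ^+ 3.
Proof.
have s20 : 0 < s ^+ 2 by rewrite exprn_gt0.
have m4 : \int[phi]_x (x ^+ 4) <= (1052 / 100) * s ^+ 4.
  have i2 := integrable_normal_sqr; have i4 := integrable_normal_exp4.
  have : 1 + hs * \int[phi]_x (x ^+ 2) + hs ^+ 2 / 4 * \int[phi]_x (x ^+ 4)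
      <= Num.sqrt 2.
    have -> : Num.sqrt 2 = (Num.sqrt (1 - 2 * hs * s ^+ 2))^-1.
      rewrite hsE (_ : 1 - 2^-1 = 2^-1) ?sqrtrV ?invrK//; lra.
    rewrite -Rintegral_expR_sqr// -{1}(Rintegral_normal_cst 1).
    rewrite -!RintegralZl//.
    have iZ2 : phi.-integrable [set: R] (EFin \o (fun x : R => hs * x ^+ 2)).
      exact: (integrableZl measurableT hs i2).
    have iZ4 : phi.-integrable [set: R]
        (EFin \o (fun x : R => hs ^+ 2 / 4 * x ^+ 4)).
      exact: (integrableZl measurableT (hs ^+ 2 / 4) i4).
    have i1 := integrable_normal_cst 1.
    have i12 : phi.-integrable [set: R] (EFin \o (fun x : R => 1 + hs * x ^+ 2)).
      exact: (integrableD measurableT i1 iZ2).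
    rewrite -RintegralD// -RintegralD//.
    apply: le_Rintegral => //.
    - exact: (integrableD measurableT i12 iZ4).
    - exact: integrable_expR_sqr.
    move=> x _.
    have y0 : 0 <= hs * x ^+ 2 by rewrite mulr_ge0 ?sqr_ge0// ltW.
    have := @expR_ge1Dx R (hs * x ^+ 2 / 2).
    have -> : expR (hs * x ^+ 2) = expR (hs * x ^+ 2 / 2) ^+ 2.
      by rewrite [RHS]expr2 -expRD -splitr.
    have -> : hs ^+ 2 / 4 * x ^+ 4 = (hs * x ^+ 2) ^+ 2 / 4.
      by rewrite exprMn -exprM mulrAC.
    move: (hs * x ^+ 2) y0 (expR _) => y y0 e e1; nra.
  rewrite normal_second_moment.
  have -> : hs * s ^+ 2 = 4^-1 by have := hsE; lra.
  have sq2 : Num.sqrt 2 <= 14142 / 10000 + 1 / 10000 :> R.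
    rewrite -[leRHS]ger0_norm; last lra.
    rewrite -sqrtr_sqr ler_sqrt; nra.
  have -> : s ^+ 4 = (4 * hs)^-1 ^+ 2.
    by rewrite /hs (exprM s 2 2); congr (_ ^+ 2); field; rewrite gt_eqF.
  move: (\int[phi]_x (x ^+ 4)) => J HJ.
  rewrite exprVn ler_pdivlMr ?exprn_gt0 ?mulr_gt0//.
  rewrite exprMn; lra.
have i3 := integrable_normal_abs3.
have i2 := integrable_normal_sqr; have i4 := integrable_normal_exp4.
have iZ2 : phi.-integrable [set: R]
    (EFin \o (fun x : R => (13 / 4 * s / 2) * x ^+ 2)).
  exact: (integrableZl measurableT (13 / 4 * s / 2) i2).
have iZ4 : phi.-integrable [set: R]
    (EFin \o (fun x : R => (2 / 13 / s) * x ^+ 4)).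
  exact: (integrableZl measurableT (2 / 13 / s) i4).
apply: (@le_trans _ _ (\int[phi]_x
    ((13 / 4 * s / 2) * x ^+ 2 + (2 / 13 / s) * x ^+ 4))).
  apply: le_Rintegral => //; first exact: (integrableD measurableT iZ2 iZ4).
  move=> x _; rewrite -[x ^+ 2]real_normK ?num_real// (_ : x ^+ 4 = `|x| ^+ 4).
    have : 0 <= `|x| by []. move: `|x| => y y0.
    rewrite -(ler_pM2l s0) (_ : s * (_ + _) =
      (13 / 8) * s ^+ 2 * y ^+ 2 + 2 / 13 * y ^+ 4).
      have := mulr_ge0 (sqr_ge0 (13 / 4 * s - y)) (sqr_ge0 y); lra.
    by field; rewrite gt_eqF.
  by rewrite (exprM x 2 2) (exprM `|x| 2 2) real_normK ?num_real.
rewrite RintegralD// !RintegralZl// normal_second_moment.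
have : 2 / 13 / s * \int[phi]_x (x ^+ 4) <= 2 / 13 / s * (1052 / 100 * s ^+ 4).
  by rewrite ler_wpM2l// !divr_ge0// ltW.
have -> : 2 / 13 / s * (1052 / 100 * s ^+ 4) = 2104 / 1300 * s ^+ 3.
  by field; rewrite gt_eqF.
have -> : 13 / 4 * s / 2 * s ^+ 2 = 13 / 8 * s ^+ 3 by field.
have : 0 <= s ^+ 3 by rewrite exprn_ge0// ltW.
lra.
Qed.

End gaussian_moments.

(** * Lipschitz functions and box means *)

Section lipschitz_means.
Context {R : realType}.
Local Notation mu := (@lebesgue_measure R).

Definition lip01 (L : R) (g : R -> R) :=
  (forall x, 0 <= g x <= 1) /\ (forall x y, `|g x - g y| <= L * `|x - y|).

Lemma lip01_continuous L g : lip01 L g -> continuous g.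
Proof.
move=> [_ gL] x; apply/cvgrPdist_le => e e0.
have L0 : 0 < `|L| + 1 by rewrite ltr_wpDl.
near=> y; apply: (le_trans (gL _ _)).
apply: (@le_trans _ _ ((`|L| + 1) * `|x - y|)).
  by rewrite ler_wpM2r// (le_trans (ler_norm L))// lerDl.
rewrite -ler_pdivlMl//; near: y.
by apply: cvgr_dist_le; [exact: cvg_id | rewrite mulr_gt0// invr_gt0].
Unshelve. all: by end_near. Qed.

Lemma lip01_measurable L g : lip01 L g -> measurable_fun [set: R] g.
Proof. by move=> /lip01_continuous; exact: continuous_measurable_fun. Qed.

Lemma lip01_shift L g a : lip01 L g -> lip01 L (fun x => g (x + a)).
Proof.
move=> [g01 gL]; split=> // x y; apply: (le_trans (gL _ _)).
by rewrite opprD addrACA subrr addr0.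
Qed.

Lemma lip01_shiftl L g a : lip01 L g -> lip01 L (fun x => g (a + x)).
Proof.
move=> gl; rewrite (_ : (fun x => _) = (fun x => g (x + a))); last first.
  by apply/funext => x; rewrite addrC.
exact: lip01_shift.
Qed.

Lemma EFin_RintegralE d (T : measurableType d) (m : {measure set T -> \bar R})
    (D : set T) (f : T -> R) : measurable D -> m.-integrable D (EFin \o f) ->
  ((\int[m]_(x in D) f x)%:E = \int[m]_(x in D) (f x)%:E)%E.
Proof. by move=> mD fi; rewrite /Rintegral fineK// integrable_fin_num. Qed.

Section mean.
Variable nu : probability (measurableTypeR R) R.

Lemma lip01_integrable L g : lip01 L g -> nu.-integrable [set: R] (EFin \o g).
Proof.
move=> gl; apply: measurable_bounded_integrable => //.
- by rewrite (le_lt_trans (probability_le1 nu _))// ltry.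
- exact: lip01_measurable gl.
exists 1; split; first exact: num_real.
move=> M M1 x _ /=; have /andP[g0 g1] := gl.1 x.
by rewrite ger0_norm// (le_trans g1)// ltW.
Qed.

Lemma mean_le L L' f g : lip01 L f -> lip01 L' g -> (forall x, f x <= g x) ->
  \int[nu]_x f x <= \int[nu]_x g x.
Proof.
move=> fl gl fg; apply: le_Rintegral => //; first exact: lip01_integrable fl.
exact: lip01_integrable gl.
Qed.

Lemma mean_cst (c : R) : \int[nu]_x c = c.
Proof. by rewrite Rintegral_cst// [X in fine X](@probability_setT _ _ _ nu) mulr1. Qed.

Lemma mean_dist L L' f g (c : R) : lip01 L f -> lip01 L' g ->
  (forall x, `|f x - g x| <= c) ->
  `|\int[nu]_x f x - \int[nu]_x g x| <= c.
Proof.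
move=> fl gl fg; have fi := lip01_integrable fl; have gi := lip01_integrable gl.
have ci : nu.-integrable [set: R] (EFin \o cst c).
  exact: finite_measure_integrable_cst.
rewrite ler_distlC; apply/andP; split.
- rewrite -{1}(mean_cst c) -RintegralB//; apply: le_Rintegral => //.
    exact: (integrableB measurableT fi ci).
  by move=> x _; have := fg x; rewrite ler_distlC => /andP[].
- rewrite -{1}(mean_cst c) -RintegralD//; apply: le_Rintegral => //.
    exact: (integrableD measurableT fi ci).
  by move=> x _; have := fg x; rewrite ler_distlC => /andP[].
Qed.

Lemma lip01_mean L (F : R -> R -> R) : (forall x, lip01 L (F x)) ->
  (forall w, lip01 L (F^~ w)) -> lip01 L (fun x => \int[nu]_w F x w).
Proof.
move=> F1 F2; have l0 : lip01 0 (cst (0 : R)).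
  by split=> [x|x y]; rewrite ?lexx ?ler01// subrr normr0 mul0r.
have l1 : lip01 0 (cst (1 : R)).
  by split=> [x|x y]; rewrite ?lexx ?ler01// subrr normr0 mul0r.
split=> [x|x y].
- apply/andP; split.
  + by rewrite -{1}(mean_cst 0); apply: (mean_le l0 (F1 x)) => w; have /andP[] := (F1 x).1 w.
  + by rewrite -[leRHS](mean_cst 1); apply: (mean_le (F1 x) l1) => w; have /andP[] := (F1 x).1 w.
- by apply: (mean_dist (F1 x) (F1 y)) => w; exact: (F2 w).2.
Qed.

End mean.

(** * Box means, their derivatives and Taylor expansion *)

Definition box_mean (h : R) (g : R -> R) (x : R) : R :=
  h^-1 * \int[mu]_(z in `[- (h / 2), h / 2]) g (x + z).

Section box_mean.
Variable h : R.
Hypothesis h0 : 0 < h.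
Let I : set R := `[- (h / 2), h / 2].
Let measI : measurable I. Proof. exact: measurable_itv. Qed.
Let Ioo : (mu I < +oo)%E.
Proof.
by rewrite /I lebesgue_measure_itv/= lte_fin ifT ?ltry// gtrN// divr_gt0.
Qed.
Let mI : fine (mu I) = h.
Proof.
rewrite /I lebesgue_measure_itv/= lte_fin ifT; last by rewrite gtrN// divr_gt0.
by rewrite -EFinD/= opprK -splitr.
Qed.

Lemma box_integrable L g : lip01 L g -> mu.-integrable I (EFin \o g).
Proof.
move=> gl; apply: measurable_bounded_integrable => //.
  by apply: measurable_funTS; exact: lip01_measurable gl.
exists 1; split; first exact: num_real.
move=> M M1 x _ /=; have /andP[g0 g1] := gl.1 x.
by rewrite ger0_norm// (le_trans g1)// ltW.
Qed.

Lemma box_mean_cst (c : R) x : box_mean h (fun=> c) x = c.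
Proof. by rewrite /box_mean Rintegral_cst// mI mulrCA mulVf ?mulr1// gt_eqF. Qed.

Lemma box_mean_le L L' f g x : lip01 L f -> lip01 L' g ->
  (forall y, `|y - x| <= h / 2 -> f y <= g y) ->
  box_mean h f x <= box_mean h g x.
Proof.
move=> fl gl fg; rewrite /box_mean ler_pM2l ?invr_gt0//.
apply: le_Rintegral => //.
- exact: (box_integrable (lip01_shiftl x fl)).
- exact: (box_integrable (lip01_shiftl x gl)).
move=> z; rewrite /= in_itv/= => zh; apply: fg.
by rewrite addrC addKr ler_norml.
Qed.

Lemma lip01_cst (c : R) : 0 <= c <= 1 -> lip01 0 (fun=> c).
Proof. by move=> c01; split=> // x y; rewrite subrr normr0 mul0r. Qed.

Lemma box_mean_dist L L' f g x (c : R) : lip01 L f -> lip01 L' g ->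
  (forall y, `|f y - g y| <= c) -> `|box_mean h f x - box_mean h g x| <= c.
Proof.
move=> fl gl fg; have fi := box_integrable (lip01_shiftl x fl).
have gi := box_integrable (lip01_shiftl x gl).
have di : mu.-integrable I (EFin \o (fun z => f (x + z) - g (x + z))).
  apply: measurable_bounded_integrable => //.
    apply: measurable_funTS; apply: measurable_funB.
      exact: lip01_measurable (lip01_shiftl x fl).
    exact: lip01_measurable (lip01_shiftl x gl).
  exists c; split; first exact: num_real.
  by move=> M cM y _; rewrite /= (le_trans (fg _))// ltW.
rewrite /box_mean -/I -mulrBr -RintegralB//.
rewrite normrM gtr0_norm ?invr_gt0// ler_pdivrMl//.
apply: le_trans; first apply: le_normr_Rintegral => //.
rewrite -(_ : \int[mu]_(z in I) c = h * c); last first.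
  by rewrite Rintegral_cst// mI mulrC.
apply: le_Rintegral => //.
- by apply: integrable_norm; exact: di.
- apply: measurable_bounded_integrable => //.
  exists `|c|; split; first exact: num_real.
  by move=> M cM y _; exact: ltW.
Qed.

Lemma lip01_box_mean L g : lip01 L g -> lip01 L (box_mean h g).
Proof.
move=> gl; split=> [x|x y].
- apply/andP; split.
  + rewrite -(box_mean_cst 0 x); apply: (box_mean_le (lip01_cst _) gl) => //.
      by rewrite lexx ler01.
    by move=> y _; have /andP[] := gl.1 y.
  + rewrite -(box_mean_cst 1 x); apply: (box_mean_le gl (lip01_cst _)) => //.
      by rewrite lexx ler01.
    by move=> y _; have /andP[] := gl.1 y.
- have -> : box_mean h g y = box_mean h (fun z => g (z + (y - x))) x.
    congr (_ * _); apply: eq_Rintegral => z _; congr g; ring.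
  apply: (box_mean_dist _ gl (lip01_shift _ gl)) => z.
  by apply: (le_trans (gl.2 _ _)); rewrite distrC addrC addKr distrC.
Qed.

(** Both sides are iterated convolutions, so Tonelli applies. This exchanges smoothing with a
    Gaussian step. *)
Lemma box_mean_mean (nu : probability (measurableTypeR R) R) L g x : lip01 L g ->
  \int[nu]_w box_mean h g (x + w) =
  box_mean h (fun y => \int[nu]_w g (y + w)) x.
Proof.
move=> gl.
pose f (zw : measurableTypeR R * measurableTypeR R) : \bar R :=
  ((\1_I zw.1)%:E * (g (x + zw.1 + zw.2))%:E)%E.
have mf : measurable_fun setT f.
  have m1 : measurable_fun [set: measurableTypeR R] (\1_I : _ -> R).
    exact: measurable_indic.
  have m2 : measurable_fun [set: measurableTypeR R * measurableTypeR R]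
      (fun zw => x + zw.1 + zw.2).
    by apply: measurable_funD => //; apply: measurable_funD.
  apply: emeasurable_funM; apply/measurable_EFinP.
    exact: (measurableT_comp m1 measurable_fst).
  exact: (measurableT_comp (lip01_measurable gl) m2).
have f0 zw : (0 <= f zw)%E.
  by rewrite mule_ge0 ?lee_fin//; have /andP[] := gl.1 (x + zw.1 + zw.2).
have := @fubini_tonelli _ _ _ _ R mu nu f mf f0.
rewrite /f/= => F.
have E1 w : (\int[mu]_z ((\1_I z)%:E * (g (x + z + w))%:E) =
   (h * box_mean h g (x + w))%:E)%E.
  have gi := box_integrable (lip01_shiftl (x + w) gl).
  rewrite /box_mean mulVKf ?gt_eqF// EFin_RintegralE//.
  rewrite [RHS]integral_mkcond; apply: eq_integral => z _.
  rewrite patchE indicE; case: ifPn => _; rewrite ?mul1e ?mul0e//.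
  by congr (g _)%:E; ring.
have E2 z : (\int[nu]_w ((\1_I z)%:E * (g (x + z + w))%:E) =
   (\1_I z)%:E * (\int[nu]_w g (x + z + w))%:E)%E.
  have gi := lip01_integrable nu (lip01_shiftl (x + z) gl).
  by rewrite integralZl// EFin_RintegralE.
have gw y : lip01 L (fun w => g (y + w)) by exact: lip01_shiftl.
have gy w : lip01 L (fun y => g (y + w)) by exact: lip01_shift.
have gm : lip01 L (fun y => \int[nu]_w g (y + w)) by apply: lip01_mean.
have F' : (\int[mu]_z ((\1_I z)%:E * (\int[nu]_w g (x + z + w))%:E) =
    \int[nu]_w (h * box_mean h g (x + w))%:E)%E.
  transitivity (\int[mu]_z \int[nu]_w ((\1_I z)%:E * (g (x + z + w))%:E))%E.
    by apply: eq_integral => z _; rewrite E2.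
  by rewrite F; apply: eq_integral => w _; rewrite E1.
move: F'; have -> : (\int[mu]_z ((\1_I z)%:E * (\int[nu]_w g (x + z + w))%:E) =
   (h * box_mean h (fun y => \int[nu]_w g (y + w)) x)%:E)%E.
  have gi := box_integrable (lip01_shiftl x gm).
  rewrite /box_mean mulVKf ?gt_eqF// EFin_RintegralE//.
  rewrite [RHS]integral_mkcond; apply: eq_integral => z _.
  by rewrite patchE indicE; case: ifPn => _; rewrite ?mul1e ?mul0e.
have bi := lip01_integrable nu (lip01_shiftl x (lip01_box_mean gl)).
under [in RHS]eq_integral do rewrite EFinM/=.
rewrite integralZl//= -EFin_RintegralE//= -EFinM => -[].
by move/mulfI => -> //; rewrite gt_eqF.
Qed.

(** The integral from [x0 - r] is an antiderivative inside the window, which is enough to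
    differentiate at [x0]. *)
Lemma local_antiderivative (g : R -> R) (x0 r : R) : 0 < r -> continuous g ->
  exists G : R -> R, forall y : R, `|y - x0| < r -> is_derive y 1 G (g y).
Proof.
move=> r0 gc; exists (fun y => \int[mu]_(t in `[x0 - r, y]) g t) => y.
rewrite ltr_distl => /andP[y1 y2].
have := @continuous_FTC1_closed R g (x0 - r) y (x0 + r) y2 _ y1 (gc y).
case.
  apply: continuous_compact_integrable; first exact: segment_compact.
  exact: continuous_subspaceT.
by move=> D1 D2; split; [exact: D1|rewrite -derive1E; exact: D2].
Qed.

Lemma is_derive_shift (f : R -> R) (a x d : R) :
  is_derive (x + a) 1 f d -> is_derive x 1 (fun y => f (y + a)) d.
Proof.
move=> fd; have H : is_derive x 1 (fun y : R => y + a) (1 + 0).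
  exact: is_deriveD.
rewrite addr0 in H.
by have := @is_derive1_comp R f (fun y => y + a) x d 1 fd H; rewrite mulr1.
Qed.

Lemma is_derive_shiftl (f : R -> R) (a x d : R) :
  is_derive (a + x) 1 f d -> is_derive x 1 (fun y => f (a + y)) d.
Proof.
move=> fd; rewrite (_ : (fun y => _) = (fun y => f (y + a))); last first.
  by apply/funext => z; rewrite addrC.
by apply: is_derive_shift; rewrite (addrC x).
Qed.

(** This is the derivative of [box_mean h g] for continuous [g], so each box mean buys one
    derivative. *)
Definition cdiff (g : R -> R) (x : R) := h^-1 * (g (x + h / 2) - g (x - h / 2)).

Lemma is_derive_cdiff (f f' : R -> R) : (forall x : R, is_derive x 1 f (f' x)) ->
  forall x : R, is_derive x 1 (cdiff f) (cdiff f' x).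
Proof.
move=> ff' x.
have H1 := is_derive_shift (ff' (x + h / 2)).
have H2 := is_derive_shift (ff' (x - h / 2)).
exact: (is_deriveZ h^-1 (is_deriveB H1 H2)).
Qed.

(** Near [x0] the box mean is the central difference quotient of a local antiderivative of [g]. *)
Lemma is_derive_box_mean (g : R -> R) : continuous g ->
  forall x : R, is_derive x 1 (box_mean h g) (cdiff g x).
Proof.
move=> gc x0; have r0 : 0 < h + 1 by rewrite addr_gt0.
have h2 : 0 < h / 2 by rewrite divr_gt0.
have [G Gd] := local_antiderivative x0 r0 gc.
apply: (@near_eq_is_derive _ _ _ (fun x => h^-1 *: (G (x + h / 2) - G (x - h / 2)))).
  near=> x.
  have x1 : `|x - x0| < 1 / 2.
    rewrite distrC; near: x; apply: cvgr_dist_lt; last by rewrite divr_gt0.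
    exact: cvg_id.
  have xz z : `|z| <= h / 2 -> `|x + z - x0| < h + 1.
    move=> zh; rewrite addrAC (le_lt_trans (ler_normD _ _))//; lra.
  rewrite /box_mean; congr (_ * _).
  rewrite /Rintegral (@continuous_FTC2 _ _ (fun z => G (x + z))) ?EFinB//=.
  - by rewrite gtrN.
  - apply: continuous_subspaceT => z.
    by apply: continuous_comp; [apply: continuousD => //; exact: cst_continuous|exact: gc].
  - split.
    + move=> z; rewrite in_itv/= => /andP[z1 z2].
      have /xz /Gd Gz : `|z| <= h / 2 by rewrite ler_norml !ltW.
      rewrite (_ : (fun z => _) = (fun y => G (y + x))); last first.
        by apply/funext => y; rewrite addrC.
      by rewrite addrC in Gz; case: (is_derive_shift Gz).
    + have /xz /Gd [/derivable1_diffP /differentiable_continuous Gz _] :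
        `|- (h / 2)| <= h / 2 by rewrite normrN gtr0_norm.
      apply: cvg_at_right_filter; apply: continuous_comp; last exact: Gz.
      by apply: continuousD => //; exact: cst_continuous.
    + have /xz /Gd [/derivable1_diffP /differentiable_continuous Gz _] :
        `|h / 2| <= h / 2 by rewrite gtr0_norm.
      apply: cvg_at_left_filter; apply: continuous_comp; last exact: Gz.
      by apply: continuousD => //; exact: cst_continuous.
  - move=> z; rewrite in_itv/= => /andP[z1 z2].
    have /xz /Gd Gz : `|z| <= h / 2 by rewrite ler_norml !ltW.
    rewrite (_ : (fun z => _) = (fun y => G (y + x))); last first.
      by apply/funext => y; rewrite addrC.
    rewrite addrC in Gz; have [_] := is_derive_shift Gz.
    by rewrite derive1E => ->; rewrite addrC.
apply: is_deriveZ; apply: is_deriveB; apply: is_derive_shift; apply: Gd.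
  by rewrite addrC addKr gtr0_norm//; lra.
by rewrite addrC addKr normrN gtr0_norm//; lra.
Unshelve. all: by end_near. Qed.

End box_mean.

(** The bound on [f1] is integrated by monotonicity: c x^(k+1) + f and c x^(k+1) - f vanish at 0 and
    have nonnegative derivatives. *)
Lemma le_power_of_derive (f f1 : R -> R) (c : R) (k : nat) : 0 <= c ->
  (forall x : R, is_derive x 1 f (f1 x)) -> f 0 = 0 ->
  (forall x : R, 0 <= x -> `|f1 x| <= c * k.+1%:R * x ^+ k) ->
  forall x : R, 0 <= x -> `|f x| <= c * x ^+ k.+1.
Proof.
move=> c0 fd f00 fc x x0.
have pd (y : R) : is_derive y 1 (fun y => c * y ^+ k.+1) (c * k.+1%:R * y ^+ k).
  have H : is_derive y 1 (fun y : R => y ^+ k.+1) (k.+1%:R *: y ^+ k *: 1).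
    by apply: DeriveDef; [exact: exprn_derivable|exact: exp_derive].
  by have := is_deriveZ c H; rewrite /GRing.scale/= mulr1 mulrA.
have mono (g g1 : R -> R) : (forall y : R, is_derive y 1 g (g1 y)) -> g 0 = 0 ->
    (forall y : R, 0 <= y -> 0 <= g1 y) -> 0 <= g x.
  move=> gd g0 g1p; rewrite -g0.
  have gc : continuous g.
    by move=> y; have [/derivable1_diffP/differentiable_continuous] := gd y.
  apply: (@ger0_derive1_le _ g 0 x _ _ true false) => //.
  - move=> y; rewrite in_itv/= => /andP[y0 _].
    by rewrite derive1E; have [_ ->] := gd y; rewrite g1p// ltW.
  - exact: continuous_subspaceT.
  - by rewrite in_itv/= lexx.
  - by rewrite in_itv/= lexx x0.
rewrite ler_norml -subr_ge0 opprK -[X in _ && X]subr_ge0; apply/andP; split.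
- apply: (mono (fun y => f y + c * y ^+ k.+1) (fun y => f1 y + c * k.+1%:R * y ^+ k)).
  + by rewrite f00 exprS mul0r mulr0 addr0.
  + by move=> y y0; have := fc y y0; rewrite ler_norml => /andP[]; lra.
- apply: (mono (fun y => c * y ^+ k.+1 - f y) (fun y => c * k.+1%:R * y ^+ k - f1 y)).
  + by rewrite f00 exprS mul0r mulr0 subr0.
  + by move=> y y0; have := fc y y0; rewrite ler_norml => /andP[]; lra.
Qed.

(** The remainders [r2], [r1], [r0] are successive antiderivatives vanishing at 0. The cubic bound
    starts from the bound on [u3], the quadratic one from the oscillation of [u2]. *)
Lemma taylor2_remainder_ge0 (u u1 u2 u3 : R -> R) (s K2 K3 : R) :
  0 <= K2 -> 0 <= K3 ->
  (forall x : R, is_derive x 1 u (u1 x)) -> (forall x : R, is_derive x 1 u1 (u2 x)) ->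
  (forall x : R, is_derive x 1 u2 (u3 x)) ->
  (forall x y, `|u2 x - u2 y| <= K2) -> (forall x, `|u3 x| <= K3) ->
  forall x : R, 0 <= x ->
  `|u (s + x) - (u s + u1 s * x + u2 s * x ^+ 2 / 2)| <= K3 / 6 * x ^+ 3 /\
  `|u (s + x) - (u s + u1 s * x + u2 s * x ^+ 2 / 2)| <= K2 / 2 * x ^+ 2.
Proof.
move=> K20 K30 d0 d1 d2 b2 b3.
have dl (f f' : R -> R) (y : R) : (forall x : R, is_derive x 1 f (f' x)) ->
    is_derive y 1 (fun x => f (s + x)) (f' (s + y)).
  by move=> ff'; exact: is_derive_shiftl.
have dlin (c : R) (y : R) : is_derive y 1 (fun x : R => c * x) c.
  by have := is_deriveZ c (is_derive_id y (1 : R)); rewrite /GRing.scale/= mulr1.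
pose r0 (x : R) := u (s + x) - (u s + u1 s * x + u2 s * x ^+ 2 / 2).
pose r1 (x : R) := u1 (s + x) - (u1 s + u2 s * x).
pose r2 (x : R) := u2 (s + x) - u2 s.
have D2 (y : R) : is_derive y 1 r2 (u3 (s + y)).
  by have := is_deriveB (dl _ _ y d2) (is_derive_cst (u2 s) y 1); rewrite subr0.
have D1 (y : R) : is_derive y 1 r1 (r2 y).
  have := is_deriveB (dl _ _ y d1)
    (is_deriveD (is_derive_cst (u1 s) y 1) (dlin (u2 s) y)).
  by rewrite add0r.
have dsq (c : R) (y : R) : is_derive y 1 (fun x : R => c * x ^+ 2 / 2) (c * y).
  rewrite (_ : (fun x => _) = (fun x => (c / 2) *: x ^+ 2)); last first.
    by apply/funext => x; rewrite mulrAC.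
  have H : is_derive y 1 (fun y : R => y ^+ 2) (2%:R *: y ^+ 1 *: 1).
    by apply: DeriveDef; [exact: exprn_derivable|exact: exp_derive].
  by have := is_deriveZ (c / 2) H; rewrite /GRing.scale/= mulr1 expr1 mulrA divfK.
have D0 (y : R) : is_derive y 1 r0 (r1 y).
  have := is_deriveB (dl _ _ y d0) (is_deriveD
    (is_deriveD (is_derive_cst (u s) y 1) (dlin (u1 s) y)) (dsq (u2 s) y)).
  by rewrite add0r.
have r00 : r0 0 = 0 by rewrite /r0 addr0 !mulr0 expr0n/= mulr0 mul0r !addr0 subrr.
have r10 : r1 0 = 0 by rewrite /r1 addr0 !mulr0 !addr0 subrr.
have r20 : r2 0 = 0 by rewrite /r2 addr0 subrr.
have B2 x : 0 <= x -> `|r2 x| <= K3 * x ^+ 1.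
  by apply: (@le_power_of_derive _ _ K3 0 K30 D2 r20) => y _; rewrite !mulr1.
have B1 x : 0 <= x -> `|r1 x| <= K3 / 2 * x ^+ 2.
  apply: (@le_power_of_derive _ _ (K3 / 2) 1 _ D1 r10) => //.
    by rewrite divr_ge0.
  by move=> y y0; rewrite divfK//; exact: B2.
have C1 x : 0 <= x -> `|r1 x| <= K2 * x ^+ 1.
  by apply: (@le_power_of_derive _ _ K2 0 K20 D1 r10) => y _; rewrite !mulr1; exact: b2.
move=> x x0; split.
- apply: (@le_power_of_derive _ _ (K3 / 6) 2 _ D0 r00) => //.
    by rewrite divr_ge0.
  move=> y y0; apply: (le_trans (B1 y y0)).
  by rewrite (_ : K3 / 6 * 3 = K3 / 2)//; field.
- apply: (@le_power_of_derive _ _ (K2 / 2) 1 _ D0 r00) => //.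
    by rewrite divr_ge0.
  by move=> y y0; rewrite divfK//; exact: C1.
Qed.

Lemma taylor2_remainder (u u1 u2 u3 : R -> R) (s K2 K3 : R) :
  0 <= K2 -> 0 <= K3 ->
  (forall x : R, is_derive x 1 u (u1 x)) -> (forall x : R, is_derive x 1 u1 (u2 x)) ->
  (forall x : R, is_derive x 1 u2 (u3 x)) ->
  (forall x y, `|u2 x - u2 y| <= K2) -> (forall x, `|u3 x| <= K3) ->
  forall x,
  `|u (s + x) - (u s + u1 s * x + u2 s * x ^+ 2 / 2)| <= K3 / 6 * `|x| ^+ 3 /\
  `|u (s + x) - (u s + u1 s * x + u2 s * x ^+ 2 / 2)| <= K2 / 2 * x ^+ 2.
Proof.
move=> K20 K30 d0 d1 d2 b2 b3 x.
have [x0|x0] := leP 0 x.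
  by rewrite (ger0_norm x0); exact: (taylor2_remainder_ge0 s K20 K30 d0 d1 d2).
have dN (f f' : R -> R) : (forall x : R, is_derive x 1 f (f' x)) ->
    forall y : R, is_derive y 1 (fun x => f (- x)) (- f' (- y)).
  move=> ff' y; have H : is_derive y 1 (fun y : R => - y) (- 1) by exact: is_deriveN.
  by have := is_derive1_comp (ff' (- y)) H; rewrite mulrN1.
have dNN (f f' : R -> R) : (forall x : R, is_derive x 1 f (f' x)) ->
    forall y : R, is_derive y 1 (fun x => - f (- x)) (f' (- y)).
  by move=> ff' y; have := is_deriveN (dN _ _ ff' y); rewrite opprK.
have b2' (y z : R) : `|u2 (- y) - u2 (- z)| <= K2 by [].
have b3' (y : R) : `|- u3 (- y)| <= K3 by rewrite normrN.
have := @taylor2_remainder_ge0 (fun x => u (- x)) (fun x => - u1 (- x))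
  (fun x => u2 (- x)) (fun x => - u3 (- x)) (- s) K2 K3 K20 K30
  (dN _ _ d0) (dNN _ _ d1) (dN _ _ d2) b2' b3' (- x).
rewrite opprD !opprK mulrNN sqrrN oppr_ge0 => /(_ (ltW x0)).
by rewrite (ltr0_norm x0).
Qed.

Lemma cdiff_bound h g a b (h0 : 0 < h) : (forall x, a <= g x <= b) ->
  forall x, - (h^-1 * (b - a)) <= cdiff h g x <= h^-1 * (b - a).
Proof.
move=> gab x; rewrite -ler_norml /cdiff normrM gtr0_norm ?invr_gt0//.
rewrite ler_pM2l ?invr_gt0// ler_norml.
have := gab (x + h / 2); have := gab (x - h / 2); lra.
Qed.

(* [u], the threefold box mean of [g], has [u'] = cdiff (box_mean^2 g),
   [u''] = cdiff^2 (box_mean g) and [u'''] = cdiff^3 g. *)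
Lemma box_mean3_taylor (h L : R) (g : R -> R) (s x : R) : 0 < h -> lip01 L g ->
  let u := box_mean h (box_mean h (box_mean h g)) in
  let r := u (s + x) - (u s + cdiff h (box_mean h (box_mean h g)) s * x +
     cdiff h (cdiff h (box_mean h g)) s * x ^+ 2 / 2) in
  `|r| <= 2 / 3 / h ^+ 3 * `|x| ^+ 3 /\ `|r| <= 2 / h ^+ 2 * x ^+ 2.
Proof.
move=> h0 gl u r.
have l1 := lip01_box_mean h0 gl; have l2 := lip01_box_mean h0 l1.
have D0 := is_derive_box_mean h0 (lip01_continuous l2).
have D1 := is_derive_cdiff h (is_derive_box_mean h0 (lip01_continuous l1)).
have D2 := is_derive_cdiff h (is_derive_cdiff h
  (is_derive_box_mean h0 (lip01_continuous gl))).
have i0 : 0 <= h^-1 by rewrite invr_ge0 ltW.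
(* A difference quotient of a function with values in an interval of length l lies within l/h of 0.
   Applied twice this gives the range 2/h^2 and hence the oscillation 4/h^2. *)
have B2 : forall y, - (h^-1 * (h^-1 * (1 - 0) - - (h^-1 * (1 - 0)))) <=
    cdiff h (cdiff h (box_mean h g)) y <=
    h^-1 * (h^-1 * (1 - 0) - - (h^-1 * (1 - 0))).
  by apply: cdiff_bound => //; apply: cdiff_bound => //; exact: l1.1.
(* The third difference is an alternating sum of eight values in [0, 1], four of each sign. *)
have B3 y : `|cdiff h (cdiff h (cdiff h g)) y| <= 4 / h ^+ 3.
  have := gl.1 (y + h / 2 + h / 2 + h / 2).
  have := gl.1 (y + h / 2 + h / 2 - h / 2).
  have := gl.1 (y + h / 2 - h / 2 + h / 2).
  have := gl.1 (y + h / 2 - h / 2 - h / 2).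
  have := gl.1 (y - h / 2 + h / 2 + h / 2).
  have := gl.1 (y - h / 2 + h / 2 - h / 2).
  have := gl.1 (y - h / 2 - h / 2 + h / 2).
  have := gl.1 (y - h / 2 - h / 2 - h / 2).
  rewrite /cdiff -!mulrBr !mulrA !normrM gtr0_norm ?invr_gt0//.
  rewrite (_ : h^-1 * h^-1 * h^-1 = (h ^+ 3)^-1); last by rewrite -!invfM -expr2 -exprSr.
  move=> *; rewrite mulrC ler_wpM2r ?invr_ge0 ?exprn_ge0 ?(ltW h0)//.
  by rewrite ler_norml; lra.
have K2 : 0 <= 4 / h ^+ 2 by rewrite divr_ge0// sqr_ge0.
have K3 : 0 <= 4 / h ^+ 3 by rewrite divr_ge0// exprn_ge0// ltW.
have b2 y z : `|cdiff h (cdiff h (box_mean h g)) y -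
    cdiff h (cdiff h (box_mean h g)) z| <= 4 / h ^+ 2.
  have := B2 y; have := B2 z.
  rewrite (_ : h^-1 * (h^-1 * (1 - 0) - - (h^-1 * (1 - 0))) = 2 / h ^+ 2).
    by move=> *; rewrite ler_norml; lra.
  by field; rewrite gt_eqF.
have [T3 T2] := taylor2_remainder s K2 K3 D0 D1 D2 b2 B3 x.
split; first by apply: (le_trans T3); rewrite (mulrAC 4) (_ : 4 / 6 = 2 / 3)//; field.
by apply: (le_trans T2); rewrite (mulrAC 4) (_ : 4 / 2 = 2)//; field.
Qed.

End lipschitz_means.

(** * Hybrid functionals *)

Section hybrid.
Context {R : realType}.
Implicit Types (x : nat -> R) (F : (nat -> R) -> R).

Definition upd x (k : nat) (v : R) : nat -> R := fun i => if i == k then v else x i.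

Lemma upd_same x k v : upd x k v k = v. Proof. by rewrite /upd eqxx. Qed.

Lemma upd_neq x k v i : i != k -> upd x k v i = x i.
Proof. by rewrite /upd => /negbTE ->. Qed.

Lemma upd_upd x k v w : upd (upd x k v) k w = upd x k w.
Proof. by apply/funext => i; rewrite /upd; case: eqP. Qed.

Lemma updC x k l v w : k != l -> upd (upd x k v) l w = upd (upd x l w) k v.
Proof.
move=> kl; apply/funext => i; rewrite /upd; case: (eqVneq i l) => // ->.
by rewrite eq_sym (negbTE kl).
Qed.

(** Taking M = 0, such an [F] ignores all coordinates beyond k; infinite sequences thus stand for
    finite histories. *)
Definition slip (L : R) (k : nat) F := forall x y (M : R),
  (forall i, (i <= k)%N -> `|x i - y i| <= M) -> `|F x - F y| <= L * M.

Definition slip01 (L : R) (k : nat) F := (forall x, 0 <= F x <= 1) /\ slip L k F.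

Lemma slip01_section L k F x j : slip01 L k F -> lip01 L (fun v => F (upd x j v)).
Proof.
move=> [F01 Fl]; split=> // v w; apply: Fl => i _; rewrite /upd.
by case: eqP => // _; rewrite subrr normr0.
Qed.

Variable nu : probability (measurableTypeR R) R.

Definition step (k : nat) F x : R := \int[nu]_w F (upd x k.+1 (x k + w)).

(** The expectation of [F], given the positions up to k, when the walk makes m further steps of law
    [nu]. *)
Fixpoint chain (m k : nat) F : (nat -> R) -> R :=
  if m is m'.+1 then step k (chain m' k.+1 F) else F.

Lemma lip01_step_fun L k l F x : slip01 L l F ->
  lip01 L (fun w => F (upd x k.+1 (x k + w))).
Proof. by move=> Fl; exact: (lip01_shiftl (x k) (slip01_section x k.+1 Fl)). Qed.

Lemma slip01_step L k F : slip01 L k.+1 F -> slip01 L k (step k F).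
Proof.
move=> Fl; split=> [x|x y M xy].
- have c0 : lip01 0 (fun=> 0 : R) by apply: lip01_cst; rewrite lexx ler01.
  have c1 : lip01 0 (fun=> 1 : R) by apply: lip01_cst; rewrite lexx ler01.
  apply/andP; split.
  + rewrite -(mean_cst nu 0); apply: (mean_le _ c0 (lip01_step_fun k x Fl)) => w.
    by have /andP[] := Fl.1 (upd x k.+1 (x k + w)).
  + rewrite -(mean_cst nu 1); apply: (mean_le _ (lip01_step_fun k x Fl) c1) => w.
    by have /andP[] := Fl.1 (upd x k.+1 (x k + w)).
- apply: (mean_dist _ (lip01_step_fun k x Fl) (lip01_step_fun k y Fl)) => w.
  apply: Fl.2 => i; rewrite leq_eqVlt ltnS => /predU1P[->|ik].
    by rewrite !upd_same opprD addrACA subrr addr0; apply: xy.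
  by rewrite !upd_neq ?ltn_eqF ?ltnS//; apply: xy.
Qed.

Lemma slip01_chain L m k F : slip01 L (k + m)%N F -> slip01 L k (chain m k F).
Proof.
elim: m k => [|m IH] k /=; first by rewrite addn0.
by rewrite addnS -addSn => /IH; exact: slip01_step.
Qed.

Lemma chain_le_upd L (delta : R) m j k F F' y : (k < j)%N ->
  slip01 L (j + m)%N F -> slip01 L (j + m)%N F' ->
  (forall x, `|y - x k| <= delta -> F x <= F' (upd x k y)) ->
  forall x, `|y - x k| <= delta -> chain m j F x <= chain m j F' (upd x k y).
Proof.
elim: m j => [//|m IH] j kj Fl Fl' FF' x xy /=.
rewrite addnS -addSn in Fl Fl'.
have cl := slip01_chain Fl; have cl' := slip01_chain Fl'.
apply: (mean_le _ (lip01_step_fun j x cl) (lip01_step_fun j _ cl')) => w.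
rewrite (upd_neq _ _ (negbT (gtn_eqF kj))).
rewrite -updC ?gtn_eqF ?ltnS ?(ltnW kj)//.
apply: IH => //; first exact: ltnW.
by rewrite upd_neq// ltn_eqF// ltnS ltnW.
Qed.

(** * A Lipschitz indicator with tolerance *)

Variables (n : nat) (eta delta : R) (A : set (nat -> R)).
Hypotheses (eta0 : 0 < eta) (delta0 : 0 < delta).

(* Lipschitz version of the indicator that [x] lies in [A] up to [delta] in the
   coordinates [k <= i <= n] and exactly in the coordinates [i < k]. *)
Definition near_set (k : nat) (x : nat -> R) : set R := [set t | 0 <= t <= 1 /\
  (t = 0 \/ exists2 a, A a & forall i, (i <= n)%N ->
    `|x i - a i| <= (1 - t) * eta + (if (k <= i)%N then delta else 0))].

Definition near_ind (k : nat) (x : nat -> R) : R := sup (near_set k x).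

Lemma near_set0 k x : near_set k x 0.
Proof. by split; [rewrite lexx ler01|left]. Qed.

Lemma near_set_ubound k x : has_ubound (near_set k x).
Proof. by exists 1 => t [/andP[]]. Qed.

Lemma near_set_has_sup k x : has_sup (near_set k x).
Proof. by split; [exists 0; exact: near_set0|exact: near_set_ubound]. Qed.

Lemma near_ind01 k x : 0 <= near_ind k x <= 1.
Proof.
apply/andP; split; first exact: (ub_le_sup (near_set_ubound k x) (near_set0 k x)).
by apply: ge_sup; [exists 0; exact: near_set0|move=> t [/andP[]]].
Qed.

(** Moving [x] by M is compensated by lowering t by M / eta, which raises the allowed distance (1 -
    t) eta by M. *)
Lemma near_ind_slip k : slip01 eta^-1 n (near_ind k).
Proof.
split; first exact: near_ind01.
have H x y (M : R) : (forall i, (i <= n)%N -> `|x i - y i| <= M) ->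
    near_ind k x <= near_ind k y + eta^-1 * M.
  move=> xy; have M0 : 0 <= M by apply: le_trans (xy 0%N _).
  apply: ge_sup; first by exists 0; exact: near_set0.
  move=> t [/andP[t0 t1] tA]; rewrite -lerBlDr.
  have [tM|tM] := leP (t - eta^-1 * M) 0.
    by apply: (le_trans tM); have /andP[] := near_ind01 k y.
  apply: (ub_le_sup (near_set_ubound k y)); split.
    rewrite (ltW tM) (le_trans _ t1)// gerBl mulr_ge0// invr_ge0 ltW//.
  right; case: tA => [t00|[a Aa xa]].
    by move: tM; rewrite t00 sub0r oppr_gt0 ltNge mulr_ge0// invr_ge0 ltW.
  exists a => // i ik.
  have -> : (1 - (t - eta^-1 * M)) * eta = (1 - t) * eta + M.
    by field; rewrite gt_eqF.
  have := xa i ik; have := xy i ik; have := ler_distD (x i) (y i) (a i).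
  rewrite (distrC (y i) (x i)); lra.
move=> x y M xy; rewrite ler_distlC; apply/andP; split.
- by rewrite lerBlDr; apply: H.
- by apply: H => i ik; rewrite distrC; apply: xy.
Qed.

(** Coordinate k is compared without tolerance in [near_ind k.+1] and with tolerance delta in
    [near_ind k]; the gain absorbs the replacement of [x k] by [y]. *)
Lemma near_ind_succ k x y : (k <= n)%N -> `|y - x k| <= delta ->
  near_ind k.+1 x <= near_ind k (upd x k y).
Proof.
move=> kn xy; apply: ge_sup; first by exists 0; exact: near_set0.
move=> t [t01 tA]; apply: (ub_le_sup (near_set_ubound k _)); split=> //.
case: tA => [->|[a Aa xa]]; [by left|right; exists a => // i ik].
have := xa i ik; rewrite /upd; case: (eqVneq i k) => [->|ik'].
  rewrite leqnn ltnn addr0 => xka.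
  by have := ler_distD (x k) y (a k); lra.
by rewrite (ltn_neqAle k i) eq_sym ik'.
Qed.

Lemma near_ind_mem k x a : A a ->
  (forall i, (i <= n)%N -> `|x i - a i| <= if (k <= i)%N then delta else 0) ->
  near_ind k x = 1.
Proof.
move=> Aa xa; apply/eqP; rewrite eq_le; have /andP[_ ->] /= := near_ind01 k x.
apply: (ub_le_sup (near_set_ubound k _)); split; first by rewrite ler01 lexx.
by right; exists a => // i ik; rewrite subrr mul0r add0r; exact: xa.
Qed.

Lemma near_ind_gt0 k x : 0 < near_ind k x ->
  exists2 a, A a & forall i, (i <= n)%N -> `|x i - a i| <= eta + delta.
Proof.
move=> t0; have [t [/andP[t0' t1] tA] tx] := sup_adherent t0 (near_set_has_sup k x).
move: tx; rewrite subrr => {}t0'.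
case: tA => [t00|[a Aa xa]]; first by rewrite t00 ltxx in t0'.
exists a => // i ik; apply: (le_trans (xa i ik)); apply: lerD.
  by rewrite ler_piMl ?(ltW eta0)//; lra.
by case: ifP => // _; exact: ltW.
Qed.

(** * Smoothed hybrid functionals *)

Let h : R := 2 / 3 * delta.
Let h0 : 0 < h. Proof. by rewrite mulr_gt0// divr_gt0. Qed.
(** Three nested windows of half-width h/2 reach exactly as far as the tolerance delta. *)
Let h3 : h / 2 + h / 2 + h / 2 = delta. Proof. by rewrite /h; lra. Qed.

Definition box_mean3 (g : R -> R) := box_mean h (box_mean h (box_mean h g)).

Lemma lip01_box_mean3 L g : lip01 L g -> lip01 L (box_mean3 g).
Proof. by move=> gl; do 3 (apply: (lip01_box_mean h0)). Qed.

Lemma box_mean3_le L L' f g (x : R) : lip01 L f -> lip01 L' g ->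
  (forall y, `|y - x| <= delta -> f y <= g y) -> box_mean3 f x <= box_mean3 g x.
Proof.
move=> fl gl fg.
have fl1 := lip01_box_mean h0 fl; have gl1 := lip01_box_mean h0 gl.
have fl2 := lip01_box_mean h0 fl1; have gl2 := lip01_box_mean h0 gl1.
apply: (box_mean_le h0 fl2 gl2) => y yx.
apply: (box_mean_le h0 fl1 gl1) => z zy.
apply: (box_mean_le h0 fl gl) => v vz.
apply: fg; rewrite -h3.
by have := ler_distD z v x; have := ler_distD y z x; lra.
Qed.

Lemma box_mean3_cst (c x : R) : box_mean3 (fun=> c) x = c.
Proof.
rewrite /box_mean3; have E (d : R) : box_mean h (fun=> d) = (fun=> d).
  by apply/funext => z; rewrite box_mean_cst.
by rewrite !E.
Qed.

Lemma box_mean3_mean L g (x : R) : lip01 L g ->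
  \int[nu]_w box_mean3 g (x + w) = box_mean3 (fun y => \int[nu]_w g (y + w)) x.
Proof.
move=> gl; have l1 := lip01_box_mean h0 gl; have l2 := lip01_box_mean h0 l1.
rewrite /box_mean3 (box_mean_mean h0 _ _ l2); congr box_mean.
apply/funext => y; rewrite (box_mean_mean h0 _ _ l1); congr box_mean.
by apply/funext => z; rewrite (box_mean_mean h0 _ _ gl).
Qed.

(** V_k of the overview as a function of the whole history; [hybrid] below averages it in coordinate
    k. *)
Definition hybrid_tail (k : nat) := chain (n - k) k (near_ind k).

Definition hybrid (k : nat) x : R :=
  box_mean3 (fun y => hybrid_tail k (upd x k y)) (x k).

Lemma hybrid_tail_slip k : (k <= n)%N -> slip01 eta^-1 k (hybrid_tail k).
Proof.
by move=> kn; apply: slip01_chain; rewrite subnKC//; exact: near_ind_slip.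
Qed.

Lemma lip01_hybrid_tail k x j : (k <= n)%N ->
  lip01 eta^-1 (fun y => hybrid_tail k (upd x j y)).
Proof. by move=> kn; exact: slip01_section (hybrid_tail_slip kn). Qed.

Lemma hybrid_upd k x y :
  hybrid k (upd x k y) = box_mean3 (fun v => hybrid_tail k (upd x k v)) y.
Proof.
rewrite /hybrid upd_same; set g := fun v => _.
by have -> : g = fun v => hybrid_tail k (upd x k v)
  by apply/funext => v; rewrite /g upd_upd.
Qed.

Lemma hybrid01 k x : (k <= n)%N -> 0 <= hybrid k x <= 1.
Proof.
by move=> kn; have /lip01_box_mean3[+ _] := lip01_hybrid_tail x k kn; apply.
Qed.

(* The sections at two histories differ by at most [L M], and so do
   their box means, also when evaluated at points that are [M]-close. *)
Lemma slip_section_op (B : (R -> R) -> R -> R) L k j F :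
  (forall g, lip01 L g -> lip01 L (B g)) ->
  (forall g g' (c v : R), lip01 L g -> lip01 L g' ->
     (forall y, `|g y - g' y| <= c) -> `|B g v - B g' v| <= c) ->
  slip01 L j F -> (forall x y (M : R), (forall i, (i <= k)%N -> `|x i - y i| <= M) ->
    forall v, `|F (upd x j v) - F (upd y j v)| <= L * M) ->
  forall c, slip (2 * L) k (fun x => B (fun v => F (upd x j v)) (x k + c)).
Proof.
move=> Bl Bd Fl FM c x y M xy.
have lx := slip01_section x j Fl; have ly := slip01_section y j Fl.
apply: (le_trans (ler_distD (B (fun v => F (upd x j v)) (y k + c)) _ _)).
rewrite mulrDl mul1r mulrDl; apply: lerD.
- apply: (le_trans ((Bl _ lx).2 _ _)).
  rewrite opprD addrACA subrr addr0.
  have L0 : 0 <= L.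
    by have := le_trans (normr_ge0 _) (lx.2 1 0); rewrite subr0 normr1 mulr1.
  by rewrite ler_wpM2l//; exact: xy.
- by apply: Bd => // v; exact: FM.
Qed.

Lemma hybrid_tail_upd_dist k j x y (M : R) : (k <= n)%N -> (j <= k <= j.+1)%N ->
  (forall i, (i <= j)%N -> `|x i - y i| <= M) ->
  forall v, `|hybrid_tail k (upd x k v) - hybrid_tail k (upd y k v)| <= eta^-1 * M.
Proof.
move=> kn /andP[jk kj] xy v; apply: (hybrid_tail_slip kn).2 => i ik.
rewrite /upd; case: eqP => [_|/eqP ik'].
  by rewrite subrr normr0; apply: le_trans (xy 0%N _).
by apply: xy; rewrite -ltnS (leq_trans _ kj)// ltn_neqAle ik'.
Qed.

Lemma slip_hybrid k : (k <= n)%N -> slip (2 * eta^-1) k (hybrid k).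
Proof.
move=> kn x y M xy.
rewrite /hybrid -[x k]addr0 -[y k]addr0.
apply: (@slip_section_op box_mean3 eta^-1 k k (hybrid_tail k)) => //.
- by move=> g; exact: lip01_box_mean3.
- move=> g g' c v gl gl' gg'.
  have l1 := lip01_box_mean h0 gl; have l2 := lip01_box_mean h0 l1.
  have l1' := lip01_box_mean h0 gl'; have l2' := lip01_box_mean h0 l1'.
  apply: (box_mean_dist h0 _ l2 l2') => ?; apply: (box_mean_dist h0 _ l1 l1') => ?.
  exact: (box_mean_dist h0 _ gl gl').
- exact: hybrid_tail_slip.
- by move=> ? ? ? ? ?; apply: (@hybrid_tail_upd_dist k k) => //; rewrite leqnn leqnSn.
Qed.

(** The first derivative of the smoothed V_(k+1) in its last argument, taken at increment 0. It
    reads only coordinates up to k, so it is known before increment k+1 is drawn; [curvature] is the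
    second derivative. *)
Definition slope (k : nat) x : R :=
  cdiff h (box_mean h (box_mean h (fun y => hybrid_tail k.+1 (upd x k.+1 y)))) (x k).

Definition curvature (k : nat) x : R :=
  cdiff h (cdiff h (box_mean h (fun y => hybrid_tail k.+1 (upd x k.+1 y)))) (x k).

Lemma slip_cdiff L k (F : (nat -> R) -> R -> R) :
  (forall c, slip L k (fun x => F x (x k + c))) ->
  forall c, slip (h^-1 * (L + L)) k (fun x => cdiff h (F x) (x k + c)).
Proof.
move=> FL c x y M xy; rewrite /cdiff -mulrBr normrM gtr0_norm ?invr_gt0//.
rewrite -(mulrA h^-1 (L + L)) ler_pM2l ?invr_gt0// mulrDl.
have := FL (c + h / 2) x y M xy; have := FL (c - h / 2) x y M xy.
rewrite !addrA !ler_norml; lra.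
Qed.

(** Lipschitz dependence on the history is what later makes the chosen mean and deviation continuous
    functions of it. *)
Lemma slope_slip k : (k < n)%N -> exists L, slip L k (slope k).
Proof.
move=> kn; exists (h^-1 * (2 * eta^-1 + 2 * eta^-1)).
move=> x y M xy; rewrite /slope -[x k]addr0 -[y k]addr0.
apply: (@slip_cdiff (2 * eta^-1) k (fun x => box_mean h
  (box_mean h (fun y => hybrid_tail k.+1 (upd x k.+1 y))))) => // c.
apply: (@slip_section_op (fun g => box_mean h (box_mean h g)) eta^-1 k k.+1).
- by move=> g gl; do 2 (apply: (lip01_box_mean h0)).
- move=> g g' d v gl gl' gg'.
  have l1 := lip01_box_mean h0 gl; have l1' := lip01_box_mean h0 gl'.
  apply: (box_mean_dist h0 _ l1 l1') => z; exact: (box_mean_dist h0 _ gl gl').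
- exact: hybrid_tail_slip.
- by move=> ? ? ? ? ?; apply: (@hybrid_tail_upd_dist k.+1 k) => //; rewrite leqnSn leqnn.
Qed.

Lemma curvature_slip k : (k < n)%N -> exists L, slip L k (curvature k).
Proof.
move=> kn; pose L1 := h^-1 * (2 * eta^-1 + 2 * eta^-1).
exists (h^-1 * (L1 + L1)).
move=> x y M xy; rewrite /curvature -[x k]addr0 -[y k]addr0.
apply: (@slip_cdiff L1 k (fun x => cdiff h
  (box_mean h (fun y => hybrid_tail k.+1 (upd x k.+1 y))))) => //.
apply: slip_cdiff => c.
apply: (@slip_section_op (fun g => box_mean h g) eta^-1 k k.+1).
- by move=> g gl; apply: (lip01_box_mean h0).
- by move=> g g' d v gl gl' gg'; exact: (box_mean_dist h0 _ gl gl').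
- exact: hybrid_tail_slip.
- by move=> ? ? ? ? ?; apply: (@hybrid_tail_upd_dist k.+1 k) => //; rewrite leqnSn leqnn.
Qed.

(** For h = 2/3 delta the coefficients 2/(3 h^3) and 2/h^2 become 9/(4 delta^3) and 9/(2
    delta^2). *)
Lemma hybrid_taylor k x z : (k < n)%N ->
  let r := hybrid k.+1 (upd x k.+1 (x k + z)) - (hybrid k.+1 (upd x k.+1 (x k))
     + slope k x * z + curvature k x * z ^+ 2 / 2) in
  `|r| <= 9 / 4 * (`|z| / delta) ^+ 3 /\ `|r| <= 9 / 2 * (z / delta) ^+ 2.
Proof.
move=> kn r.
have [T3 T2] := box_mean3_taylor (x k) z h0 (lip01_hybrid_tail x k.+1 kn).
rewrite /r !hybrid_upd; split.
- apply: (le_trans T3); rewrite le_eqVlt; apply/orP; left; apply/eqP.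
  by rewrite /h; field; rewrite gt_eqF.
- apply: (le_trans T2); rewrite le_eqVlt; apply/orP; left; apply/eqP.
  by rewrite /h; field; rewrite gt_eqF.
Qed.

(** The Gaussian mean is moved inside the box means, which then average over y within delta of
    [x k]. On both sides coordinate k+1 is y + w; only coordinate k differs, being [x k] on the left
    and y on the right, and the tolerance gained at k pays for that. *)
Lemma step_hybrid_le k x : (k < n)%N -> step k (hybrid k.+1) x <= hybrid k x.
Proof.
move=> kn; have gl := lip01_hybrid_tail x k.+1 kn.
rewrite /step; under eq_Rintegral do rewrite hybrid_upd.
rewrite (box_mean3_mean _ gl).
have ml : lip01 eta^-1 (fun y => \int[nu]_w hybrid_tail k.+1 (upd x k.+1 (y + w))).
  by apply: lip01_mean => y; [exact: lip01_shiftl y gl|exact: lip01_shift y gl].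
apply: (box_mean3_le ml (lip01_hybrid_tail x k (ltnW kn))) => y yx.
rewrite [X in _ <= X]/hybrid_tail -[(n - k)%N]prednK ?subn_gt0// -subnS /=.
have nl : slip01 eta^-1 (k.+1 + (n - k.+1))%N (near_ind k.+1).
  by rewrite subnKC//; exact: near_ind_slip.
have nl' : slip01 eta^-1 (k.+1 + (n - k.+1))%N (near_ind k).
  by rewrite subnKC//; exact: near_ind_slip.
have cl' := slip01_chain nl'.
apply: (mean_le _ (lip01_shiftl y gl) (lip01_step_fun k _ cl')) => w.
rewrite upd_same updC ?ltn_eqF//.
apply: (@chain_le_upd _ delta _ _ _ _ _ _ (ltnSn k) nl nl'); last by rewrite upd_neq ?ltn_eqF.
by move=> x' xy'; apply: near_ind_succ => //; exact: ltnW.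
Qed.

(** The box means move coordinate n alone, by at most delta, which [near_ind n] tolerates. *)
Lemma hybrid_ge1 x : A x -> 1 <= hybrid n x.
Proof.
move=> Ax; rewrite -[leLHS](box_mean3_cst 1 (x n)).
apply: box_mean3_le.
- by apply: lip01_cst; rewrite ler01 lexx.
- exact: lip01_hybrid_tail.
move=> y yx; rewrite /hybrid_tail subnn/= (near_ind_mem Ax)// => i ik.
rewrite /upd; case: eqP => [->|/eqP ik']; first by rewrite leqnn.
by rewrite subrr normr0; case: ifP => // _; exact: ltW.
Qed.

Lemma hybrid0_le x (c : R) : 0 <= c <= 1 ->
  (forall y, `|y - x 0%N| <= delta -> chain n 0 (near_ind 0) (upd x 0 y) <= c) ->
  hybrid 0 x <= c.
Proof.
move=> c01 xc; rewrite -[leRHS](box_mean3_cst c (x 0%N)).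
apply: box_mean3_le; first exact: lip01_hybrid_tail.
  exact: lip01_cst c01.
by move=> y yx; rewrite /hybrid_tail subn0; exact: xc.
Qed.

End hybrid.

(** * Integrals over independent increments *)

Section measurability_lipschitz.
Context {R : realType} {d : measure_display} {T : measurableType d}.

Lemma measurable_fun_ltP (f : T -> R) :
  (forall c : R, measurable [set w | f w < c]) -> measurable_fun [set: T] f.
Proof.
move=> fc; apply: (measurability (@RGenInftyO.G R)) => [|/= _ [_] [r] -> <-].
  exact: RGenInftyO.measurableE.
rewrite setTI (_ : _ @^-1` _ = [set w | f w < r])//.
Qed.

(* A Lipschitz function is the infimal convolution over the rationals of its
   values with [L |. - .|]. *)
Lemma measurable_lipschitz_comp (Phi : T -> R -> R) (D : T -> R) (L : R) :
  (forall v, measurable_fun [set: T] (Phi^~ v)) ->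
  (forall w x y, `|Phi w x - Phi w y| <= L * `|x - y|) ->
  measurable_fun [set: T] D -> measurable_fun [set: T] (fun w => Phi w (D w)).
Proof.
move=> mPhi PhiL mD; apply: measurable_fun_ltP => c.
rewrite (_ : [set w | _] =
  \bigcup_q [set w | Phi w (ratr q) + L * `|ratr q - D w| < c]).
  apply: bigcupT_measurable_rat => q.
  rewrite -[X in measurable X]setTI.
  have := @measurable_fun_ltr _ _ _ [set: T]
    (fun w => Phi w (ratr q) + L * `|ratr q - D w|) (cst c).
  move=> /(_ _ _ measurableT [set true]); apply => //.
  apply: measurable_funD => //; apply: measurable_funM => //.
  by apply: measurableT_comp => //; apply: measurable_funB.
apply/seteqP; split => [w /= wc|w [q _] /= qc]; last first.
  have := PhiL w (ratr q) (D w); rewrite ler_distlC => /andP[_]; lra.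
have L0 : 0 <= L.
  by have := le_trans (normr_ge0 _) (PhiL w 1 0); rewrite subr0 normr1 mulr1.
have e0 : 0 < (c - Phi w (D w)) / (2 * L + 1).
  by rewrite divr_gt0 ?subr_gt0// ltr_wpDl// mulr_ge0.
have /rat_in_itvoo[q] : D w < D w + (c - Phi w (D w)) / (2 * L + 1).
  by rewrite ltrDl.
rewrite in_itv/= => /andP[q1 q2]; exists q => //=.
have qD : `|ratr q - D w| < (c - Phi w (D w)) / (2 * L + 1).
  by rewrite ger0_norm ?subr_ge0 ?ltW// ltrBlDl.
have := PhiL w (ratr q) (D w); rewrite ler_distl => /andP[_ PhiD].
have : 2 * L * `|ratr q - D w| < c - Phi w (D w).
  apply: (@le_lt_trans _ _ ((2 * L) * ((c - Phi w (D w)) / (2 * L + 1)))).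
    by rewrite ler_wpM2l ?mulr_ge0// ltW.
  rewrite mulrCA -[ltRHS]mulr1 ltr_pM2l ?subr_gt0//.
  by rewrite ltr_pdivrMr ?mul1r ?ltrDl// ltr_wpDl// mulr_ge0.
lra.
Qed.

(** The space of sequences carries no sigma-algebra here. Random coordinates are inserted one at a
    time, each insertion being a Lipschitz composition. *)
Lemma measurable_slip L k (F : (nat -> R) -> R) (x : nat -> T -> R) :
  slip L k F -> (forall i, measurable_fun [set: T] (x i)) ->
  measurable_fun [set: T] (fun w => F (x ^~ w)).
Proof.
move=> Fl mx.
have H j : forall y, measurable_fun [set: T]
    (fun w => F (fun i => if (i < j)%N then x i w else y i)).
  elim: j => [|j IH] y.
    rewrite (_ : (fun w => _) = cst (F y)); first exact: measurable_cst.
    by apply/funext => w /=; congr F; apply/funext => i; rewrite ltn0.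
  have -> : (fun w => F (fun i => if (i < j.+1)%N then x i w else y i)) =
      (fun w => F (upd (fun i => if (i < j)%N then x i w else y i) j (x j w))).
    apply/funext => w; congr F; apply/funext => i; rewrite /upd ltnS leq_eqVlt.
    by case: eqP => [->|].
  apply: (@measurable_lipschitz_comp (fun w v =>
    F (upd (fun i => if (i < j)%N then x i w else y i) j v)) (x j) L) => // [v|w u v].
  - rewrite (_ : (fun w => _) = (fun w => F (fun i => if (i < j)%N then x i w
      else upd y j v i))); first exact: IH.
    apply/funext => w; congr F; apply/funext => i; rewrite /upd.
    by case: eqP => [->|]; rewrite ?ltnn.
  - by apply: Fl => i _; rewrite /upd; case: eqP => // _; rewrite subrr normr0.
have -> : (fun w => F (x ^~ w)) =
    (fun w => F (fun i => if (i < k.+1)%N then x i w else 0)).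
  apply/funext => w; apply/eqP; rewrite -subr_eq0 -normr_le0.
  have := Fl (x ^~ w) (fun i => if (i < k.+1)%N then x i w else 0) 0.
  rewrite mulr0; apply => i ik; by rewrite ltnS ik subrr normr0.
exact: H.
Qed.

Lemma integrable_bounded (m : {finite_measure set T -> \bar R}) (D : set T)
    (f : T -> R) (c : R) : measurable D -> measurable_fun [set: T] f ->
  (forall w, `|f w| <= c) -> m.-integrable D (EFin \o f).
Proof.
move=> mD mf fc; apply: measurable_bounded_integrable => //.
- by rewrite ltey_eq fin_num_measure.
- exact: measurable_funTS.
exists c; split; first exact: num_real.
by move=> M cM w _ /=; rewrite (le_trans (fc w))// ltW.
Qed.

Lemma Rintegral_dist_le (m : {finite_measure set T -> \bar R}) (D : set T)
    (f g : T -> R) (c : R) : measurable D -> 0 <= c ->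
  m.-integrable D (EFin \o f) -> m.-integrable D (EFin \o g) ->
  (forall w, D w -> `|f w - g w| <= c) ->
  `|\int[m]_(w in D) f w - \int[m]_(w in D) g w| <= c * fine (m D).
Proof.
move=> mD c0 fi gi fg.
have ci : m.-integrable D (EFin \o cst c).
  exact: (integrable_bounded _ (c := `|c|)).
rewrite -(Rintegral_cst m mD) ler_distlC; apply/andP; split.
- rewrite -RintegralB//; apply: le_Rintegral => //.
    exact: (integrableB mD fi ci).
  by move=> w Dw; have := fg w Dw; rewrite ler_distlC => /andP[].
- rewrite -RintegralD//; apply: le_Rintegral => //.
    exact: (integrableD mD fi ci).
  by move=> w Dw; have := fg w Dw; rewrite ler_distlC => /andP[].
Qed.

End measurability_lipschitz.

(** * Freezing and walks with independent increments *)

Section freezing.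
Context {R : realType} {d : measure_display} {T : measurableType d}.
Variables (P : probability T R) (nu : probability (measurableTypeR R) R).

Let prob_le1 (A : set T) : measurable A -> fine (P A) <= 1.
Proof.
move=> mA; rewrite -lee_fin fineK ?fin_num_measure//; exact: probability_le1.
Qed.

Lemma fine_measureU d' (T' : measurableType d') (m : {finite_measure set T' -> \bar R})
    (A B : set T') : measurable A -> measurable B -> [disjoint A & B] ->
  fine (m (A `|` B)) = fine (m A) + fine (m B).
Proof.
move=> mA mB AB; rewrite measureU//; last by apply/eqP; rewrite -disj_set2E.
by rewrite fineD// fin_num_measure.
Qed.

(** Cut [[- M, M[] into small cells and replace the second argument of [Phi] by the left end of its
    cell, on both sides. Independence identifies both results with the integral of one Riemann sum.
    Mesh and tail each cost e/4 per side. *)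
Lemma freezing (C : set T) (D : T -> R) (Phi : T -> R -> R) (L : R) :
  0 <= L -> measurable C -> measurable_fun [set: T] D ->
  (forall v, measurable_fun [set: T] (Phi^~ v)) ->
  (forall w, lip01 L (Phi w)) ->
  measurable_fun [set: T] (fun w => \int[nu]_v Phi w v) ->
  (forall I : set (measurableTypeR R), measurable I -> P (D @^-1` I) = nu I) ->
  (forall (I : set (measurableTypeR R)) v, measurable I ->
    \int[P]_(w in C `&` D @^-1` I) Phi w v =
    fine (nu I) * \int[P]_(w in C) Phi w v) ->
  (forall e, 0 < e -> exists2 M : R, 0 < M & fine (nu (~` `[- M, M[)) <= e) ->
  \int[P]_(w in C) Phi w (D w) = \int[P]_(w in C) \int[nu]_v Phi w v.
Proof.
move=> L0 mC mD mPhi Phil mInt law indep tail.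
have mPD : measurable_fun [set: T] (fun w => Phi w (D w)).
  by apply: (measurable_lipschitz_comp mPhi) => // w; exact: (Phil w).2.
have b1 w v : `|Phi w v| <= 1.
  by have /andP[p0 p1] := (Phil w).1 v; rewrite ger0_norm.
have mDI (I : set (measurableTypeR R)) : measurable I -> measurable (D @^-1` I).
  by move=> mI; rewrite -[X in measurable X]setTI; apply: mD.
have iPhi (E : set T) v : measurable E -> P.-integrable E (EFin \o Phi^~ v).
  by move=> mE; apply: (integrable_bounded _ (c := 1)).
have iPD (E : set T) : measurable E -> P.-integrable E (EFin \o (fun w => Phi w (D w))).
  by move=> mE; apply: (integrable_bounded _ (c := 1)).
have iNu w (I : set (measurableTypeR R)) :
    measurable I -> nu.-integrable I (EFin \o Phi w).
  move=> mI; apply: (integrable_bounded _ (c := 1)) => //.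
  exact: lip01_measurable (Phil w).
have m01 w : 0 <= \int[nu]_v Phi w v <= 1.
  have := @lip01_mean R nu L (fun _ => Phi w) (fun _ => Phil w).
  case; last by move=> + _; apply; exact: 0.
  by move=> v; split => [_|x y]; [exact: (Phil w).1 v|rewrite subrr normr0 mulr_ge0].
have iInt (E : set T) : measurable E ->
    P.-integrable E (EFin \o (fun w => \int[nu]_v Phi w v)).
  move=> mE; apply: (integrable_bounded _ (c := 1)) => // w.
  by have /andP[? ?] := m01 w; rewrite ger0_norm.
apply/eqP; rewrite -subr_eq0 -normr_le0; apply/ler_addgt0Pl => e e0; rewrite addr0.
have [M M0 tM] := tail (e / 4) (divr_gt0 e0 (ltr0n _ 4)).
(* The mesh is 2M/K, so K > 8 M L / e makes the Lipschitz error per cell at most e/4. *)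
pose K := (Num.truncn (8 * M * L / e)).+1.
pose eps := 2 * M / K%:R.
have K0 : 0 < K%:R :> R by rewrite ltr0n.
have eps0 : 0 < eps by rewrite divr_gt0// mulr_gt0.
have Leps : L * eps <= e / 4.
  have : 8 * M * L / e < K%:R by rewrite /K truncnS_gt.
  rewrite ltr_pdivrMr// /eps => H.
  rewrite mulrA ler_pdivrMr//; lra.
pose a k : R := - M + eps * k%:R.
have aS k : a k.+1 = a k + eps by rewrite /a -natr1; ring.
pose U k : set (measurableTypeR R) := `[- M, a k[%classic.
pose I k : set (measurableTypeR R) := `[a k, a k.+1[%classic.
have mU k : measurable (U k) by exact: measurable_itv.
have mI k : measurable (I k) by exact: measurable_itv.
have Ma k : - M <= a k by rewrite /a lerDl mulr_ge0// ltW.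
have US k : U k.+1 = U k `|` I k.
  apply/seteqP; split => v; rewrite /U /I /= !in_itv/= aS.
    move=> /andP[v1 v2]; have [va|va] := ltP v (a k); first by left; rewrite v1.
    by right.
  move=> [/andP[-> v2]|/andP[v1 ->]]; first by rewrite (lt_trans v2)// ltrDl.
  by rewrite (le_trans (Ma k)).
have UI k : [disjoint U k & I k].
  apply/disj_setPS => v []; rewrite /U /I /= !in_itv/= => /andP[_ v1] /andP[v2 _].
  by move: v1; rewrite ltNge v2.
have DUI k : [disjoint (C `&` D @^-1` U k) & (C `&` D @^-1` I k)].
  apply/disj_setPS => w [[_ w1] [_ w2]].
  by have /disj_setPS /(_ (D w)) := UI k; apply.
have DUS k : C `&` D @^-1` U k.+1 = (C `&` D @^-1` U k) `|` (C `&` D @^-1` I k).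
  by rewrite US preimage_setU setIUr.
(* The Riemann sum of [Phi w] against [nu] over the first k cells. *)
pose S := fix S k w : R := if k is k'.+1 then S k' w + fine (nu (I k')) * Phi w (a k')
                       else 0.
have mS k : measurable_fun [set: T] (S k).
  elim: k => [|k IH] /=; first exact: measurable_cst.
  by apply: measurable_funD => //; apply: measurable_funM.
have bS k w : `|S k w| <= k%:R.
  elim: k => [|k IH] /=; first by rewrite normr0.
  rewrite -natr1; apply: (le_trans (ler_normD _ _)); rewrite lerD// normrM.
  rewrite -[leRHS]mulr1 ler_pM// ger0_norm ?fine_ge0//.
  by rewrite -lee_fin fineK ?fin_num_measure//; exact: probability_le1.
have iS k (E : set T) : measurable E -> P.-integrable E (EFin \o S k).
  by move=> mE; apply: (integrable_bounded _ (c := k%:R)).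
have lawf (J : set (measurableTypeR R)) : measurable J ->
    fine (P (C `&` D @^-1` J)) <= fine (nu J).
  move=> mJ; rewrite -law//; apply: fine_le; rewrite ?fin_num_measure//.
  - by apply: measurableI => //; exact: mDI.
  - exact: mDI.
  - apply: le_measure; rewrite ?inE//.
      by apply: measurableI => //; exact: mDI.
    exact: mDI.
have close w v k : I k v -> `|Phi w v - Phi w (a k)| <= L * eps.
  rewrite /I /= in_itv/= aS => /andP[v1 v2]; apply: (le_trans ((Phil w).2 _ _)).
  by rewrite ler_wpM2l// ger0_norm ?subr_ge0// lerBlDl ltW.
have Le0 : 0 <= L * eps by rewrite mulr_ge0// ltW.
have nuU k : fine (nu (U k.+1)) = fine (nu (U k)) + fine (nu (I k)).
  by rewrite US fine_measureU.
have A1 k : `|\int[P]_(w in C `&` D @^-1` U k) Phi w (D w) - \int[P]_(w in C) S k w|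
    <= L * eps * fine (nu (U k)).
  elim: k => [|k IH].
    rewrite (_ : U 0%N = set0); last first.
      apply/seteqP; split => v //; rewrite /U /= in_itv/= /a mulr0 addr0.
      by move=> /andP[v1]; rewrite ltNge v1.
    rewrite preimage_set0 setI0 Rintegral_set0 measure0/= mulr0.
    by rewrite Rintegral_cst// mul0r subrr normr0.
  have mCU : measurable (C `&` D @^-1` U k) by apply: measurableI => //; exact: mDI.
  have mCI : measurable (C `&` D @^-1` I k) by apply: measurableI => //; exact: mDI.
  rewrite DUS Rintegral_setU//; last by apply: iPD; exact: measurableU.
  rewrite nuU mulrDr /= RintegralD//; [|exact: iS|]; last first.
    exact: (integrableZl mC _ (iPhi _ _ mC)).
  rewrite RintegralZl//; last exact: iPhi.
  rewrite -indep// opprD addrACA (le_trans (ler_normD _ _))// lerD//.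
  apply: (le_trans (Rintegral_dist_le mCI Le0 (iPD _ mCI) (iPhi _ _ mCI) _)).
    by move=> w [_ Iw]; exact: close.
  by rewrite ler_wpM2l//; exact: lawf.
have A2 w k : `|\int[nu]_(v in U k) Phi w v - S k w| <= L * eps * fine (nu (U k)).
  elim: k => [|k IH].
    rewrite (_ : U 0%N = set0); last first.
      apply/seteqP; split => v //; rewrite /U /= in_itv/= /a mulr0 addr0.
      by move=> /andP[v1]; rewrite ltNge v1.
    by rewrite Rintegral_set0 measure0/= mulr0 subrr normr0.
  have iU := iNu w _ (measurableU _ _ (mU k) (mI k)).
  rewrite nuU US Rintegral_setU// mulrDr /=.
  rewrite opprD addrACA (le_trans (ler_normD _ _))// lerD//.
  have ci : nu.-integrable (I k) (EFin \o cst (Phi w (a k))).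
    by apply: (integrable_bounded _ (c := 1)) => // v; exact: b1.
  rewrite mulrC -(Rintegral_cst nu (mI k)).
  apply: (Rintegral_dist_le (mI k) Le0 (iNu w _ (mI k)) ci) => v Iv.
  exact: close.
have aK : a K = M by rewrite /a /eps divfK ?gt_eqF//; ring.
have UK : U K = `[- M, M[%classic by rewrite /U aK.
have mUc := measurableC (mU K).
have Ule1 : fine (nu (U K)) <= 1.
  by rewrite -lee_fin fineK ?fin_num_measure//; exact: probability_le1.
have B1 : `|\int[P]_(w in C) Phi w (D w) - \int[P]_(w in C) S K w| <= e / 2.
  have -> : \int[P]_(w in C) Phi w (D w) =
      \int[P]_(w in C `&` D @^-1` U K) Phi w (D w) +
      \int[P]_(w in C `&` D @^-1` (~` U K)) Phi w (D w).
    rewrite -Rintegral_setU//; first last.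
    - apply/disj_setPS => w [[_ w1] [_ w2]]; exact: w2.
    - by rewrite -setIUr -preimage_setU setUv preimage_setT setIT; exact: iPD.
    - by apply: measurableI => //; exact: mDI.
    - by apply: measurableI => //; exact: mDI.
    - by rewrite -setIUr -preimage_setU setUv preimage_setT setIT.
  rewrite addrAC (le_trans (ler_normD _ _))//.
  have mE : measurable (C `&` D @^-1` (~` U K)) by apply: measurableI => //; exact: mDI.
  have T1 : `|\int[P]_(w in C `&` D @^-1` (~` U K)) Phi w (D w)| <= e / 4.
    have i0 : P.-integrable (C `&` D @^-1` (~` U K)) (EFin \o cst (0 : R)).
      by apply: (integrable_bounded _ (c := 1)) => // w; rewrite normr0.
    have := Rintegral_dist_le mE (@ler01 R) (iPD _ mE) i0.
    rewrite Rintegral_cst// mul0r subr0 mul1r => H.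
    apply: (le_trans (H _)); first by move=> w _; rewrite subr0.
    by apply: (le_trans (lawf _ mUc)); rewrite UK.
  have := A1 K; have : L * eps * fine (nu (U K)) <= e / 4.
    by apply: le_trans Leps; rewrite ler_piMr.
  lra.
have B2 : `|\int[P]_(w in C) (\int[nu]_v Phi w v) - \int[P]_(w in C) S K w| <= e / 2.
  have e20 : 0 <= e / 2 by rewrite ltW// divr_gt0.
  apply: (le_trans (Rintegral_dist_le mC e20 (iInt _ mC) (iS _ _ mC) _)); last first.
    by rewrite ler_piMr// prob_le1.
  move=> w _.
  have -> : \int[nu]_v Phi w v = \int[nu]_(v in U K) Phi w v + \int[nu]_(v in ~` U K) Phi w v.
    rewrite -Rintegral_setU//; first by rewrite setUv.
    - by rewrite setUv; exact: iNu.
    - by apply/disj_setPS => v [].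
  rewrite addrAC (le_trans (ler_normD _ _))//.
  have T1 : `|\int[nu]_(v in ~` U K) Phi w v| <= e / 4.
    have i0 : nu.-integrable (~` U K) (EFin \o cst (0 : R)).
      by apply: (integrable_bounded _ (c := 1)) => // v; rewrite normr0.
    have := Rintegral_dist_le mUc (@ler01 R) (iNu w _ mUc) i0.
    rewrite Rintegral_cst// mul0r subr0 mul1r => H.
    apply: (le_trans (H _)); first by move=> v _; rewrite subr0.
    by rewrite UK.
  have := A2 w K; have : L * eps * fine (nu (U K)) <= e / 4.
    by apply: le_trans Leps; rewrite ler_piMr.
  lra.
by have := ler_distD (\int[P]_(w in C) S K w) (\int[P]_(w in C) Phi w (D w))
  (\int[P]_(w in C) \int[nu]_v Phi w v); rewrite (distrC (\int[P]_(w in C) S K w)); lra.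
Qed.

Lemma chain_rcons m k (F : (nat -> R) -> R) :
  chain nu m.+1 k F = chain nu m k (step nu (k + m) F).
Proof.
elim: m k => [|m IH] k; first by rewrite /= addn0.
by rewrite [LHS]/= -/(chain nu m.+1 k.+1 F) IH /= addnS addSn.
Qed.

Variables (n : nat) (D : nat -> T -> R).
Hypothesis mD : forall i, measurable_fun [set: T] (D i).
Hypothesis tail :
  forall e, 0 < e -> exists2 M : R, 0 < M & fine (nu (~` `[- M, M[)) <= e.
Hypothesis indep : forall A : nat -> set (measurableTypeR R),
  (forall i, measurable (A i)) ->
  P [set w | forall i, (i < n)%N -> A i (D i w)] = (\prod_(i < n) nu (A i))%E.

Definition partial_sums (z : R) (w : T) (i : nat) : R := z + \sum_(0 <= j < i) D j w.

(** Constrains only increments from number j on, those not yet read by a function of the first j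
    partial sums. *)
Let ev (j : nat) (A : nat -> set (measurableTypeR R)) : set T :=
  [set w | forall i, (j <= i < n)%N -> A i (D i w)].

Let measurable_ev j A : (forall i, measurable (A i)) -> measurable (ev j A).
Proof.
move=> mA; rewrite (_ : ev j A =
    \bigcap_i (if (j <= i < n)%N then D i @^-1` A i else setT)).
  apply: bigcapT_measurable => i; case: ifP => // _.
  by rewrite -[X in measurable X]setTI; exact: (mD i measurableT (mA i)).
apply/seteqP; split => w H i; first by move=> _; case: ifP => // ij; exact: H.
by move=> ij; have := H i I; rewrite ij.
Qed.

Let fprod j (A : nat -> set (measurableTypeR R)) : R :=
  \prod_(j <= i < n) fine (nu (A i)).

Let P_ev j A : (j <= n)%N -> (forall i, measurable (A i)) -> fine (P (ev j A)) = fprod j A.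
Proof.
move=> jn mA; pose A' i := if (i < j)%N then setT else A i.
have mA' i : measurable (A' i) by rewrite /A'; case: ifP.
have -> : ev j A = [set w | forall i, (i < n)%N -> A' i (D i w)].
  apply/seteqP; split => w H i; rewrite /A'.
    by move=> i_n; case: ltnP => // ji; apply: H; rewrite ji.
  by move=> /andP[ji i_n]; have := H i i_n; rewrite /A' ltnNge ji.
rewrite indep//; have -> : (\prod_(i < n) nu (A' i) = (\prod_(i < n) fine (nu (A' i)))%:E)%E.
  rewrite -prodEFin; apply: eq_bigr => i _; by rewrite fineK ?fin_num_measure.
rewrite /= -(big_mkord xpredT (fun i => fine (nu (A' i)))) (big_cat_nat (leq0n j) jn)//=.
rewrite big_nat_cond big1 ?mul1r; last first.
  by move=> i /andP[/andP[_ ij] _]; rewrite /A' ij probability_setT.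
rewrite /fprod; apply: eq_big_nat => i /andP[ji _].
by rewrite /A' ltnNge ji.
Qed.

Lemma integral_walk_weighted L z j : 0 <= L -> (j <= n)%N ->
  forall F A, slip01 L j F -> (forall i, measurable (A i)) ->
  \int[P]_(w in ev j A) F (partial_sums z w) = chain nu j 0 F (fun=> z) * fprod j A.
Proof.
move=> L0; elim: j => [|j IH] jn F A Fl mA.
  rewrite /= -(P_ev _ mA)//.
  have -> : (fun w => F (partial_sums z w)) = cst (F (fun=> z)).
    apply/funext => w /=; apply/eqP; rewrite -subr_eq0 -normr_le0.
    have := Fl.2 (partial_sums z w) (fun=> z) 0; rewrite mulr0; apply => i.
    by rewrite leqn0 => /eqP ->; rewrite /partial_sums big_geq// addr0 subrr normr0.
  by rewrite Rintegral_cst//; exact: measurable_ev.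
rewrite chain_rcons add0n.
have Fj := slip01_step nu Fl.
have mpartial_sums i : measurable_fun [set: T] (fun w => partial_sums z w i).
  by apply: measurable_funD => //; apply: measurable_sum.
have mF G l : slip01 L l G -> measurable_fun [set: T] (fun w => G (partial_sums z w)).
  by move=> Gl; exact: (measurable_slip Gl.2 (x := fun i w => partial_sums z w i)).
(* Prescribing I for increment j turns a constraint at stage j+1 together with D_j in I into a
   constraint at stage j. *)
pose setA I i := if i == j then I else A i.
have msetA I : measurable I -> forall i, measurable (setA I i).
  by move=> mI i; rewrite /setA; case: ifP.
have evI I : ev j (setA I) = ev j.+1 A `&` D j @^-1` I.
  apply/seteqP; split => w.
    move=> H; split; last by have := H j; rewrite /setA eqxx leqnn; exact.
    move=> i /andP[ji i_n]; have := H i; rewrite /setA gtn_eqF// (ltnW ji) i_n.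
    exact.
  move=> [H1 H2] i /andP[ji i_n]; rewrite /setA; case: eqP => [->//|/eqP ij].
  by apply: H1; rewrite i_n andbT ltn_neqAle eq_sym ij.
have fprodI I : fprod j (setA I) = fine (nu I) * fprod j.+1 A.
  rewrite /fprod big_ltn//; congr (_ * _); first by rewrite /setA eqxx.
  by apply: eq_big_nat => i /andP[ji _]; rewrite /setA gtn_eqF.
pose Fv v x := F (upd x j.+1 (x j + v)).
have Fvl v : slip01 L j (Fv v).
  split=> [x|x y M xy]; first exact: Fl.1.
  apply: Fl.2 => i; rewrite leq_eqVlt ltnS => /predU1P[->|ij].
    by rewrite !upd_same opprD addrACA subrr addr0; exact: xy.
  by rewrite !upd_neq ?ltn_eqF ?ltnS//; exact: xy.
have E1 w : F (partial_sums z w) = Fv (D j w) (partial_sums z w).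
  apply/eqP; rewrite -subr_eq0 -normr_le0.
  have := Fl.2 (partial_sums z w) (upd (partial_sums z w) j.+1 (partial_sums z w j + D j w)) 0.
  rewrite mulr0; apply => i ij; rewrite /upd; case: eqP => [->|_].
    by rewrite /partial_sums big_nat_recr//= addrA subrr normr0.
  by rewrite subrr normr0.
have mE := measurable_ev j.+1 mA.
have lawD (I : set (measurableTypeR R)) : measurable I -> P (D j @^-1` I) = nu I.
  move=> mI; have := P_ev (ltnW jn) (A := fun i => if i == j then I else setT).
  rewrite (_ : ev _ _ = D j @^-1` I); last first.
    apply/seteqP; split => w H; first by have := H j; rewrite eqxx leqnn; exact.
    by move=> i _; case: eqP => // ->.
  rewrite /fprod big_ltn// eqxx big_nat_cond big1 ?mulr1.
    move=> /(_ _) H; rewrite -[LHS]fineK ?fin_num_measure//; last first.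
      by rewrite -[X in measurable X]setTI; exact: mD.
    rewrite H ?fineK ?fin_num_measure// => i; by case: eqP.
  by move=> i /andP[/andP[ji _] _]; rewrite gtn_eqF// probability_setT.
transitivity (\int[P]_(w in ev j.+1 A) step nu j F (partial_sums z w)); last first.
  have := IH (ltnW jn) _ _ Fj (msetA _ measurableT).
  by rewrite evI preimage_setT setIT fprodI probability_setT mul1r.
under eq_Rintegral do rewrite E1.
rewrite /step; apply: (freezing L0 mE (mD j) (Phi := fun w v => Fv v (partial_sums z w))) => //.
- by move=> v; exact: mF (Fvl v).
- by move=> w; exact: lip01_step_fun Fl.
- exact: mF Fj.
- move=> I v mI; have := IH (ltnW jn) _ _ (Fvl v) (msetA _ mI).
  rewrite evI fprodI => ->.
  have := IH (ltnW jn) _ _ (Fvl v) (msetA _ measurableT).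
  rewrite evI preimage_setT setIT fprodI probability_setT mul1r => ->.
  by rewrite mulrCA.
Qed.

Lemma integral_walk L z F : 0 <= L -> slip01 L n F ->
  \int[P]_w F (partial_sums z w) = chain nu n 0 F (fun=> z).
Proof.
move=> L0 Fl; have := integral_walk_weighted z L0 (leqnn n) Fl (fun _ => measurableT).
rewrite /fprod big_geq// mulr1 (_ : ev _ _ = setT)//.
by apply/seteqP; split => // w _ i /andP[ni]; rewrite ltnNge ni.
Qed.

End freezing.

(** * Paths on the unit interval *)

Lemma truncnP_ex (R : realType) (r : R) : 0 < r -> exists m : nat, m.+1%:R^-1 < r.
Proof.
move=> r0; exists (Num.truncn r^-1); rewrite invf_plt ?posrE ?ltr0n//.
exact: truncnS_gt.
Qed.

Section unit_interval.
Context {R : realType}.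

Definition clamp01 (x : R) : R := if x <= 0 then 0 else if 1 <= x then 1 else x.

Lemma clamp01_lip : lip01 1 clamp01.
Proof.
split=> [x|x y].
  by rewrite /clamp01; have [?|?] := leP x 0; have [?|?] := leP 1 x; rewrite ?lexx ?ler01//; lra.
rewrite mul1r /clamp01 ler_norml.
have := ler_norm (x - y); have := ler_norm (y - x); rewrite distrC.
by have [?|?] := leP x 0; have [?|?] := leP 1 x;
   have [?|?] := leP y 0; have [?|?] := leP 1 y; move=> *; lra.
Qed.

Lemma clamp01_id x : 0 <= x <= 1 -> clamp01 x = x.
Proof.
move=> /andP[x0 x1]; rewrite /clamp01; have [?|?] := leP x 0; first lra.
by have [?|?] := leP 1 x; lra.
Qed.

Lemma clamp01_mem x : (`[0, 1]%classic : set R) (clamp01 x).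
Proof. by rewrite /= in_itv/=; exact: clamp01_lip.1. Qed.

(** Clamping gives a total map from the reals, so a path composed with it is a continuous function
    on the whole line. *)
Definition tpt (x : R) : unit_interval R := exist _ (clamp01 x) (mem_set (clamp01_mem x)).

Lemma time_tpt x : time (tpt x) = clamp01 x.
Proof. by rewrite /time set_valE. Qed.

Lemma time01 (t : unit_interval R) : 0 <= time t <= 1.
Proof. by have := set_valP t; rewrite /= in_itv/= /time set_valE. Qed.

Lemma tptK (t : unit_interval R) : tpt (time t) = t.
Proof. by apply: val_inj => /=; rewrite clamp01_id ?time01// /time set_valE. Qed.

Lemma tpt_clamp01 x : tpt (clamp01 x) = tpt x.
Proof. by rewrite -time_tpt tptK. Qed.

Lemma tpt_continuous : continuous tpt.
Proof.
apply: (@continuous_comp_initial _ _ _ set_val).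
rewrite (_ : _ \o _ = clamp01); first exact: lip01_continuous clamp01_lip.
by apply/funext => x /=; rewrite -/(time _) time_tpt.
Qed.

Lemma comp_tpt_continuous (x : unit_interval R -> R) :
  C01 x -> continuous (fun s => x (tpt s)).
Proof. by move=> xc s; apply: continuous_comp; [exact: tpt_continuous|exact: xc]. Qed.

(** Uniform continuity from the near-covering form of compactness of the unit segment. Clamping is
    1-Lipschitz, which carries the estimate to all real times. *)
Lemma unit_interval_heine (x : unit_interval R -> R) (e : R) : C01 x -> 0 < e ->
  exists m : nat, forall s t : R, `|s - t| <= m.+1%:R^-1 ->
    `|x (tpt s) - x (tpt t)| <= e.
Proof.
move=> /comp_tpt_continuous fc e0; set f := fun s => _ in fc.
have [/compact_near_coveringP + _] := conj (@segment_compact R 0 1) I.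
move=> /(_ nat \oo (fun m s => forall t, `|s - t| <= m.+1%:R^-1 ->
  `|f s - f t| <= e) _) H.
have [|m _ Hm] := H.
  move=> s _; have e20 : 0 < e / 2 by rewrite divr_gt0.
  have /cvgrPdist_le /(_ _ e20) /nbhs_ballP[r /= r0 sr] := fc s.
  have r20 : 0 < r / 2 by rewrite divr_gt0.
  exists (ball s (r / 2), [set m | m.+1%:R^-1 < r / 2]).
    split => /=; first exact: nbhsx_ballx.
    have [m mr] := truncnP_ex r20.
    by exists m => // k /= mk; apply: le_lt_trans mr; rewrite lef_pV2 ?posrE// ler_nat.
  move=> [s' m] /= [ss' mr] t s't.
  have h1 : `|f s - f s'| <= e / 2.
    by apply: sr; apply: le_ball ss'; lra.
  have h2 : `|f s - f t| <= e / 2.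
    apply: sr; rewrite /ball/=; move: ss'; rewrite /ball/= => ss'.
    have tri (p q v : R) : `|p - q| < r / 2 -> `|q - v| < r / 2 -> `|p - v| < r.
      by have := ler_distD q p v; lra.
    by apply: (tri _ s') => //; apply: le_lt_trans s't mr.
  by have := ler_distD (f s) (f s') (f t); rewrite (distrC (f s') (f s)); lra.
exists m => s t st; have := Hm m (leqnn m) (clamp01 s) _ (clamp01 t).
rewrite /f !tpt_clamp01; apply; first exact: clamp01_mem.
by have := clamp01_lip.2 s t; rewrite mul1r => /le_trans; apply.
Qed.

(** [sup] bounds the elements of a set only if the set is bounded above; continuity provides this
    through the extreme value theorem. *)
Lemma uniform_dist_ge (x y : unit_interval R -> R) : C01 x -> C01 y ->
  forall t, `|x t - y t| <= uniform_dist x y.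
Proof.
move=> /comp_tpt_continuous xc /comp_tpt_continuous yc t.
have c : {within `[0, 1], continuous (fun s : R => `|x (tpt s) - y (tpt s)|)}.
  apply: continuous_subspaceT => s; apply: cvg_norm.
  by apply: continuousB; [exact: xc|exact: yc].
have [c0 _ Hc] := EVT_max (@ler01 R) c.
apply: ub_le_sup; last by exists t.
exists (`|x (tpt c0) - y (tpt c0)|) => _ [s _ <-].
by have := Hc (time s); rewrite tptK; apply; rewrite in_itv/= time01.
Qed.

Lemma uniform_dist_le (x y : unit_interval R -> R) (c : R) :
  (forall t, `|x t - y t| <= c) -> uniform_dist x y <= c.
Proof.
move=> xyc; apply: ge_sup; first by exists (`|x (tpt 0) - y (tpt 0)|); exists (tpt 0).
by move=> _ [t _ <-].
Qed.

(** At index n+1 every coordinate is compared without tolerance, so positivity means uniform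
    distance strictly below eta; the witness is t = 1 - c / eta. *)
Lemma near_ind_strict n (eta delta : R) A x : 0 < eta ->
  0 < near_ind n eta delta A n.+1 x <->
  exists2 a, A a & exists2 c, c < eta & forall i, (i <= n)%N -> `|x i - a i| <= c.
Proof.
move=> eta0; split.
- move=> t0; have [t [/andP[_ t1] tA] tx] :=
    sup_adherent t0 (near_set_has_sup n eta delta A n.+1 x).
  move: tx; rewrite subrr => {}t0.
  case: tA => [t00|[a Aa xa]]; first by rewrite t00 ltxx in t0.
  exists a => //; exists ((1 - t) * eta).
    by rewrite gtr_pMl//; lra.
  by move=> i ik; have := xa i ik; rewrite ltnNge ik addr0.
- move=> [a Aa [c ce xa]].
  have c0 : 0 <= c by apply: le_trans (xa 0%N _).
  apply: (@lt_le_trans _ _ (1 - c / eta)).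
    by rewrite subr_gt0 ltr_pdivrMr// mul1r.
  apply: (ub_le_sup (near_set_ubound n eta delta A n.+1 x)); split.
    by rewrite subr_ge0 ler_pdivrMr// mul1r (ltW ce)/= gerBl divr_ge0// ltW.
  right; exists a => // i ik; rewrite ltnNge ik addr0 opprB addrCA subrr addr0.
  by rewrite divfK ?gt_eqF//; exact: xa.
Qed.

End unit_interval.

(** * Measurability of the enlargement of an arbitrary set of paths *)

Section enlargement_measurability.
Context {R : realType} {d : measure_display} {T : measurableType d}.
Variable B : T -> unit_interval R -> R.
Hypothesis BC : forall w, C01 (B w).
Hypothesis mB : forall t, measurable_fun [set: T] (fun w => B w t).

(** Oscillation at most 1/(l+1) within distance 1/(m+1) of each grid point. Rational times make this
    a countable condition; [osc_real] recovers real times by continuity. *)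
Let osc (l m : nat) (x : unit_interval R -> R) := forall (i : nat) (q : rat),
  `|(ratr q : R) - i%:R / m.+1%:R| <= m.+1%:R^-1 ->
  `|x (tpt (ratr q)) - x (tpt (i%:R / m.+1%:R))| <= l.+1%:R^-1.

Let osc_real l m x s : C01 x -> osc l m x -> 0 <= s ->
  `|x (tpt s) - x (tpt ((Num.truncn (s * m.+1%:R))%:R / m.+1%:R))| <= l.+1%:R^-1.
Proof.
move=> xC xo s0; set i := Num.truncn _; apply/ler_addgt0Pl => e e0.
have m0 : 0 < m.+1%:R :> R by rewrite ltr0n.
have /truncn_itv/andP[i1 i2] : 0 <= s * m.+1%:R by rewrite mulr_ge0// ltW.
have [m' Hm'] := unit_interval_heine xC e0.
have : s < Num.min (s + m'.+1%:R^-1) (i.+1%:R / m.+1%:R).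
  by rewrite lt_min ltrDl invr_gt0 ltr0n/= ltr_pdivlMr.
move=> /rat_in_itvoo[q]; rewrite in_itv/= lt_min => /and3P[sq q1 q2].
have h1 : `|x (tpt s) - x (tpt (ratr q))| <= e.
  by apply: Hm'; rewrite distrC ger0_norm ?subr_ge0 ?ltW// ltrBlDl.
have i_s : i%:R / m.+1%:R <= s by rewrite ler_pdivrMr.
have h2 : `|x (tpt (ratr q)) - x (tpt (i%:R / m.+1%:R))| <= l.+1%:R^-1.
  apply: xo; rewrite ger0_norm; last by rewrite subr_ge0 (le_trans i_s)// ltW.
  have e1 : i.+1%:R / m.+1%:R = i%:R / m.+1%:R + m.+1%:R^-1 :> R.
    by rewrite -natr1 mulrDl mul1r.
  by rewrite lerBlDl -e1 ltW.
by apply: (le_trans (ler_distD (x (tpt (ratr q))) _ _)); exact: lerD.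
Qed.

(** The set D may be neither countable nor measurable. Sorting paths by their modulus of continuity
    reduces nearness in the uniform norm to nearness of finitely many grid values to some set
    [A l m], and the Lipschitz function [near_ind] of that set is measurable whatever the set is. *)
Lemma measurable_enlargement (D : set (unit_interval R -> R)) (e : R) :
  D `<=` C01 -> measurable [set w | enlargement D e (B w)].
Proof.
move=> DC.
pose A l m : set (nat -> R) := [set a | exists y, [/\ D y, osc l m y &
  forall i, a i = y (tpt (i%:R / m.+1%:R))]].
(* The oscillations of the path and of its neighbour in D, 1/(l+1) each, are taken off the
   radius. *)
pose eta l : R := e - 2 * l.+1%:R^-1.
pose G l m : set T := [set w | osc l m (B w)] `&`
  [set w | 0 < near_ind m.+1 (eta l) 1 (A l m) m.+2 (fun i => B w (tpt (i%:R / m.+1%:R)))].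
rewrite (_ : [set w | _] = \bigcup_(l in [set l | 0 < eta l]) \bigcup_m G l m).
  apply: bigcup_measurable => l l0; apply: bigcupT_measurable => m.
  apply: measurableI.
  - rewrite (_ : [set w | _] = ~` (\bigcup_i \bigcup_q
        (if `|ratr q - i%:R / m.+1%:R| <= m.+1%:R^-1 :> R then
          [set w | l.+1%:R^-1 < `|B w (tpt (ratr q)) - B w (tpt (i%:R / m.+1%:R))|]
         else set0))).
      apply: measurableC; apply: bigcupT_measurable => i.
      apply: bigcupT_measurable_rat => q; case: ifP => // _.
      rewrite -[X in measurable X]setTI.
      have := @measurable_fun_ltr _ _ _ [set: T] (cst l.+1%:R^-1)
        (fun w => `|B w (tpt (ratr q)) - B w (tpt (i%:R / m.+1%:R))|).
      move=> /(_ _ _ measurableT [set true]); apply => //.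
      by apply: measurableT_comp => //; apply: measurable_funB.
    apply/seteqP; split => w.
      move=> H [i _ [q _]]; case: ifP => // qi /= lt.
      by have := H i q qi; rewrite leNgt lt.
    move=> H i q qi; rewrite leNgt; apply/negP => lt; apply: H.
    by exists i => //; exists q => //; rewrite qi.
  - rewrite -[X in measurable X]setTI.
    have ns := @near_ind_slip R m.+1 (eta l) 1 (A l m) l0 m.+2.
    have := @measurable_fun_ltr _ _ _ [set: T] (cst 0) (fun w =>
      near_ind m.+1 (eta l) 1 (A l m) m.+2 (fun i => B w (tpt (i%:R / m.+1%:R)))).
    move=> /(_ _ _ measurableT [set true]); apply => //.
    exact: (measurable_slip ns.2 (x := fun i w => B w (tpt (i%:R / m.+1%:R)))).
apply/seteqP; split => w; last first.
  move=> [l l0 [m _ [wo /(near_ind_strict _ _ _ _ l0)[a [y [Dy yo ay]] [c ce xa]]]]].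
  split; first exact: BC.
  exists y => //; apply: (@le_lt_trans _ _ (2 * l.+1%:R^-1 + c)); last first.
    by rewrite -ltrBrDl.
  apply: uniform_dist_le => t; rewrite -(tptK t).
  have /andP[t0 t1] := time01 t; move: (time t) t0 t1 => s s0 s1.
  have h1 := osc_real (@BC w) wo s0; have h2 := osc_real (DC _ Dy) yo s0.
  have : (Num.truncn (s * m.+1%:R) <= m.+1)%N.
    rewrite -(ler_nat R); have /truncn_itv/andP[+ _] : 0 <= s * m.+1%:R by rewrite mulr_ge0.
    by move=> /le_trans; apply; rewrite ler_piMl.
  move: (Num.truncn _) h1 h2 => i h1 h2 im.
  have := xa i im; rewrite ay.
  move: (l.+1%:R^-1) h1 h2 => r; rewrite !ler_norml; lra.
move=> [_ [y Dy yd]].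
have [l l0] : exists l : nat, 2 * l.+1%:R^-1 < e - uniform_dist (B w) y.
  have g0 : 0 < (e - uniform_dist (B w) y) / 2 by rewrite divr_gt0// subr_gt0.
  have [l Hl] := truncnP_ex g0; exists l; by rewrite mulrC -ltr_pdivlMr.
have l1 : 0 < l.+1%:R^-1 :> R by rewrite invr_gt0.
have d0 : 0 <= uniform_dist (B w) y.
  exact: le_trans (normr_ge0 _) (uniform_dist_ge (@BC w) (DC _ Dy) (tpt 0)).
have [m1 Hm1] := unit_interval_heine (@BC w) l1.
have [m2 Hm2] := unit_interval_heine (DC _ Dy) l1.
(* A common mesh for the path and its neighbour [y]. *)
pose m := maxn m1 m2.
have le1 : m.+1%:R^-1 <= m1.+1%:R^-1 :> R.
  by rewrite lef_pV2 ?posrE// ler_nat ltnS leq_maxl.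
have le2 : m.+1%:R^-1 <= m2.+1%:R^-1 :> R.
  by rewrite lef_pV2 ?posrE// ler_nat ltnS leq_maxr.
have eta0 : 0 < eta l by rewrite /eta subr_gt0 (lt_le_trans l0)// gerBl.
exists l => //; exists m => //; split.
  by move=> i q qi; apply: Hm1; apply: le_trans qi le1.
apply/(near_ind_strict _ _ _ _ eta0).
exists (fun i => y (tpt (i%:R / m.+1%:R))).
  by exists y; split=> // i q qi; apply: Hm2; apply: le_trans qi le2.
exists (uniform_dist (B w) y); first by rewrite /eta ltrBrDr -ltrBrDl.
by move=> i _; exact: uniform_dist_ge (@BC w) (DC _ Dy) _.
Qed.

End enlargement_measurability.

(** * Wiener process on a grid *)

Section wiener.
Context {R : realType} {d : measure_display} {T : measurableType d}.
Variables (P : probability T R) (B : T -> unit_interval R -> R).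
Hypothesis wB : standard_wiener P B.

Let BC : forall w, C01 (B w). Proof. by case: wB. Qed.
Let mB : forall t, measurable_fun [set: T] (fun w => B w t). Proof. by case: wB. Qed.

Let W (s : R) (w : T) := B w (tpt s).

Lemma wiener_increment (s t : R) : 0 <= s -> s < t -> t <= 1 ->
  forall A : set (measurableTypeR R), measurable A ->
  P [set w | A (W t w - W s w)] = normal_prob 0 (Num.sqrt (t - s)) A.
Proof.
move=> s0 st t1 A mA; have [_ _ _ inc _] := wB.
have es : time (tpt s) = s by rewrite time_tpt clamp01_id// s0 (le_trans (ltW st)).
have et : time (tpt t) = t by rewrite time_tpt clamp01_id// t1 (le_trans s0)// ltW.
by rewrite inc ?es ?et.
Qed.

Variable n : nat.
Hypothesis n0 : (0 < n)%N.

Let nR : 0 < n%:R :> R. Proof. by rewrite ltr0n. Qed.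

Let Dn (i : nat) (w : T) := W (i.+1%:R / n%:R) w - W (i%:R / n%:R) w.

Let sn : R := Num.sqrt n%:R^-1.
Let sn0 : 0 < sn. Proof. by rewrite sqrtr_gt0 invr_gt0. Qed.

Lemma wiener_grid_independent (A : nat -> set (measurableTypeR R)) :
  (forall i, measurable (A i)) ->
  P [set w | forall i, (i < n)%N -> A i (Dn i w)] =
  (\prod_(i < n) normal_prob 0 sn (A i))%E.
Proof.
move=> mA; have [_ _ _ _ ind] := wB.
have tm (i : nat) : (i <= n)%N -> time (tpt (i%:R / n%:R : R)) = i%:R / n%:R :> R.
  move=> i_n; rewrite time_tpt clamp01_id// divr_ge0//=.
  by rewrite ler_pdivrMr// mul1r ler_nat.
rewrite (ind n (fun i => tpt (i%:R / n%:R)) A) //; last first.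
  move=> i i_n; rewrite !tm// ?(ltnW i_n)// ler_pM2r ?invr_gt0//.
  by rewrite ler_nat.
apply: eq_bigr => i _.
have w1 : 0 <= i%:R / n%:R :> R by rewrite divr_ge0.
have w2 : i%:R / n%:R < i.+1%:R / n%:R :> R.
  by rewrite ltr_pM2r ?invr_gt0// ltr_nat.
have w3 : i.+1%:R / n%:R <= 1 :> R by rewrite ler_pdivrMr// mul1r ler_nat.
have w4 : i.+1%:R / n%:R - i%:R / n%:R = n%:R^-1 :> R.
  by rewrite -mulrBl -natr1 addrAC subrr add0r mul1r.
by have := wiener_increment w1 w2 w3 (mA i); rewrite w4.
Qed.

Lemma normal_tail_small (s : R) : 0 < s ->
  forall e : R, 0 < e -> exists2 M : R, 0 < M &
    fine (normal_prob 0 s (~` `[- M, M[)) <= e.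
Proof.
(* For M = 4 s (1 + c) the tail is at most 2 / (1 + (1 + c)^2), which is below 2 / c = e. *)
move=> s0 e e0; pose c := 2 / e; have c0 : 0 < c by rewrite divr_gt0.
have M0 : 0 < 4 * s * (1 + c) by rewrite !mulr_gt0// addr_gt0.
exists (4 * s * (1 + c)) => //; set M := 4 * s * (1 + c).
have M0' : 0 < M by [].
have mT : measurable (~` `[- M, M[%classic : set (measurableTypeR R)).
  by apply: measurableC; exact: measurable_itv.
have mA : measurable ([set x : measurableTypeR R | (M / 2 < `|x|)%R]).
  rewrite -[X in measurable X]setTI.
  by apply: (@measurable_fun_ltr _ _ _ _ (cst (M / 2)) (fun x : R => `|x|)) => //.
rewrite -lee_fin fineK ?fin_num_measure//.
have M20 : 0 <= M / 2 by rewrite divr_ge0// ltW.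
(* The complement contains the endpoint M; halving restores the strict inequality of
   [normal_tail]. *)
apply: (@le_trans _ _ (normal_prob 0 s [set x | (M / 2 < `|x|)%R])).
  apply: le_measure; rewrite ?inE// => x /=; rewrite in_itv/= => /negP.
  rewrite negb_and -ltNge -leNgt => /orP[xM|xM].
    by rewrite ltr0_norm; lra.
  by rewrite ger0_norm; lra.
apply: (le_trans (normal_tail s0 M20)); rewrite lee_fin.
have -> : (M / 2) ^+ 2 / (4 * s ^+ 2) = (1 + c) ^+ 2.
  by rewrite /M; field; rewrite gt_eqF.
have s2 : Num.sqrt 2 <= 2 :> R.
  by rewrite -[leRHS]ger0_norm// -sqrtr_sqr ler_sqrt; nra.
apply: (@le_trans _ _ (2 * (1 + (1 + c) ^+ 2)^-1)).
  rewrite expRN ler_pM ?sqrtr_ge0 ?invr_ge0 ?expR_ge0// lef_pV2 ?posrE ?expR_gt0//.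
    exact: expR_ge1Dx.
  by rewrite addr_gt0// exprn_gt0// addr_gt0.
rewrite ler_pdivrMr; last by rewrite addr_gt0// exprn_gt0// addr_gt0.
have ec : e * c = 2 by rewrite /c mulrCA divff ?mulr1// gt_eqF.
by nra.
Qed.

Lemma wiener_chain (z L : R) (F : (nat -> R) -> R) : 0 <= L -> slip01 L n F ->
  \int[P]_w F (fun i => z + \sum_(0 <= j < i) Dn j w) =
  chain (normal_prob 0 sn) n 0 F (fun=> z).
Proof.
move=> L0 Fl; apply: (integral_walk (D := Dn) _ _ _ z L0 Fl).
- by move=> i; apply: measurable_funB; exact: mB.
- exact: normal_tail_small.
- exact: wiener_grid_independent.
Qed.

(* Dyadic chaining: outside of the event below the increments of the j-th
   dyadic refinement of the grid are at most x (4/5)^j, and the sum over j >= 1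
   of these bounds is 4 x. *)
Let rough (x : R) (j i : nat) : set T := [set w |
  x * (4 / 5) ^+ j < `|W (i.+1%:R / (n * 2 ^ j)%:R) w - W (i%:R / (n * 2 ^ j)%:R) w|].

Let bad (x : R) : set T := \bigcup_j \big[setU/set0]_(i < n * 2 ^ j) rough x j i.

Let measurable_rough x j i : measurable (rough x j i).
Proof.
rewrite -[X in measurable X]setTI.
have := @measurable_fun_ltr _ _ _ [set: T] (cst (x * (4 / 5) ^+ j))
  (fun w => `|W (i.+1%:R / (n * 2 ^ j)%:R) w - W (i%:R / (n * 2 ^ j)%:R) w|).
move=> /(_ _ _ measurableT [set true]); apply => //.
by apply: measurableT_comp => //; apply: measurable_funB; exact: mB.
Qed.

Let measurable_bad x : measurable (bad x).
Proof.
by apply: bigcupT_measurable => j; apply: bigsetU_measurable => i _; exact: measurable_rough.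
Qed.

Let smooth x w : 0 <= x -> ~ bad x w -> forall j m, (m < n * 2 ^ j)%N ->
  `|W (m.+1%:R / (n * 2 ^ j)%:R) w - W (m%:R / (n * 2 ^ j)%:R) w| <= x * (4 / 5) ^+ j.
Proof.
move=> x0 nb j m mn; rewrite leNgt; apply/negP => H; apply: nb.
exists j => //; rewrite -(bigcup_mkord (n * 2 ^ j) (rough x j)).
by exists m.
Qed.

(** Rounding m down to an even number costs at most one increment of level j+1, and halving then
    leads to level j. The costs add up to x times the sum of (4/5)^i for i = 1, ..., j, which is 4 x
    (1 - (4/5)^j). *)
Let dyadic x w : 0 <= x -> ~ bad x w -> forall j m, (m <= n * 2 ^ j)%N ->
  `|W (m%:R / (n * 2 ^ j)%:R) w - W ((m %/ 2 ^ j)%:R / n%:R) w| <=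
  4 * x * (1 - (4 / 5) ^+ j).
Proof.
move=> x0 nb; elim=> [|j IH] m mn.
  by rewrite expn0 muln1 divn1 subrr normr0 expr0 subrr mulr0.
have half (m' : nat) : (m'.*2)%:R / (n * 2 ^ j.+1)%:R = m'%:R / (n * 2 ^ j)%:R :> R.
  rewrite expnS mulnCA -mul2n !natrM; field.
  by rewrite !pnatr_eq0 -!lt0n n0 expn_gt0.
have halfdiv (m' : nat) (b : bool) : ((b + m'.*2) %/ 2 ^ j.+1 = m' %/ 2 ^ j)%N.
  by rewrite expnS divnMA divn2 half_bit_double.
have sum_le : 4 * x * (1 - (4 / 5) ^+ j) + x * (4 / 5) ^+ j.+1 =
    4 * x * (1 - (4 / 5) ^+ j.+1) by rewrite exprS; field.
have mE := odd_double_half m; rewrite -mE halfdiv.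
have m2n : (m./2 <= n * 2 ^ j)%N.
  rewrite -leq_double -[X in (_ <= X)%N]muln2 -mulnA -expnSr.
  by apply: leq_trans mn; rewrite -[X in (_ <= X)%N]mE leq_addl.
have x4 : 0 <= x * (4 / 5) ^+ j.+1 by rewrite mulr_ge0// exprn_ge0.
case: (odd m) mE => [|] mE.
- have mlt : (m./2.*2 < n * 2 ^ j.+1)%N by rewrite -mE add1n in mn.
  have := smooth x0 nb mlt; have := IH _ m2n; rewrite -half add1n.
  have := ler_distD (W (m./2.*2%:R / (n * 2 ^ j.+1)%:R) w)
    (W (m./2.*2.+1%:R / (n * 2 ^ j.+1)%:R) w) (W ((m./2 %/ 2 ^ j)%:R / n%:R) w).
  lra.
- rewrite add0n half; have := IH _ m2n; lra.
Qed.

(** Continuity of the path carries the dyadic bound to every real time of the cell. *)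
Lemma wiener_smooth_block x w : 0 <= x -> ~ bad x w -> forall (i : nat) (s : R),
  (i < n)%N -> i%:R <= n%:R * s < i.+1%:R -> `|W s w - W (i%:R / n%:R) w| <= 4 * x.
Proof.
move=> x0 nb i s i_n /andP[is1 is2]; apply/ler_addgt0Pr => e e0.
have s0 : 0 <= s by have := le_trans (ler0n R i) is1; rewrite pmulr_rge0.
have [k Hk] := unit_interval_heine (@BC w) e0.
(* Since 2^k > k, level k is finer than the modulus 1/(k+1) just obtained. *)
pose N := (n * 2 ^ k)%N; have N0 : 0 < N%:R :> R by rewrite ltr0n muln_gt0 n0 expn_gt0.
pose m := Num.truncn (s * N%:R).
have /truncn_itv/andP[m1 m2] : 0 <= s * N%:R by rewrite mulr_ge0// ltW.
have sN : s * N%:R = n%:R * s * (2 ^ k)%:R by rewrite /N natrM; ring.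
have p2 : 0 < (2 ^ k)%:R :> R by rewrite ltr0n expn_gt0.
have mi : (m %/ 2 ^ k = i)%N.
  apply/eqP; rewrite eqn_leq; apply/andP; split.
  - rewrite -ltnS ltn_divLR ?expn_gt0// -(ltr_nat R); apply: (le_lt_trans m1).
    by rewrite sN natrM ltr_pM2r.
  - rewrite leq_divRL ?expn_gt0// /m truncn_ge_nat ?mulr_ge0 ?(ltW N0)//.
    by rewrite sN natrM ler_pM2r.
have mN : (m <= N)%N.
  rewrite -(ler_nat R); apply: (le_trans m1); rewrite ler_piMl ?(ltW N0)//.
  have : n%:R * s <= n%:R by apply: (le_trans (ltW is2)); rewrite ler_nat.
  by rewrite -[leRHS]mulr1 ler_pM2l.
have := dyadic x0 nb mN; rewrite mi => D1.
have D2 : `|W s w - W (m%:R / N%:R) w| <= e.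
  apply: Hk; rewrite ger0_norm; last by rewrite subr_ge0 ler_pdivrMr.
  rewrite lerBlDr; apply: (@le_trans _ _ (N%:R^-1 + m%:R / N%:R)).
    have -> : N%:R^-1 + m%:R / N%:R = m.+1%:R / N%:R :> R.
      by rewrite -natr1 mulrDl mul1r addrC.
    by rewrite ler_pdivlMr// ltW.
  rewrite lerD2r lef_pV2 ?posrE// ler_nat.
  by apply: (leq_trans (ltn_expl k (ltnSn 1))); rewrite leq_pmull.
have : 4 * x * (1 - (4 / 5) ^+ k) <= 4 * x.
  by rewrite ler_piMr ?mulr_ge0// gerBl exprn_ge0.
have := ler_distD (W (m%:R / N%:R) w) (W s w) (W (i%:R / n%:R) w); lra.
Qed.

(** At level j the tail exponent is v (32/25)^j with v = x^2 n / 4, where 32/25 = 2 (4/5)^2. By exp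
    y >= y^6 / 720 and sqrt 2 <= 3/2, each of the n 2^j increments is too large with probability at
    most 1080 / (v^6 4^j), because (32/25)^6 >= 4. The sum over j is geometric of ratio 1/2. *)
Lemma prob_bad x : 0 < x -> (P (bad x) <= (2160 * n%:R / (x ^+ 2 * n%:R / 4) ^+ 6)%:E)%E.
Proof.
move=> x0; set v : R := x ^+ 2 * n%:R / 4; pose K : R := 2160 * n%:R / v ^+ 6; rewrite -/K.
have v0 : 0 < v by rewrite divr_gt0// mulr_gt0// exprn_gt0.
have v60 : 0 < v ^+ 6 by rewrite exprn_gt0.
have K0 : 0 <= K by apply: divr_ge0; [apply: mulr_ge0; exact: ler0n|exact: ltW].
pose E j := \big[setU/set0]_(i < n * 2 ^ j) rough x j i.
have mE j : measurable (E j) by apply: bigsetU_measurable => i _; exact: measurable_rough.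
have PR j i : (i < n * 2 ^ j)%N ->
    (P (rough x j i) <= (3 / 2 * 720 / (v * (32 / 25) ^+ j) ^+ 6)%:E)%E.
  move=> iN; pose N := (n * 2 ^ j)%N; have N0 : 0 < N%:R :> R.
    by rewrite ltr0n muln_gt0 n0 expn_gt0.
  have mA : measurable ([set y : measurableTypeR R | (x * (4 / 5) ^+ j < `|y|)%R]).
    rewrite -[X in measurable X]setTI.
    by apply: (@measurable_fun_ltr _ _ _ _ (cst (x * (4 / 5) ^+ j)) (fun x : R => `|x|)).
  rewrite /rough; rewrite (wiener_increment _ _ _ mA) ?divr_ge0//; last 2 first.
  - by rewrite ltr_pM2r ?invr_gt0// ltr_nat.
  - by rewrite ler_pdivrMr// mul1r ler_nat.
  have -> : i.+1%:R / N%:R - i%:R / N%:R = N%:R^-1 :> R.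
    by rewrite -mulrBl -natr1 addrAC subrr add0r mul1r.
  have sN0 : 0 < Num.sqrt N%:R^-1 :> R by rewrite sqrtr_gt0 invr_gt0.
  have a0 : 0 <= x * (4 / 5) ^+ j by rewrite mulr_ge0 ?(ltW x0)// exprn_ge0.
  apply: (le_trans (normal_tail sN0 a0)); rewrite lee_fin.
  have -> : (x * (4 / 5) ^+ j) ^+ 2 / (4 * Num.sqrt N%:R^-1 ^+ 2) = v * (32 / 25) ^+ j.
    rewrite sqr_sqrtr ?invr_ge0 ?(ltW N0)// /v /N natrM natrX.
    have -> : 32 / 25 = (4 / 5) ^+ 2 * 2 :> R by field.
    rewrite (exprMn j ((4 / 5) ^+ 2)) exprAC (exprMn 2 x).
    by field; rewrite expf_neq0// gt_eqF.
  set y := v * _; have y0 : 0 < y by rewrite mulr_gt0// exprn_gt0.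
  have := @expR_ge1Dxn R y 5 (ltW y0); rewrite (_ : 6`! = 720)%N// => ey.
  have sq2 : Num.sqrt 2 <= 3 / 2 :> R.
    by rewrite -[leRHS]ger0_norm// -sqrtr_sqr ler_sqrt; lra.
  have y6 : 0 < y ^+ 6 by rewrite exprn_gt0.
  have y720 : y ^+ 6 <= 720 * expR y.
    by rewrite -ler_pdivrMl ?ltr0n// mulrC; lra.
  rewrite expRN ler_pdivrMr ?expR_gt0// mulrAC ler_pdivlMr//.
  by have := ler_wpM2r (ltW y6) sq2; lra.
have PU N (F : nat -> set T) (c : R) : (forall i, measurable (F i)) ->
    (forall i, (i < N)%N -> (P (F i) <= c%:E)%E) ->
    (P (\big[setU/set0]_(i < N) F i) <= (N%:R * c)%:E)%E.
  move=> mF; elim: N => [|N IH] Fc; first by rewrite big_ord0 measure0 mul0r.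
  rewrite big_ord_recr/= -natr1 mulrDl mul1r EFinD.
  apply: (le_trans (measureU2 _ _ _)) => //; first by apply: bigsetU_measurable.
  by apply: leeD; [apply: IH => i iN; apply: Fc; exact: ltnW|exact: Fc].
have PE j : (P (E j) <= (K / (2 ^ j.+1)%:R)%:E)%E.
  apply: (le_trans (PU _ _ _ (measurable_rough x j) (PR j))); rewrite lee_fin.
  have q6 : 4 ^+ j <= ((32 / 25) ^+ j) ^+ 6 :> R.
    by rewrite exprAC lerXn2r ?nnegrE//; lra.
  have p2 : 0 < (2 : R) ^+ j by rewrite exprn_gt0.
  rewrite exprMn natrM natrX natrX (exprS 2 j) /K.
  have -> : 2160 * n%:R / v ^+ 6 / (2 * 2 ^+ j) =
     n%:R * 2 ^+ j * (3 / 2 * 720 / (v ^+ 6 * 4 ^+ j)).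
    have -> : (4 : R) ^+ j = 2 ^+ j * 2 ^+ j by rewrite -exprMn; congr (_ ^+ _); ring.
    by field; rewrite (gt_eqF p2) (gt_eqF v0).
  rewrite ler_wpM2l ?mulr_ge0 ?(ltW p2)//.
  apply: ler_wpM2l; first lra.
  rewrite lef_pV2 ?posrE.
  - by rewrite ler_wpM2l// exprn_ge0// ltW.
  - by rewrite mulr_gt0 ?exprn_gt0.
  - by rewrite mulr_gt0 ?exprn_gt0.
apply: (le_trans (le_mu_bigcup P mE (measurable_bad x))).
apply: le_trans (epsilon_trick0 xpredT K0).
by apply: lee_nneseries => // j *; exact: PE.
Qed.

(** The radius collects delta for the start z, delta + eta from [near_ind_gt0], 4 x for the path
    within a cell and x for the passage to the next grid point. *)
Lemma wiener_near (D : set (unit_interval R -> R)) (e x delta eta z : R) :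
  D `<=` C01 -> 0 < eta -> 0 < delta -> 0 < x -> 2 * delta + eta + 5 * x < e ->
  `|z| <= delta ->
  chain (normal_prob 0 sn) n 0
    (near_ind n eta delta [set a | D (broken_line n a)] 0) (fun=> z) <=
  fine (P [set w | enlargement D e (B w)]) + 2160 * n%:R / (x ^+ 2 * n%:R / 4) ^+ 6.
Proof.
move=> DC eta0 delta0 x0 le_e zd; set A := [set a | _].
have Fl := @near_ind_slip R n eta delta A eta0 0.
have ei0 : 0 <= eta^-1 by rewrite invr_ge0 ltW.
rewrite -(wiener_chain z ei0 Fl); set F := near_ind _ _ _ _ _.
pose b w (i : nat) := z + \sum_(0 <= j < i) Dn j w.
have mDn i : measurable_fun [set: T] (Dn i) by apply: measurable_funB; exact: mB.
have mF : measurable_fun [set: T] (fun w => F (b w)).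
  apply: (measurable_slip Fl.2 (x := fun i w => b w i)) => i.
  by apply: measurable_funD => //; apply: measurable_sum.
pose G := [set w | 0 < F (b w)].
have mG : measurable G.
  rewrite -[X in measurable X]setTI.
  have := @measurable_fun_ltr _ _ _ [set: T] (cst 0) (fun w => F (b w)).
  by move=> /(_ _ _ measurableT [set true]); apply.
pose En := [set w | enlargement D e (B w)].
have mEn : measurable En by exact: measurable_enlargement.
(* The path starts at 0 only almost surely; the exceptions form a null set. *)
pose Z := [set w | W 0 w != 0].
have mZ : measurable Z.
  rewrite (_ : Z = ~` (W 0 @^-1` [set 0])).
    apply: measurableC; rewrite -[X in measurable X]setTI.
    by apply: (mB (tpt 0)) => //; exact: measurable_set1.
  by apply/seteqP; split => w /=; [move=> /eqP|move=> H; apply/eqP].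
have PZ : P Z = 0%E.
  have [_ _ ae0 _ _] := wB.
  apply: measure_negligible => //; apply: negligibleS (ae0 (tpt 0) _).
    by move=> w /= /eqP.
  by rewrite time_tpt clamp01_id// lexx ler01.
have Gsub : G `<=` (En `|` bad x) `|` Z.
  move=> w Gw; have [a Aa Ha] := near_ind_gt0 eta0 delta0 Gw.
  have [W0|W0] := eqVneq (W 0 w) 0; last by right.
  left; have [bw|bw] := pselect (bad x w); [by right|left].
  have wa i : (i <= n)%N -> `|W (i%:R / n%:R) w - a i| <= eta + 2 * delta.
    move=> i_n; have := Ha i i_n; rewrite /b.
    have -> : \sum_(0 <= j < i) Dn j w = W (i%:R / n%:R) w.
      rewrite /Dn telescope_sumr// mul0r W0 subr0//.
    move: zd; rewrite !ler_norml; lra.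
  split; first exact: BC.
  exists (broken_line n a) => //; apply: le_lt_trans le_e; apply: uniform_dist_le => t.
  rewrite /broken_line -{1}(tptK t) -/(W (time t) w).
  have /andP[t0 t1] := time01 t; move: (time t) t0 t1 => s s0 s1 {t}.
  set k := Num.truncn _; have ns0 : 0 <= n%:R * s by rewrite mulr_ge0// ltW.
  have /andP[k1 k2] := truncn_itv ns0; rewrite -/k in k1 k2.
  have kn : (k <= n)%N.
    by rewrite -(ler_nat R) (le_trans k1)// ler_piMr// ltW.
  have [kn'|kn'] := ltnP k n.
    have b1 : `|W s w - W (k%:R / n%:R) w| <= 4 * x.
      by apply: wiener_smooth_block => //; [exact: ltW|rewrite k1].
    have b2 : `|W (k.+1%:R / n%:R) w - W (k%:R / n%:R) w| <= x.
      by have := @smooth x w (ltW x0) bw 0 k; rewrite expn0 muln1 expr0 mulr1; exact.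
    have b3 := wa k kn; have b4 := wa k.+1 kn'.
    have l0 : 0 <= n%:R * s - k%:R by rewrite subr_ge0.
    have l1 : n%:R * s - k%:R <= 1 by rewrite lerBlDr addrC natr1 ltW.
    move: (n%:R * s - k%:R) l0 l1 => l l0 l1.
    have c1 : `|W s w - a k| <= eta + 2 * delta + 5 * x.
      by move: b1 b3; rewrite !ler_norml; lra.
    have c2 : `|W s w - a k.+1| <= eta + 2 * delta + 5 * x.
      by move: b1 b2 b4; rewrite !ler_norml; lra.
    (* The broken line is a convex combination of the two neighbouring values, and W is close to
       both. *)
    have -> : W s w - (a k + l * (a k.+1 - a k)) =
      (1 - l) * (W s w - a k) + l * (W s w - a k.+1) by ring.
    apply: (le_trans (ler_normD _ _)); rewrite !normrM (ger0_norm l0).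
    rewrite (ger0_norm (_ : 0 <= 1 - l)); last by rewrite subr_ge0.
    have l10 : 0 <= 1 - l by rewrite subr_ge0.
    have := ler_wpM2l l10 c1; have := ler_wpM2l l0 c2; lra.
  (* The remaining case is time 1, where the slope term vanishes. *)
  have kE : k = n by apply/eqP; rewrite eqn_leq kn.
  have nsn : n%:R * s = n%:R.
    apply/eqP; rewrite eq_le; apply/andP; split; first by rewrite ler_piMr// ltW.
    by rewrite -{1}kE.
  have sE : s = n%:R / n%:R.
    by rewrite divff ?gt_eqF//; apply: (mulfI (lt0r_neq0 nR)); rewrite mulr1.
  rewrite nsn kE subrr mul0r addr0 sE.
  have := wa n (leqnn n); lra.
apply: (@le_trans _ _ (fine (P G))).
  have Fi : P.-integrable setT (EFin \o (fun w => F (b w))).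
    apply: (integrable_bounded _ (c := 1)) => // w.
    by have /andP[? ?] := Fl.1 (b w); rewrite ger0_norm.
  have PG : (fine (P G))%:E = P G by rewrite fineK// fin_num_measure.
  rewrite -lee_fin PG; have E1 := EFin_RintegralE measurableT Fi.
  apply: (@le_trans _ _ (\int[P]_w (F (b w))%:E)%E); first by rewrite -E1.
  apply: (@le_trans _ _ (\int[P]_w (\1_G w)%:E)%E); last by rewrite integral_indic// setIT.
  apply: ge0_le_integral => //.
  - by move=> w _; rewrite lee_fin; have /andP[] := Fl.1 (b w).
  - exact/measurable_EFinP.
  - by apply/measurable_EFinP; exact: measurable_indic.
  - move=> w _; rewrite lee_fin indicE; have /andP[f0 f1] := Fl.1 (b w).
    have [wG|wG] := pselect (G w); first by rewrite mem_set.
    by rewrite memNset//; move/negP: wG; rewrite -leNgt.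
have PG : (fine (P G))%:E = P G by rewrite fineK// fin_num_measure.
have PE : (fine (P En))%:E = P En by rewrite fineK// fin_num_measure.
rewrite -lee_fin PG EFinD PE.
apply: (@le_trans _ _ (P ((En `|` bad x) `|` Z))).
  by apply: le_measure; rewrite ?inE//; do 2 (apply: measurableU => //).
have mEb : measurable (En `|` bad x) by apply: measurableU.
apply: (le_trans (measureU2 _ mEb mZ)).
rewrite [X in (_ + X <= _)%E]PZ adde0.
apply: (le_trans (measureU2 _ mEn (measurable_bad x))).
by rewrite leeD2l// prob_bad.
Qed.

End wiener.

(** * Sublinear expectations *)

Section sublinear.
Context {R : realType} {Omega : Type}.
Variables (H : set (Omega -> R)) (E : (Omega -> R) -> R).
Hypothesis sE : sublinear_expectation H E.

Lemma sle_memN Y : H Y -> H (fun w => - Y w).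
Proof.
move=> HY; rewrite (_ : (fun w => - Y w) = (fun w => -1 * Y w)).
  exact: (sle_memZ sE).
by apply/funext => w; rewrite mulN1r.
Qed.

Lemma sle_memDr Y (c : R) : H Y -> H (fun w => Y w + c).
Proof. by move=> HY; exact: (sle_memD sE HY (sle_memcst sE c)). Qed.

(** Subadditivity for the constants c and -c gives the two inequalities. *)
Lemma sle_addr Y (c : R) : H Y -> E (fun w => Y w + c) = E Y + c.
Proof.
move=> HY; have HYc := sle_memDr c HY.
have le1 := sle_subadd sE HY (sle_memcst sE c).
have le2 := sle_subadd sE HYc (sle_memcst sE (- c)).
rewrite (sle_cst sE) in le1; rewrite (sle_cst sE) in le2.
have YE : (fun w => Y w + c + - c) = Y by apply/funext => w; rewrite addrK.
by rewrite YE in le2; lra.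
Qed.

Lemma lower_le_upper Y : H Y -> lower_expectation E Y <= E Y.
Proof.
move=> HY; have := sle_subadd sE HY (sle_memN HY).
have -> : (fun w => Y w + - Y w) = (fun=> 0) by apply/funext => w; rewrite subrr.
by rewrite (sle_cst sE) /lower_expectation; lra.
Qed.

Lemma sle_neghom (c : R) Y : H Y -> c <= 0 ->
  E (fun w => c * Y w) = c * lower_expectation E Y.
Proof.
move=> HY c0; rewrite /lower_expectation mulrN -mulNr.
rewrite -(sle_poshom sE (sle_memN HY)) ?oppr_ge0//.
by congr (E _); apply/funext => w; rewrite mulrNN.
Qed.

Section reference_variable.
Variable X0 : Omega -> R.
Hypotheses (H1 : H X0) (H2 : H (fun w => X0 w ^+ 2)).

Local Notation m1 := (mean_low E X0).
Local Notation m2 := (mean_up E X0).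

Lemma mean_low_le_up : m1 <= m2. Proof. exact: lower_le_upper. Qed.

Lemma sle_mem_centered (mu : R) : H (fun w => X0 w - mu).
Proof. exact: sle_memDr. Qed.

Lemma sle_mem_centered_sqr (mu : R) : H (fun w => (X0 w - mu) ^+ 2).
Proof.
rewrite (_ : (fun w => _) = (fun w => X0 w ^+ 2 + (- 2 * mu * X0 w + mu ^+ 2))).
  exact: (sle_memD sE H2 (sle_memDr _ (sle_memZ sE _ H1))).
by apply/funext => w; ring.
Qed.

Lemma upper_centered (mu : R) : E (fun w => X0 w - mu) = m2 - mu.
Proof. exact: sle_addr. Qed.

Lemma lower_centered (mu : R) : lower_expectation E (fun w => X0 w - mu) = m1 - mu.
Proof.
rewrite /mean_low /lower_expectation.
have -> : (fun w => - (X0 w - mu)) = (fun w => - X0 w + mu).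
  by apply/funext => w; rewrite opprB addrC.
by rewrite (sle_addr _ (sle_memN H1)) opprD.
Qed.

Lemma sqr_sd_up_at mu : sd_up_at E X0 mu ^+ 2 = E (fun w => (X0 w - mu) ^+ 2).
Proof.
rewrite sqr_sqrtr//; rewrite -(sle_cst sE 0).
apply: (sle_mono sE (sle_memcst sE 0) (sle_mem_centered_sqr mu)) => w.
exact: sqr_ge0.
Qed.

Lemma sqr_sd_low_at mu :
  sd_low_at E X0 mu ^+ 2 = lower_expectation E (fun w => (X0 w - mu) ^+ 2).
Proof.
rewrite sqr_sqrtr// /lower_expectation oppr_ge0 -(sle_cst sE 0).
apply: (sle_mono sE (sle_memN (sle_mem_centered_sqr mu)) (sle_memcst sE 0)) => w.
by rewrite oppr_le0 sqr_ge0.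
Qed.

Lemma sd_low_le_up mu : sd_low_at E X0 mu <= sd_up_at E X0 mu.
Proof.
by rewrite -ler_sqr ?nnegrE ?sqrtr_ge0// sqr_sd_up_at sqr_sd_low_at
  lower_le_upper//; exact: sle_mem_centered_sqr.
Qed.

Lemma sle_scale_le (c : R) : E (fun w => c * X0 w) <= `|c| * (`|m1| + `|m2|).
Proof.
have n1 := ler_norm m1; have n1' := ler_norm (- m1); have n2 := ler_norm m2.
have n2' := normr_ge0 m2; have n3 := normr_ge0 m1; rewrite normrN in n1'.
have [c0|c0] := leP 0 c.
  by rewrite (sle_poshom sE)// -/(mean_up E X0) ger0_norm// ler_wpM2l//; lra.
rewrite sle_neghom ?(ltW c0)// -/(mean_low E X0) ltr0_norm// -[leLHS]mulrNN.
by rewrite ler_wpM2l ?oppr_ge0 ?(ltW c0)//; lra.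
Qed.

Lemma continuous_of_quadratic_modulus (f : R -> R) (K : R) :
  (forall x y, f x - f y <= `|x - y| * (K + `|x| + `|y|)) -> continuous f.
Proof.
move=> fK y; apply/cvgrPdist_le => e e0.
have gc : (fun x : R => `|x - y| * (K + `|x| + `|y|)) x @[x --> y] --> (0 : R).
  rewrite [X in _ --> X](_ : 0 = `|y - y| * (K + `|y| + `|y|)); last first.
    by rewrite subrr normr0 mul0r.
  apply: cvgM.
    by apply: cvg_norm; apply: cvgB; [exact: cvg_id|exact: cvg_cst].
  apply: cvgD; last exact: cvg_cst.
  by apply: cvgD; [exact: cvg_cst|apply: cvg_norm; exact: cvg_id].
move/cvgrPdist_le : gc => /(_ e e0); apply: filterS => x.
rewrite sub0r normrN => /(le_trans (ler_norm _)) xe.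
have := fK x y; have := fK y x; rewrite (distrC y x) => a b.
rewrite ler_norml; lra.
Qed.

(** The difference of the two squares is affine in X_0, so subadditivity leaves an expectation
    linear in X_0. The values a = 1 and a = -1 give continuity of the upper and of the lower
    deviation. *)
Lemma centered_sqr_modulus (a mu nu : R) : `|a| <= 1 ->
  E (fun w => a * (X0 w - mu) ^+ 2) - E (fun w => a * (X0 w - nu) ^+ 2) <=
  `|mu - nu| * (2 * (`|m1| + `|m2|) + `|mu| + `|nu|).
Proof.
move=> a1; set c := 2 * a * (nu - mu); set b := a * (mu ^+ 2 - nu ^+ 2).
have -> : (fun w => a * (X0 w - mu) ^+ 2) =
    (fun w => a * (X0 w - nu) ^+ 2 + (c * X0 w + b)).
  by apply/funext => w; rewrite /b /c; ring.
have Hc := sle_memZ sE c H1.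
have := sle_subadd sE (sle_memZ sE a (sle_mem_centered_sqr nu)) (sle_memDr b Hc).
rewrite (sle_addr _ Hc); have := sle_scale_le c.
have ad : `|a| * `|mu - nu| <= `|mu - nu| by rewrite ler_piMl.
have -> : `|c| = 2 * (`|a| * `|mu - nu|).
  by rewrite /c !normrM ger0_norm// distrC mulrA.
have bl : b <= `|mu - nu| * (`|mu| + `|nu|).
  apply: (le_trans (ler_norm b)).
  rewrite /b (_ : mu ^+ 2 - nu ^+ 2 = (mu - nu) * (mu + nu)); last by ring.
  rewrite !normrM mulrA; apply: ler_pM => //; exact: ler_normD.
have M0 : 0 <= `|m1| + `|m2| by rewrite addr_ge0.
have := ler_wpM2r M0 ad.
lra.
Qed.

Lemma sd_up_continuous : continuous (sd_up_at E X0).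
Proof.
move=> mu; apply: continuous_comp; last exact: sqrt_continuous.
apply: (@continuous_of_quadratic_modulus _ (2 * (`|m1| + `|m2|))) => {}mu nu.
have := @centered_sqr_modulus 1 mu nu.
by rewrite normr1 lexx; under eq_fun do rewrite mul1r;
  under [X in _ - E X]eq_fun do rewrite mul1r; apply.
Qed.

Lemma sd_low_continuous : continuous (sd_low_at E X0).
Proof.
move=> mu; apply: continuous_comp; last exact: sqrt_continuous.
apply: (@continuous_of_quadratic_modulus _ (2 * (`|m1| + `|m2|))) => {}mu nu.
have := @centered_sqr_modulus (-1) nu mu.
rewrite normrN normr1 lexx => /(_ isT).
under eq_fun do rewrite mulN1r; under [X in _ - E X]eq_fun do rewrite mulN1r.
by rewrite (distrC nu) /lower_expectation; lra.
Qed.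

(** * Continuous choice of mean and deviation, and one step *)

Definition ramp (eta x : R) : R := clamp01 ((x + eta) / (2 * eta)).

Lemma ramp01 eta x : 0 <= ramp eta x <= 1.
Proof. exact: clamp01_lip.1. Qed.

Lemma ramp_continuous eta : continuous (ramp eta).
Proof.
move=> x; apply: (@continuous_comp _ _ _ (fun x => (x + eta) / (2 * eta)) (@clamp01 R)).
  by apply: cvgM; [apply: cvgD; [exact: cvg_id|exact: cvg_cst]|exact: cvg_cst].
exact: (lip01_continuous (@clamp01_lip R)).
Qed.

Lemma ramp1 eta x : 0 < eta -> eta <= x -> ramp eta x = 1.
Proof.
move=> e0 ex; rewrite /ramp /clamp01.
have x1 : 1 <= (x + eta) / (2 * eta) by rewrite ler_pdivlMr; lra.
by rewrite x1 leNgt (lt_le_trans ltr01 x1).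
Qed.

Lemma ramp0 eta x : 0 < eta -> x <= - eta -> ramp eta x = 0.
Proof.
move=> e0 ex; rewrite /ramp /clamp01.
have -> // : (x + eta) / (2 * eta) <= 0.
by rewrite ler_pdivrMr; lra.
Qed.

(* The choice against which the one-step Taylor expansion with first and second
   order coefficients [d1] and [d2] has the expectation of the Gaussian one: the
   upper mean and variance for positive coefficients and the lower ones for
   negative coefficients. The ramp makes the choice continuous. *)
Definition best_mean (eta d1 : R) : R := m1 + ramp eta d1 * (m2 - m1).

Definition best_sd (eta mu d2 : R) : R :=
  sd_low_at E X0 mu + ramp eta d2 * (sd_up_at E X0 mu - sd_low_at E X0 mu).

Lemma best_mean_bounds eta d1 : m1 <= best_mean eta d1 <= m2.
Proof.
rewrite /best_mean; have /andP[] := ramp01 eta d1; have := mean_low_le_up; nra.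
Qed.

Lemma best_sd_bounds eta mu d2 :
  sd_low_at E X0 mu <= best_sd eta mu d2 <= sd_up_at E X0 mu.
Proof.
rewrite /best_sd; have /andP[] := ramp01 eta d2; have := sd_low_le_up mu; nra.
Qed.

Lemma best_mean_continuous eta : continuous (best_mean eta).
Proof.
move=> x; apply: cvgD; first exact: cvg_cst.
by apply: cvgM; [exact: ramp_continuous|exact: cvg_cst].
Qed.

Lemma best_sd_continuous_comp (T : topologicalType) eta (f g : T -> R) :
  continuous f -> continuous g -> continuous (fun x => best_sd eta (f x) (g x)).
Proof.
move=> fc gc x.
have cl : {for x, continuous (fun x => sd_low_at E X0 (f x))}.
  by apply: (@continuous_comp _ _ _ f (sd_low_at E X0)); [exact: fc|exact: sd_low_continuous].
have cu : {for x, continuous (fun x => sd_up_at E X0 (f x))}.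
  by apply: (@continuous_comp _ _ _ f (sd_up_at E X0)); [exact: fc|exact: sd_up_continuous].
apply: cvgD; first exact: cl.
apply: cvgM; last by apply: cvgB.
by apply: (@continuous_comp _ _ _ g (ramp eta)); [exact: gc|exact: ramp_continuous].
Qed.

(** Where |d1| >= eta the ramp is saturated and the expectation is at most 0; in between, d1 itself
    is small. The same split proves [best_sd_drift]. *)
Lemma best_mean_drift eta d1 : 0 < eta ->
  E (fun w => d1 * (X0 w - best_mean eta d1)) <= eta * (m2 - m1).
Proof.
move=> e0; have m12 := mean_low_le_up.
have HC := sle_mem_centered (best_mean eta d1).
have [d10|d10] := leP 0 d1.
  rewrite (sle_poshom sE)// upper_centered.
  have [de|de] := leP eta d1; first by rewrite /best_mean ramp1//; nra.
  have /andP[] := best_mean_bounds eta d1; nra.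
rewrite sle_neghom ?(ltW d10)// lower_centered.
have [de|de] := leP d1 (- eta); first by rewrite /best_mean ramp0//; nra.
have /andP[] := best_mean_bounds eta d1; nra.
Qed.

Lemma best_sd_drift eta mu d2 : 0 < eta -> 0 < sd_low_at E X0 mu ->
  E (fun w => d2 * (X0 w - mu) ^+ 2) <=
  d2 * best_sd eta mu d2 ^+ 2 + eta * (2 * sd_up_at E X0 mu ^+ 2).
Proof.
move=> e0 l0; have HC := sle_mem_centered_sqr mu.
have /andP[b1 b2] := best_sd_bounds eta mu d2.
have b12 : sd_low_at E X0 mu ^+ 2 <= best_sd eta mu d2 ^+ 2.
  by rewrite lerXn2r// nnegrE; lra.
have b22 : best_sd eta mu d2 ^+ 2 <= sd_up_at E X0 mu ^+ 2.
  by rewrite lerXn2r// nnegrE; lra.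
have l20 := sqr_ge0 (sd_low_at E X0 mu).
have [d20|d20] := leP 0 d2.
  rewrite (sle_poshom sE)// -sqr_sd_up_at.
  have [de|de] := leP eta d2.
    have -> : best_sd eta mu d2 = sd_up_at E X0 mu by rewrite /best_sd ramp1//; ring.
    by rewrite lerDl mulr_ge0 ?(ltW e0)// mulr_ge0// sqr_ge0.
  by nra.
rewrite sle_neghom ?(ltW d20)// -sqr_sd_low_at.
have [de|de] := leP d2 (- eta).
  have -> : best_sd eta mu d2 = sd_low_at E X0 mu by rewrite /best_sd ramp0//; ring.
  by rewrite lerDl mulr_ge0 ?(ltW e0)// mulr_ge0// sqr_ge0.
by nra.
Qed.

(** The minimum of y^2 and y^3 is at most y^p, which gives the first branch. The second uses the
    quadratic bound alone together with delta^p <= delta^2, hence delta <= 1. *)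
Lemma truncated_remainder_le (p N delta a y r : R) :
  2 <= p <= 3 -> 0 < N -> 0 < delta <= 1 -> 0 <= y -> y * (delta * N) <= `|a| ->
  r <= 9 / 4 * y ^+ 3 -> r <= 9 / 2 * y ^+ 2 ->
  r <= 9 / 2 / (delta * N) `^ p * Num.min (`|a| `^ p) (N `^ (p - 2) * a ^+ 2).
Proof.
move=> /andP[p2 p3] N0 /andP[d0 d1] y0 ya r3 r2.
have U0 : 0 < delta * N by rewrite mulr_gt0.
have Up := powR_gt0 p U0; have p0 : 0 <= p by lra.
suff le_m : r * (delta * N) `^ p / (9 / 2) <=
    Num.min (`|a| `^ p) (N `^ (p - 2) * a ^+ 2).
  rewrite mulrAC ler_pdivlMr// -ler_pdivrMl; last lra.
  by rewrite mulrC.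
rewrite le_min ler_pdivrMr; last lra.
rewrite ler_pdivrMr; last lra.
apply/andP; split.
- have yp : r <= 9 / 2 * y `^ p.
    have [y1|y1] := leP y 1.
      have [yE|yn0] := eqVneq y 0.
        by move: r2; rewrite yE expr0n/= powR0; [lra|rewrite gt_eqF//; lra].
      have := @ger_powR R y; rewrite lt_neqAle eq_sym yn0 y0 y1 => /(_ isT _ _ p3).
      rewrite (powR_mulrn 3 y0); have := exprn_ge0 3 y0; lra.
    have := ler_powR (ltW y1) p2; rewrite (powR_mulrn 2 y0); lra.
  have : (y * (delta * N)) `^ p <= `|a| `^ p.
    by apply: ge0_ler_powR => //; rewrite nnegrE mulr_ge0 ?(ltW U0).
  rewrite powRM ?(ltW U0)// => ha.
  have := ler_wpM2r (ltW Up) yp; nra.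
- have dp : delta `^ p <= delta ^+ 2.
    rewrite -(powR_mulrn 2 (ltW d0)); apply: ger_powR => //.
    by rewrite d0.
  have Np : N `^ p = N `^ (p - 2) * N ^+ 2.
    rewrite -(powR_mulrn 2 (ltW N0)) -powRD ?subrK//.
    by apply/implyP => _; rewrite gt_eqF.
  have N2 := powR_gt0 (p - 2) N0.
  have ya2 : (y * (delta * N)) ^+ 2 <= a ^+ 2.
    have yU0 : 0 <= y * (delta * N) by rewrite mulr_ge0 ?(ltW U0).
    by rewrite -(real_normK (num_real a)) lerXn2r// nnegrE.
  have y2 := sqr_ge0 y.
  have s1 : y ^+ 2 * (delta * N) `^ p <= N `^ (p - 2) * a ^+ 2.
    apply: (@le_trans _ _ (N `^ (p - 2) * (y * (delta * N)) ^+ 2)); last first.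
      by rewrite ler_pM2l.
    rewrite powRM ?(ltW d0) ?(ltW N0)// Np.
    rewrite (_ : _ * _ = N `^ (p - 2) * (y ^+ 2 * N ^+ 2 * delta `^ p)); last by ring.
    rewrite ler_pM2l// (_ : (y * _) ^+ 2 = y ^+ 2 * N ^+ 2 * delta ^+ 2); last by ring.
    by rewrite ler_wpM2l// mulr_ge0// sqr_ge0.
  have := ler_wpM2r (ltW Up) r2; lra.
Qed.

(** Subadditivity separates the Taylor terms. The linear one costs only ramp error, the quadratic
    one becomes the Gaussian value [d2 / (2 * n%:R)] plus ramp error, and the remainder is dominated
    by the truncated moment because sg is at least the lower deviation used in [standardized]. *)
Lemma sublinear_step (n : nat) (p g delta eta s0 S c d1 d2 : R) (F : R -> R) :
  (0 < n)%N -> 2 <= p <= 3 -> 0 < delta <= 1 -> 0 < eta -> 0 < s0 ->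
  (forall mu, m1 <= mu <= m2 -> s0 <= sd_low_at E X0 mu /\ sd_up_at E X0 mu <= S) ->
  gamma_trunc H E X0 p (Num.sqrt n%:R) = g%:E ->
  let mu := best_mean eta d1 in
  let sg := best_sd eta mu d2 in
  H (fun w => F ((X0 w - mu) / (sg * Num.sqrt n%:R))) ->
  (forall z, let r := F z - (c + d1 * z + d2 * z ^+ 2 / 2) in
     `|r| <= 9 / 4 * (`|z| / delta) ^+ 3 /\ `|r| <= 9 / 2 * (z / delta) ^+ 2) ->
  E (fun w => F ((X0 w - mu) / (sg * Num.sqrt n%:R))) <=
    c + d2 / (2 * n%:R) + eta * ((m2 - m1) / s0 + S ^+ 2 / s0 ^+ 2) +
    9 / 2 * g / (delta * Num.sqrt n%:R) `^ p.
Proof.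
move=> n0 p23 /andP[d0 dle1] e0 s00 sS gE mu sg HF FT.
set N := Num.sqrt n%:R; have n1 : 1 <= n%:R :> R by rewrite ler1n.
have N2 : N ^+ 2 = n%:R by rewrite sqr_sqrtr.
have N0 : 0 < N by rewrite sqrtr_gt0; lra.
have N1 : 1 <= N by rewrite -sqrtr1 ler_sqrt.
have mur : m1 <= mu <= m2 by exact: best_mean_bounds.
have [sl su] := sS mu mur; have sl0 : 0 < sd_low_at E X0 mu by lra.
have /andP[sg1 sg2] : sd_low_at E X0 mu <= sg <= sd_up_at E X0 mu by exact: best_sd_bounds.
have sg0 : 0 < sg by lra.
have m12 := mean_low_le_up.
have Up : 0 < (delta * N) `^ p by rewrite powR_gt0// mulr_gt0.
set K : R := 9 / 2 / (delta * N) `^ p; have K0 : 0 <= K by rewrite /K divr_ge0 ?(ltW Up)//; lra.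
apply/ler_addgt0Pr => e e_gt0.
(* The infimum in the extended expectation need not be attained, so Y is optimal up to e / (K +
   1). *)
have [Y [HY YE] EY] : exists2 Y, H Y /\ (forall w,
    Num.min (`|standardized E X0 mu w| `^ p)
      (N `^ (p - 2) * standardized E X0 mu w ^+ 2) <= Y w) & K * E Y <= K * g + e.
  have : (extended_expectation H E (fun w => Num.min (`|standardized E X0 mu w| `^ p)
      (N `^ (p - 2) * standardized E X0 mu w ^+ 2))%R < (g + e / (K + 1))%:E)%E.
    apply: (@le_lt_trans _ _ g%:E); last by rewrite lte_fin ltrDl divr_gt0//; lra.
    rewrite -gE; apply: ereal_sup_ubound; exists mu; last by reflexivity.
    by rewrite /mean_range /= in_itv.
  move=> /ereal_inf_lt[_ [Y [HY YE] <-]]; rewrite lte_fin => EY; exists Y => //.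
  have K1 : K * (e / (K + 1)) <= e.
    by rewrite mulrCA ler_piMr ?(ltW e_gt0)// ler_pdivrMr; lra.
  have := ler_wpM2l K0 (ltW EY); lra.
pose a1 := (sg * N)^-1; have a10 : 0 < a1 by rewrite invr_gt0 mulr_gt0.
pose a2 := a1 ^+ 2 / 2; have a20 : 0 <= a2 by rewrite divr_ge0// sqr_ge0.
pose L w := d1 * (X0 w - mu); pose Q w := d2 * (X0 w - mu) ^+ 2.
have HL : H L by exact: (sle_memZ sE _ (sle_mem_centered mu)).
have HQ : H Q by exact: (sle_memZ sE _ (sle_mem_centered_sqr mu)).
have HL' := sle_memZ sE a1 HL; have HQ' := sle_memZ sE a2 HQ.
have HY' := sle_memZ sE K HY.
have HS := sle_memD sE (sle_memD sE HL' HQ') HY'.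
have EF : E (fun w => F ((X0 w - mu) / (sg * N))) <=
    a1 * E L + a2 * E Q + K * E Y + c.
  have := sle_mono sE HF (sle_memDr c HS); rewrite (sle_addr _ HS) => EF.
  apply: (le_trans (EF _)) => [w|]; last first.
    rewrite lerD2r; apply: (le_trans (sle_subadd sE (sle_memD sE HL' HQ') HY')).
    rewrite (sle_poshom sE HY K0) lerD2r; apply: (le_trans (sle_subadd sE HL' HQ')).
    by rewrite (sle_poshom sE HL (ltW a10)) (sle_poshom sE HQ a20).
  set z := (X0 w - mu) / (sg * N); have [r3 r2] := FT z.
  set r := F z - _ in r3 r2.
  have zE : a1 * L w + a2 * Q w = d1 * z + d2 * z ^+ 2 / 2.
    by rewrite /a2 /L /Q /z -/a1; ring.
  have rY : r <= K * Y w.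
    apply: le_trans (ler_wpM2l K0 (YE w)).
    apply: (@truncated_remainder_le p N delta _ (`|z| / delta)) => //.
    - by rewrite d0.
    - by rewrite divr_ge0// ltW.
    - rewrite /standardized /z !normrM !normfV normrM (gtr0_norm sg0) (gtr0_norm N0).
      rewrite (gtr0_norm sl0).
      rewrite (_ : _ * (delta * N) = `|X0 w - mu| / sg); last first.
        by field; rewrite !gt_eqF.
      by rewrite ler_wpM2l// lef_pV2.
    - by apply: le_trans r3; exact: ler_norm.
    - apply: (le_trans (ler_norm r)); apply: (le_trans r2).
      have zz (t : R) : (t / delta) ^+ 2 = (`|t| / delta) ^+ 2.
        by rewrite !exprMn real_normK ?num_real.
      by rewrite zz.
  by rewrite zE; rewrite /r in rY; lra.
have EL : a1 * E L <= eta * ((m2 - m1) / s0).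
  have sN : s0 <= sg * N by nra.
  apply: (le_trans (ler_wpM2l (ltW a10) (best_mean_drift d1 e0))).
  rewrite mulrCA ler_pM2l// mulrC ler_wpM2l ?subr_ge0// lef_pV2 ?posrE//.
  by rewrite mulr_gt0.
have EQ : a2 * E Q <= d2 / (2 * n%:R) + eta * (S ^+ 2 / s0 ^+ 2).
  apply: (le_trans (ler_wpM2l a20 (best_sd_drift d2 e0 sl0))).
  rewrite -/sg /a2 /a1 -N2.
  rewrite (_ : (sg * N)^-1 ^+ 2 / 2 * (d2 * sg ^+ 2 + eta * (2 * sd_up_at E X0 mu ^+ 2)) =
      d2 / (2 * N ^+ 2) + eta * (sd_up_at E X0 mu ^+ 2 / (sg * N) ^+ 2)).
    rewrite lerD2l ler_pM2l// ler_pM ?invr_ge0 ?sqr_ge0//.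
      by rewrite lerXn2r// nnegrE; lra.
    rewrite lef_pV2 ?posrE ?exprn_gt0 ?mulr_gt0// lerXn2r ?nnegrE; nra.
  by field; rewrite !gt_eqF.
rewrite (_ : 9 / 2 * g / (delta * N) `^ p = K * g); first lra.
by rewrite /K; field; rewrite gt_eqF.
Qed.

(** The truncated power of y = |xi_0| is at least min(y^2, y^3) >= y^2 - 4/27, and the upper
    expectation of xi_0^2 is at least 1. *)
Lemma gamma_trunc_ge (p N s0 : R) : 2 <= p <= 3 -> 1 <= N -> 0 < s0 ->
  (forall mu, m1 <= mu <= m2 -> s0 <= sd_low_at E X0 mu) ->
  ((23 / 27)%:E <= gamma_trunc H E X0 p N)%E.
Proof.
move=> /andP[p2 p3] N1 s00 sl; set mu := m1.
have sl0 : 0 < sd_low_at E X0 mu.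
  by apply: (lt_le_trans s00); apply: sl; rewrite lexx mean_low_le_up.
apply: le_ereal_sup_tmp; eexists.
  exists mu; last by reflexivity.
  by rewrite /mean_range /= in_itv/= lexx mean_low_le_up.
apply: le_ereal_inf_tmp => _ [Y [HY YE] <-]; rewrite lee_fin.
pose a := (sd_low_at E X0 mu ^+ 2)^-1.
have a0 : 0 <= a by rewrite invr_ge0 sqr_ge0.
have HC := sle_mem_centered_sqr mu; have HaC := sle_memZ sE a HC.
have EC : 1 <= a * E (fun w => (X0 w - mu) ^+ 2).
  rewrite -sqr_sd_up_at /a mulrC ler_pdivlMr ?exprn_gt0// mul1r.
  by rewrite lerXn2r ?nnegrE ?sqrtr_ge0// sd_low_le_up.
suff : E (fun w => a * (X0 w - mu) ^+ 2 + - (4 / 27)) <= E Y.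
  by rewrite (sle_addr _ HaC) (sle_poshom sE HC a0); lra.
apply: (sle_mono sE (sle_memDr _ HaC) HY) => w; apply: le_trans (YE w).
set x := standardized E X0 mu w.
have -> : a * (X0 w - mu) ^+ 2 = x ^+ 2 by rewrite /x /standardized /a expr_div_n mulrC.
have x0 := normr_ge0 x; rewrite -(real_normK (num_real x)).
move: (`|x|) x0 => y y0.
have Np : 1 <= N `^ (p - 2) by have := @ler_powR R N N1 0 (p - 2); rewrite powRr0; apply; lra.
rewrite le_min; apply/andP; split; last by have := sqr_ge0 y; nra.
have [y1|y1] := leP y 1; last first.
  by have := ler_powR (ltW y1) p2; rewrite (powR_mulrn 2 y0); lra.
have [->|yn0] := eqVneq y 0.
  by rewrite expr0n/= powR0; [lra|rewrite gt_eqF//; lra].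
have := @ger_powR R y; rewrite lt_neqAle eq_sym yn0 y0 y1 => /(_ isT _ _ p3).
rewrite (powR_mulrn 3 y0).
have : 0 <= (y - 2 / 3) ^+ 2 * (y + 1 / 3) by rewrite mulr_ge0 ?sqr_ge0//; lra.
by lra.
Qed.

End reference_variable.
End sublinear.

(** * The normalized walk *)

Section slip_continuity.
Context {R : realType} {T : topologicalType}.

Lemma slip_continuous_comp (L : R) k (F : (nat -> R) -> R) (x : T -> nat -> R) :
  slip L k F -> (forall i, continuous (fun v => x v i)) -> continuous (fun v => F (x v)).
Proof.
move=> FL xc v; apply/cvgrPdist_le => e e0.
have L0 : 0 < `|L| + 1 by rewrite ltr_wpDl.
have eL : 0 < e / (`|L| + 1) by rewrite divr_gt0.
have near_i (i : 'I_k.+1) : \forall u \near v, `|x v i - x u i| <= e / (`|L| + 1).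
  by have /cvgrPdist_le := xc i v; apply.
have := @filter_forall _ _ (fun (i : 'I_k.+1) u => `|x v i - x u i| <= e / (`|L| + 1))
  (nbhs v) (nbhs_filter v) near_i.
apply: filterS => u Hu.
have Hi i : (i <= k)%N -> `|x v i - x u i| <= e / (`|L| + 1).
  by rewrite -ltnS => ik; exact: (Hu (Ordinal ik)).
apply: (le_trans (FL _ _ _ Hi)); rewrite mulrCA ler_piMr ?(ltW e0)//.
by rewrite ler_pdivrMr// mul1r; have := ler_norm L; lra.
Qed.

Lemma continuous_upd k (x : T -> nat -> R) (f : T -> R) :
  (forall i, continuous (fun v => x v i)) -> continuous f ->
  forall i, continuous (fun v => upd (x v) k (f v) i).
Proof. by move=> xc fc i; rewrite /upd; case: eqP. Qed.

End slip_continuity.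

Section process.
Context {R : realType} {Omega : Type}.
Variables (H : set (Omega -> R)) (E : (Omega -> R) -> R) (X : nat -> Omega -> R).
Hypotheses (sE : sublinear_expectation H E) (iX : iid_with_X0 H E X).
Hypotheses (H1 : H (X 0%N)) (H2 : H (fun w => X 0%N w ^+ 2)).
Variables (n : nat) (p g delta eta tau s0 S : R) (A : set (nat -> R)).
Hypotheses (n0 : (0 < n)%N) (p23 : 2 <= p <= 3) (delta01 : 0 < delta <= 1).
Hypotheses (eta0 : 0 < eta) (tau0 : 0 < tau) (s00 : 0 < s0).
Hypothesis sdS : forall mu, mean_low E (X 0%N) <= mu <= mean_up E (X 0%N) ->
  s0 <= sd_low_at E (X 0%N) mu /\ sd_up_at E (X 0%N) mu <= S.
Hypothesis gE : gamma_trunc H E (X 0%N) p (Num.sqrt n%:R) = g%:E.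

Let delta0 : 0 < delta. Proof. by case/andP: delta01. Qed.

Let sn : R := Num.sqrt n%:R^-1.
Let sn0 : 0 < sn. Proof. by rewrite sqrtr_gt0 invr_gt0 ltr0n. Qed.

Let hyb := hybrid (normal_prob 0 sn) n eta delta A.
Let slp := slope (normal_prob 0 sn) n eta delta A.
Let crv := curvature (normal_prob 0 sn) n eta delta A.

(** Together with [volatility], the normalization of [X k.+1] as a function of the positions 0, ...,
    k. These positions depend on the earlier normalizations, hence the recursion in [walk]. *)
Definition drift k (s : nat -> R) : R := best_mean E (X 0%N) tau (slp k s).
Definition volatility k (s : nat -> R) : R :=
  best_sd E (X 0%N) tau (drift k s) (crv k s).

Definition advance k (s : nat -> R) (y : R) : nat -> R :=
  upd s k.+1 (s k + (y - drift k s) / (volatility k s * Num.sqrt n%:R)).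

(* Values at [0, ..., k] of the normalized walk driven by [x 1, ..., x k]. *)
Fixpoint walk (x : nat -> R) (k : nat) : nat -> R :=
  if k is k'.+1 then advance k' (walk x k') (x k) else fun=> 0.

Lemma walk_eq k x y : (forall i, (0 < i <= k)%N -> x i = y i) -> walk x k = walk y k.
Proof.
elim: k => [//|k IH] xy /=; rewrite IH; last first.
  by move=> i /andP[i0 ik]; apply: xy; rewrite i0 leqW.
by rewrite xy// ltn0Sn leqnn.
Qed.

Lemma walkE x k i : (i <= k)%N -> walk x k i = (Num.sqrt n%:R)^-1 *
  \sum_(1 <= j < i.+1) (x j - drift j.-1 (walk x j.-1)) / volatility j.-1 (walk x j.-1).
Proof.
elim: k i => [|k IH] i.
  by rewrite leqn0 => /eqP ->; rewrite big_geq// mulr0.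
rewrite leq_eqVlt => /predU1P[->|ik]; last first.
  by rewrite /= /advance upd_neq ?ltn_eqF// IH.
rewrite /= /advance upd_same IH// [in RHS]big_nat_recr//= mulrDr; congr (_ + _).
by rewrite invfM mulrA mulrC.
Qed.

Lemma continuous_drift (T : topologicalType) k (x : T -> nat -> R) : (k < n)%N ->
  (forall i, continuous (fun v => x v i)) -> continuous (fun v => drift k (x v)).
Proof.
move=> kn xc v.
have [L sL] := slope_slip (normal_prob 0 sn) A eta0 delta0 kn.
apply: (@continuous_comp _ _ _ (fun v => slp k (x v)) (best_mean E (X 0%N) tau)).
  exact: (slip_continuous_comp sL xc).
exact: best_mean_continuous.
Qed.

Lemma continuous_volatility (T : topologicalType) k (x : T -> nat -> R) : (k < n)%N ->
  (forall i, continuous (fun v => x v i)) -> continuous (fun v => volatility k (x v)).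
Proof.
move=> kn xc.
have [L sL] := curvature_slip (normal_prob 0 sn) A eta0 delta0 kn.
apply: (best_sd_continuous_comp sE H1 H2); first exact: continuous_drift.
exact: (slip_continuous_comp sL xc).
Qed.

Lemma volatility_gt0 k s : 0 < volatility k s.
Proof.
have [l _] := sdS (best_mean_bounds sE H1 tau (slp k s)).
have /andP[b _] := best_sd_bounds sE H1 H2 tau (drift k s) (crv k s).
by rewrite /volatility; apply: lt_le_trans b; exact: lt_le_trans l.
Qed.

Lemma continuous_advance (T : topologicalType) k (x : T -> nat -> R) (y : T -> R) :
  (k < n)%N -> (forall i, continuous (fun v => x v i)) -> continuous y ->
  forall i, continuous (fun v => advance k (x v) (y v) i).
Proof.
move=> kn xc yc; apply: continuous_upd => // v.
apply: cvgD; first exact: xc.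
apply: cvgM; first by apply: cvgB; [exact: yc|exact: continuous_drift].
apply: cvgV; first by rewrite mulf_neq0 ?gt_eqF ?volatility_gt0// sqrtr_gt0 ltr0n.
by apply: cvgM; [exact: continuous_volatility|exact: cvg_cst].
Qed.

Lemma continuous_walk (T : topologicalType) k (x : T -> nat -> R) : (k <= n)%N ->
  (forall i, continuous (fun v => x v i)) ->
  forall i, continuous (fun v => walk (x v) k i).
Proof.
elim: k => [|k IH] kn xc i /=; first by move=> v; exact: cvg_cst.
by apply: continuous_advance => //; apply: IH => //; exact: ltnW.
Qed.

Lemma continuous_hybrid (T : topologicalType) k (x : T -> nat -> R) : (k <= n)%N ->
  (forall i, continuous (fun v => x v i)) -> continuous (fun v => hyb k (x v)).
Proof.
move=> kn xc.
exact: (slip_continuous_comp (slip_hybrid (normal_prob 0 sn) A eta0 delta0 kn) xc).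
Qed.

Let hyb01 k x : (k <= n)%N -> 0 <= hyb k x <= 1.
Proof. exact: hybrid01. Qed.

Let hyb_norm k x : (k <= n)%N -> `|hyb k x| <= 1.
Proof. by move=> /(hyb01 x)/andP[? ?]; rewrite ger0_norm. Qed.

(** The Gaussian counterpart of [sublinear_step]: mean 0 and variance 1/n leave the same constant
    and curvature terms, so these cancel when the two are combined. The error is 9/4 times the third
    moment constant 13/4. *)
Lemma gaussian_step k s : (k < n)%N ->
  hyb k.+1 (upd s k.+1 (s k)) + crv k s / (2 * n%:R) <=
  hyb k s + 117 / 16 * sn ^+ 3 / delta ^+ 3.
Proof.
have arith_end (a b q m h r : R) : a + b + - q * m <= h -> q * m <= r -> a + b <= h + r.
  by move=> *; lra.
move=> kn; set c := hyb k.+1 _; set nu := normal_prob 0 sn.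
have sn2 : sn ^+ 2 = n%:R^-1 by rewrite sqr_sqrtr// invr_ge0.
have le_step := step_hybrid_le nu A eta0 delta0 s kn.
have i1 := integrable_normal_id sn0; have i2 := integrable_normal_sqr sn0.
have i3 := integrable_normal_abs3 sn0; have ic := integrable_normal_cst sn.
pose e3 : R := - (9 / 4 / delta ^+ 3).
have iZ (f : R -> R) (b : R) : nu.-integrable [set: R] (EFin \o f) ->
    nu.-integrable [set: R] (EFin \o (fun x => b * f x)).
  by move=> fi; exact: (integrableZl measurableT b fi).
have iD (f h : R -> R) : nu.-integrable [set: R] (EFin \o f) ->
    nu.-integrable [set: R] (EFin \o h) ->
    nu.-integrable [set: R] (EFin \o (fun x => f x + h x)).
  by move=> fi hi; exact: (integrableD measurableT fi hi).
pose f (x : R) := c + slp k s * x + (crv k s / 2) * x ^+ 2 + e3 * `|x| ^+ 3.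
have iA := iD _ _ (ic c) (iZ _ (slp k s) i1).
have iB := iD _ _ iA (iZ _ (crv k s / 2) i2).
have iF := iD _ _ iB (iZ _ e3 i3).
have Ef : \int[nu]_x f x = c + crv k s / 2 * n%:R^-1 + e3 * \int[nu]_x (`|x| ^+ 3).
  rewrite (RintegralD measurableT iB (iZ _ e3 i3)).
  rewrite (RintegralD measurableT iA (iZ _ (crv k s / 2) i2)).
  rewrite (RintegralD measurableT (ic c) (iZ _ (slp k s) i1)).
  rewrite (RintegralZl _ measurableT i1) (RintegralZl _ measurableT i2).
  rewrite (RintegralZl _ measurableT i3) Rintegral_normal_cst.
  by rewrite normal_mean// normal_second_moment// mulr0 addr0 sn2.
have lipF : exists L, lip01 L (fun w => hyb k.+1 (upd s k.+1 (s k + w))).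
  have sH : slip01 (2 / eta) k.+1 (hyb k.+1).
    by split; [move=> x; exact: hyb01|exact: slip_hybrid].
  by exists (2 / eta); exact: (lip01_shiftl (s k) (slip01_section s k.+1 sH)).
have [L lipL] := lipF.
have le_f : \int[nu]_x f x <= step nu k (hyb k.+1) s.
  apply: (le_Rintegral measurableT iF (lip01_integrable nu lipL)) => x _.
  have [r3 _] := hybrid_taylor nu A eta0 delta0 s x kn.
  rewrite -/hyb -/c -/(slp k s) -/(crv k s) in r3.
  rewrite /f /e3; move: r3; rewrite expr_div_n => /ler_normlP[+ _].
  have arith (F a b y d : R) : - (F - (c + a * x + b * x ^+ 2 / 2)) <= 9 / 4 * (y / d) ->
      c + a * x + b / 2 * x ^+ 2 + - (9 / 4 / d) * y <= F by lra.
  exact: arith.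
have m3 := normal_abs_third_moment sn0; rewrite -/nu in m3.
have e3m : 9 / 4 / delta ^+ 3 * \int[nu]_x (`|x| ^+ 3) <= 117 / 16 * sn ^+ 3 / delta ^+ 3.
  have d30 : 0 <= 9 / 4 / delta ^+ 3 by rewrite divr_ge0// exprn_ge0// ltW.
  apply: (le_trans (ler_wpM2l d30 m3)); rewrite le_eqVlt; apply/orP; left.
  by apply/eqP; field; rewrite gt_eqF.
have -> : crv k s / (2 * n%:R) = crv k s / 2 * n%:R^-1 by rewrite invfM mulrA.
move: le_step; rewrite -/(hyb k s) -/(hyb k.+1) => le_step.
by apply: arith_end e3m; rewrite -Ef; exact: le_trans le_f le_step.
Qed.

(** In order: the ramps, the Taylor remainder of the normalized variable, and the Gaussian Taylor
    remainder. *)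
Definition step_error : R :=
  tau * ((mean_up E (X 0%N) - mean_low E (X 0%N)) / s0 + S ^+ 2 / s0 ^+ 2) +
  9 / 2 * g / (delta * Num.sqrt n%:R) `^ p + 117 / 16 * sn ^+ 3 / delta ^+ 3.

Let one_dim k s : (k < n)%N ->
  continuous (fun y : R => hyb k.+1 (advance k s y)) /\
  exists M : R, forall y, `|hyb k.+1 (advance k s y)| <= M.
Proof.
move=> kn; split; last by exists 1 => y; exact: hyb_norm.
apply: continuous_hybrid => //; apply: continuous_advance => // [i v|v].
  exact: cvg_cst.
exact: cvg_id.
Qed.

(** With the history frozen, identical distribution replaces [X k.+1] by [X 0], to which the
    parameters refer. *)
Lemma step_le k s : (k < n)%N ->
  E (fun w => hyb k.+1 (advance k s (X k.+1 w))) <= hyb k s + step_error.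
Proof.
have arith (a b t r h q : R) : a + b <= h + q -> a + b + t + r <= h + (t + r + q).
  by move=> *; lra.
move=> kn; have [yc yb] := one_dim s kn.
have [_ HX EX] := iX.2 k.+1 isT _ yc yb.
rewrite /comp in EX HX; rewrite EX.
pose F z := hyb k.+1 (upd s k.+1 (s k + z)).
have := @sublinear_step _ _ H E sE (X 0%N) H1 H2 n p g delta tau s0 S
  (hyb k.+1 (upd s k.+1 (s k))) (slp k s) (crv k s) F n0 p23 delta01 tau0 s00 sdS gE HX.
have FT z := hybrid_taylor (normal_prob 0 sn) A eta0 delta0 s z kn.
move=> /(_ FT) EF; apply: (le_trans EF).
exact: arith (gaussian_step s kn).
Qed.

(** A left inverse of [history] for indices 1, ..., k: the shift is there because X is numbered from
    1 and row entries from 0. Beyond k the value is 0. *)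
Definition coords k (v : 'rV[R]_k) (i : nat) : R :=
  if insub i.-1 is Some j then v ord0 j else 0.

Lemma coords_history k w i : (0 < i <= k)%N -> coords (history X k w) i = X i w.
Proof.
case: i => [//|i] /= ik; rewrite /coords /= (insubT (fun m => m < k)%N ik).
by rewrite mxE.
Qed.

Lemma coords_row_mxl k (v : 'rV[R]_k) (u : 'rV[R]_1) i : (0 < i <= k)%N ->
  coords (row_mx v u) i = coords v i.
Proof.
case: i => [//|i] /= ik; have ik1 : (i < k + 1)%N by rewrite addn1 ltnW.
rewrite /coords /= (insubT (fun m => m < k + 1)%N ik1) (insubT (fun m => m < k)%N ik).
rewrite -(row_mxEl v u); congr (row_mx v u _ _); exact: val_inj.
Qed.

Lemma coords_row_mxr k (v : 'rV[R]_k) (u : 'rV[R]_1) :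
  coords (row_mx v u) k.+1 = u ord0 ord0.
Proof.
have ik1 : (k < k + 1)%N by rewrite addn1.
rewrite /coords /= (insubT (fun m => m < k + 1)%N ik1).
rewrite -(row_mxEr v u); congr (row_mx v u _ _).
by apply: val_inj; rewrite /= addn0.
Qed.

Lemma continuous_coords k i : continuous (fun v : 'rV[R]_k => coords v i).
Proof.
rewrite /coords; case: insub => [j|]; first exact: coord_continuous.
exact: cst_continuous.
Qed.

Lemma walk_history k j w : (k <= j)%N ->
  walk (coords (history X j w)) k = walk (X^~ w) k.
Proof.
move=> kj; apply: walk_eq => i /andP[i0 ik].
by rewrite coords_history// i0 (leq_trans ik).
Qed.

Lemma walk_row_mx k (v : 'rV[R]_k) (u : 'rV[R]_1) :
  walk (coords (row_mx v u)) k.+1 = advance k (walk (coords v) k) (u ord0 ord0).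
Proof.
rewrite /= coords_row_mxr; congr advance; apply: walk_eq => i ik.
exact: coords_row_mxl.
Qed.

(** Independence turns the expectation into an iterated one; [step_le] bounds the inner expectation
    pointwise, and monotonicity with the induction hypothesis bounds the outer one. *)
Lemma hybrid_walk_le k : (k <= n)%N ->
  H (fun w => hyb k (walk (X^~ w) k)) /\
  E (fun w => hyb k (walk (X^~ w) k)) <= hyb 0 (fun=> 0) + k%:R * step_error.
Proof.
elim: k => [|k IH] kn /=.
  by rewrite (sle_cst sE) mul0r addr0; split=> //; exact: (sle_memcst sE).
have [HG EG] := IH (ltnW kn); rewrite -natr1 mulrDl mul1r addrA.
(* Independence starts at the second variable; the first step rests on identical distribution
   alone. *)
case: k => [|k] in kn IH HG EG *.
  have [yc yb] := one_dim (fun=> 0) kn.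
  have [HX _ _] := iX.2 1%N isT _ yc yb; split; first exact: HX.
  by rewrite mul0r addr0; exact: (step_le (fun=> 0) kn).
pose psi (v : 'rV[R]_(k.+1 + 1)) := hyb k.+2 (walk (coords v) k.+2).
have psi_bc : bounded_continuous psi.
  split; last by exists 1 => v; exact: hyb_norm.
  apply: continuous_hybrid => //; apply: continuous_walk => // i.
  exact: continuous_coords.
have psiV v u : psi (row_mx v u) = hyb k.+2 (advance k.+1 (walk (coords v) k.+1) (u ord0 ord0)).
  by rewrite /psi walk_row_mx.
move: psi psi_bc psiV => psi psi_bc psiV.
pose last_var w : 'rV[R]_1 := \row_(j < 1) X k.+2 w.
have [Hpsi Hin Epsi] : [/\ H (fun w => psi (row_mx (history X k.+1 w) (last_var w))),
    H (fun w => E (fun w' => psi (row_mx (history X k.+1 w) (last_var w')))) &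
    E (fun w => psi (row_mx (history X k.+1 w) (last_var w))) =
    E (fun w => E (fun w' => psi (row_mx (history X k.+1 w) (last_var w'))))].
  exact: (iX.1 k.+2 isT psi psi_bc).
have psiE : (fun w => psi (row_mx (history X k.+1 w) (last_var w))) =
    (fun w => hyb k.+2 (advance k.+1 (walk (X^~ w) k.+1) (X k.+2 w))).
  by apply/funext => w; rewrite psiV (walk_history w (leqnn _)) mxE.
have psi_in v : E (fun w => psi (row_mx v (last_var w))) =
    E (fun w => hyb k.+2 (advance k.+1 (walk (coords v) k.+1) (X k.+2 w))).
  by congr (E _); apply/funext => w; rewrite psiV mxE.
rewrite psiE in Hpsi; split; first exact: Hpsi.
have Epsi' := etrans (congr1 E (esym psiE)) Epsi; rewrite Epsi'.
apply: (@le_trans _ _ (E (fun w => hyb k.+1 (walk (X^~ w) k.+1) + step_error))).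
  apply: (sle_mono sE Hin (sle_memDr sE _ HG)) => w.
  by rewrite psi_in -(walk_history w (leqnn k.+1)); exact: step_le.
by rewrite (sle_addr sE _ HG) lerD2r.
Qed.

Definition walk_choice : (nat -> Omega -> R) * (nat -> Omega -> R) :=
  (fun i w => drift i.-1 (walk (X^~ w) i.-1),
   fun i w => volatility i.-1 (walk (X^~ w) i.-1)).

Lemma walk_choice_normalizations : normalizations E X n walk_choice.
Proof.
move=> i /andP[i0 i_n]; have in1 : (i.-1 < n)%N by rewrite prednK.
have wc j : continuous (fun v : 'rV[R]_i.-1 => walk (coords v) i.-1 j).
  by apply: continuous_walk; [exact: ltnW|move=> l; exact: continuous_coords].
have mr w := best_mean_bounds sE H1 tau (slp i.-1 (walk (X^~ w) i.-1)).
split => /=.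
- exists (fun v => drift i.-1 (walk (coords v) i.-1)); first exact: continuous_drift.
  by move=> w; rewrite walk_history.
- exists (fun v => volatility i.-1 (walk (coords v) i.-1)).
    exact: continuous_volatility.
  by move=> w; rewrite walk_history.
- exact: mr.
- move=> w; set s := walk _ _.
  have /andP[b1 b2] := best_sd_bounds sE H1 H2 tau (drift i.-1 s) (crv i.-1 s).
  have rg : mean_range E (X 0%N) (drift i.-1 s).
    by rewrite /mean_range /= in_itv; exact: mr.
  split=> //; first by apply: ereal_inf_lbound; exists (drift i.-1 s).
  by apply: ereal_sup_ubound; exists (drift i.-1 s).
Qed.

(** The interpolated sequences agree up to index n. Index n+1 is read only at time 1, with factor
    0. *)
Lemma broken_line_walk w : broken_line n (walk (X^~ w) n) = S_path X n walk_choice w.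
Proof.
apply/funext => t; rewrite /S_path /broken_line.
have /andP[t0 t1] := time01 t; move: (time t) t0 t1 => u u0 u1.
have nu0 : 0 <= n%:R * u by rewrite mulr_ge0.
have /andP[k1 k2] := truncn_itv nu0; set k := Num.truncn _ in k1 k2 *.
have nu1 : n%:R * u <= n%:R by rewrite ler_piMr.
have kn : (k <= n)%N by rewrite -(ler_nat R) (le_trans k1).
rewrite walkE//; have [kn'|nk] := ltnP k n; first by rewrite walkE.
have kE : k = n by apply/eqP; rewrite eqn_leq kn.
have -> : n%:R * u - k%:R = 0.
  apply/eqP; rewrite subr_eq0 eq_le k1 andbT -{1}kE; rewrite kE in k1 *.
  by rewrite nu1.
by rewrite !mul0r.
Qed.

(** As a function of the history, the last hybrid functional dominates the indicator and is
    admissible in the upper probability. *)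
Lemma upper_prob_walk_le (D : set (unit_interval R -> R)) :
  A = [set a | D (broken_line n a)] ->
  (upper_prob H E X n walk_choice D <= (hyb 0 (fun=> 0) + n%:R * step_error)%:E)%E.
Proof.
move=> AE; have [HG EG] := hybrid_walk_le (leqnn n).
apply: ge_ereal_inf; exists (E (fun w => hyb n (walk (X^~ w) n)))%:E; last by rewrite lee_fin.
have AD a : D (broken_line n a) -> A a by rewrite AE.
have cE : (fun v : 'rV[R]_n => hyb n (walk (coords v) n)) \o history X n =
    (fun w => hyb n (walk (X^~ w) n)).
  by apply/funext => w /=; rewrite (walk_history w (leqnn n)).
exists (fun v => hyb n (walk (coords v) n)); last by rewrite cE.
split=> [|w]; first by rewrite cE.
rewrite (walk_history w (leqnn n)); have /andP[h0 _] := hyb01 (walk (X^~ w) n) (leqnn n).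
rewrite indicE; have [Dw|Dw] := pselect (D (S_path X n walk_choice w)); last first.
  by rewrite memNset.
rewrite mem_set; last exact: Dw.
apply: (hybrid_ge1 _ n eta0 delta0); apply: AD.
by rewrite broken_line_walk; exact: Dw.
Qed.

End process.

(** * The bound *)

Section numerics.
Context {R : realType}.

(** With r = n^(1/8) the total Gaussian error is a constant times e / (e r)^4, so a lower bound on e
    r suffices. *)
Lemma gaussian_error_le (e r : R) : 0 < e -> 44 / 10 <= e * r ->
  r ^+ 8 * (117 / 16 * (r ^+ 4)^-1 ^+ 3 / (3 / 8 * e) ^+ 3) <= 371 / 1000 * e.
Proof.
move=> e0 er; have r0 : 0 < r by rewrite -(pmulr_rgt0 _ e0); lra.
have er0 : 0 < e * r by rewrite mulr_gt0.
have er2 : (44 / 10) ^+ 2 <= (e * r) ^+ 2 by rewrite lerXn2r ?nnegrE ?(ltW er0)//; lra.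
have er4 : ((44 / 10) ^+ 2) ^+ 2 <= ((e * r) ^+ 2) ^+ 2 :> R.
  by rewrite lerXn2r ?nnegrE ?sqr_ge0.
have -> : r ^+ 8 * (117 / 16 * (r ^+ 4)^-1 ^+ 3 / (3 / 8 * e) ^+ 3) =
    117 / 16 * (8 / 3) ^+ 3 * e / ((e * r) ^+ 2) ^+ 2.
  by field; rewrite (gt_eqF e0) (gt_eqF r0).
rewrite ler_pdivrMr; last by rewrite exprn_gt0// exprn_gt0.
have := ler_wpM2r (ltW e0) er4; lra.
Qed.

(** Here x = e/25 and r = n^(1/8), so x^2 n / 4 = z^2 with z = e r^4 / 50 >= q. The ratio then
    decays like a high power of r >= 4.4. *)
Lemma smooth_error_le (e r : R) : 0 < e < 1 -> 44 / 10 <= e * r ->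
  2160 * r ^+ 8 / ((e / 25) ^+ 2 * r ^+ 8 / 4) ^+ 6 <= e / 100.
Proof.
move=> /andP[e0 e1] er; have r0 : 0 < r by rewrite -(pmulr_rgt0 _ e0); lra.
have r44 : 44 / 10 <= r by apply: (le_trans er); rewrite ler_piMl ?ltW.
have r3 : (44 / 10) ^+ 3 <= r ^+ 3 by rewrite lerXn2r ?nnegrE ?(ltW r0)//; lra.
set q := 11 / 125 * r ^+ 3; have q0 : 0 < q by rewrite mulr_gt0 ?exprn_gt0//; lra.
(* 7.49 lies just below 11/125 times 4.4^3, and its cube just above 420. *)
have [c [c0 c3 cq]] : exists c : R, [/\ 0 <= c, 420 <= c ^+ 3 & c <= q].
  by exists (749 / 100); split; rewrite ?/q; lra.
have Q420 : 420 <= q ^+ 3.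
  by apply: (le_trans c3); rewrite lerXn2r// nnegrE ltW.
have w0 : 0 < q ^+ 3 by rewrite exprn_gt0.
(* 420^3 is large enough for the final comparison, whose factor 44/1000 is 4.4/100. *)
have [D [D0 D3 Dw]] : exists D : R,
    [/\ 0 <= D, 2160 * (125 / 11) ^+ 3 <= 44 / 1000 * D ^+ 3 & D <= q ^+ 3].
  by exists 420; split=> [||//]; lra.
have Q9 : D ^+ 3 <= (q ^+ 3) ^+ 3 by rewrite lerXn2r// nnegrE ltW.
set z := e * r * r ^+ 3 / 50.
have zq : q <= z.
  have := ler_wpM2r (ltW (exprn_gt0 3 r0)) er; rewrite /z /q; lra.
have -> : (e / 25) ^+ 2 * r ^+ 8 / 4 = z ^+ 2 by rewrite /z; field.
have z12 : q ^+ 12 <= (z ^+ 2) ^+ 6.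
  by rewrite -exprM lerXn2r ?nnegrE ?(ltW q0) ?(ltW (lt_le_trans q0 zq)).
have qp : 0 < q ^+ 12 by rewrite exprn_gt0.
apply: (@le_trans _ _ (2160 * r ^+ 8 / q ^+ 12)).
  apply: ler_wpM2l; first by apply: mulr_ge0; [exact: ler0n|exact/exprn_ge0/ltW].
  by rewrite lef_pV2 ?posrE// (lt_le_trans qp).
rewrite ler_pdivrMr// -(ler_pM2r r0).
have rE : r ^+ 3 = 125 / 11 * q by rewrite /q; field.
have -> : 2160 * r ^+ 8 * r = 2160 * (125 / 11) ^+ 3 * q ^+ 3.
  rewrite (_ : 2160 * r ^+ 8 * r = 2160 * (r ^+ 3) ^+ 3); last by ring.
  by rewrite rE; ring.
have -> : e / 100 * q ^+ 12 * r = (e * r) / 100 * (q ^+ 3) ^+ 3 * q ^+ 3 by ring.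
rewrite ler_pM2r ?exprn_gt0//.
apply: (@le_trans _ _ (44 / 1000 * (q ^+ 3) ^+ 3)); first lra.
by rewrite ler_pM2r ?exprn_gt0//; lra.
Qed.

Variables (n : nat) (p g : R).
Hypotheses (n0 : (0 < n)%N) (p23 : 2 <= p <= 3) (g_ge : 23 / 27 <= g).

Let n1 : 1 <= n%:R :> R. Proof. by rewrite ler1n. Qed.
Let nR : 0 < n%:R :> R. Proof. by rewrite ltr0n. Qed.
Let g0 : 0 < g. Proof. by apply: lt_le_trans g_ge; lra. Qed.
Let p2 : 2 <= p. Proof. by case/andP: p23. Qed.
Let p3 : p <= 3. Proof. by case/andP: p23. Qed.
Let p10 : p + 1 != 0. Proof. by rewrite gt_eqF//; have := p2; lra. Qed.

Let rate : R := n%:R `^ ((p - 2) / (2 * p + 2)).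
Let rate0 : 0 < rate. Proof. exact: powR_gt0. Qed.
Let e : R := 47 / 10 * g `^ (1 / (p + 1)) * rate^-1.
(** 1/8 is the exponent of [rate] at p = 3, the largest one on [2, 3]. *)
Let r : R := n%:R `^ (1 / 8).

Lemma bound_gt0 : 0 < e.
Proof. by rewrite /e !mulr_gt0 ?invr_gt0 ?powR_gt0//; lra. Qed.

Let bound_rate : e * rate = 47 / 10 * g `^ (1 / (p + 1)).
Proof. by rewrite /e mulfVK// gt_eqF. Qed.

Let g_root : (g `^ (1 / (p + 1))) `^ (p + 1) = g.
Proof. by rewrite -powRrM div1r mulVf// powRr1// ltW. Qed.

(** By g >= 23/27 >= (44/47)^3 the root of g is at least 44/47, and 4.7 times that is 4.4. *)
Lemma bound_root8 : 44 / 10 <= e * r.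
Proof.
have v1 : 0 < 44 / 47 :> R by lra.
have v2 : 44 / 47 <= 1 :> R by lra.
have vg : (44 / 47) `^ (p + 1) <= g.
  apply: le_trans g_ge; apply: (@le_trans _ _ ((44 / 47) `^ 3)).
    by apply: ger_powR; [rewrite v1 v2|have := p2; lra].
  by rewrite (powR_mulrn 3); lra.
have vr : 44 / 47 <= g `^ (1 / (p + 1)).
  have q0 : 0 <= 1 / (p + 1) by rewrite divr_ge0//; have := p2; lra.
  have := @ge0_ler_powR R _ q0 ((44 / 47) `^ (p + 1)) g; rewrite !nnegrE.
  move=> /(_ (powR_ge0 _ _) (ltW g0) vg).
  by rewrite -powRrM div1r mulfV// powRr1//; lra.
apply: (@le_trans _ _ (e * rate)); first by rewrite bound_rate; lra.
rewrite ler_pM2l ?bound_gt0//; apply: ler_powR => //.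
rewrite ler_pdivrMr; last by have := p2; lra.
by have := p3; lra.
Qed.

Lemma root8_pow : r ^+ 8 = n%:R.
Proof. by rewrite -powR_mulrn ?powR_ge0// -powRrM div1r mulVf// powRr1// ltW. Qed.

Lemma sqrt_inv_root8 : Num.sqrt n%:R^-1 = (r ^+ 4)^-1.
Proof.
have r0 : 0 < r by exact: powR_gt0.
have r40 : 0 <= (r ^+ 4)^-1 by rewrite invr_ge0 exprn_ge0 ?ltW.
by rewrite -root8_pow -[RHS](ger0_norm r40) -sqrtr_sqr exprVn -exprM.
Qed.

(** The value of e satisfies e^(p+1) n^((p-2)/2) = 4.7^(p+1) g, which cancels g and n and leaves
    45/47 e / (141/80)^p; the worst case is p = 2. *)
Lemma remainder_error_le :
  n%:R * (9 / 2 * g / (3 / 8 * e * Num.sqrt n%:R) `^ p) <= 31 / 100 * e.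
Proof.
have e0 := bound_gt0.
set N := n%:R `^ ((p - 2) / 2); have N0 : 0 < N by exact: powR_gt0.
set a := (3 / 8 : R) `^ p; have a0 : 0 < a by apply: powR_gt0; lra.
set b := (47 / 10 : R) `^ p; have b0 : 0 < b by apply: powR_gt0; lra.
set u := e `^ p; have u0 : 0 < u by exact: powR_gt0.
have powD1 (x : R) : 0 < x -> x `^ (p + 1) = x `^ p * x.
  by move=> x0; rewrite powRD ?powRr1 ?(ltW x0)//; apply/implyP => _; rewrite gt_eqF.
have gE : g = u * e * N / (b * (47 / 10)).
  have : (e * rate) `^ (p + 1) = (47 / 10 * g `^ (1 / (p + 1))) `^ (p + 1).
    by rewrite bound_rate.
  have c0 : 0 < 47 / 10 :> R by lra.
  have rateE : rate `^ (p + 1) = N.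
    rewrite /rate -powRrM; congr (_ `^ _).
    by field; rewrite gt_eqF//; have := p2; lra.
  rewrite (powRM _ (ltW e0) (ltW rate0)) (powRM _ (ltW c0) (powR_ge0 _ _)) g_root rateE.
  rewrite (powD1 _ e0) (powD1 _ c0) -/b -/u => ->.
  by field; rewrite gt_eqF.
have ab : (141 / 80) ^+ 2 <= a * b.
  have c38 : 0 <= 3 / 8 :> R by lra.
  have c47 : 0 <= 47 / 10 :> R by lra.
  rewrite /a /b -(powRM _ c38 c47) -(powR_mulrn 2); last lra.
  rewrite (_ : 3 / 8 * (47 / 10) = 141 / 80 :> R); last by field.
  by apply: ler_powR => //; lra.
have dE : (3 / 8 * e * Num.sqrt n%:R) `^ p = a * u * (N * n%:R).
  have c38 : 0 <= 3 / 8 :> R by lra.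
  rewrite (powRM _ (mulr_ge0 c38 (ltW e0)) (sqrtr_ge0 _)) (powRM _ c38 (ltW e0)).
  rewrite -/a -/u; congr (_ * _); rewrite -powR12_sqrt// -powRrM.
  rewrite -[X in N * X](powRr1 (ltW nR)) -powRD; last first.
    by apply/implyP => _; rewrite gt_eqF.
  by congr (_ `^ _); field.
rewrite dE gE.
have -> : n%:R * (9 / 2 * (u * e * N / (b * (47 / 10))) / (a * u * (N * n%:R))) =
    45 / 47 * e / (a * b).
  by field; rewrite !gt_eqF.
rewrite ler_pdivrMr ?mulr_gt0//; have := ler_wpM2l (ltW e0) ab; lra.
Qed.

End numerics.

Lemma slip_ext {R : realType} (L : R) k (F : (nat -> R) -> R) x y : slip L k F ->
  (forall i, (i <= k)%N -> x i = y i) -> F x = F y.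
Proof.
move=> Fl xy; apply/eqP; rewrite -subr_eq0 -normr_le0 -(mulr0 L); apply: Fl => i ik.
by rewrite xy// subrr normr0.
Qed.

Section prokhorov_bound.
Context {R : realType} {Omega : Type}.
Variables (H : set (Omega -> R)) (E : (Omega -> R) -> R) (X : nat -> Omega -> R).
Context {d : measure_display} {T : measurableType d}.
Variables (P : probability T R) (B : T -> unit_interval R -> R).
Variables (n : nat) (p g s0 S : R).
Hypotheses (sE : sublinear_expectation H E) (iX : iid_with_X0 H E X).
Hypotheses (H1 : H (X 0%N)) (H2 : H (fun w => X 0%N w ^+ 2)).
Hypotheses (wB : standard_wiener P B) (n0 : (0 < n)%N) (p23 : 2 <= p <= 3).
Hypothesis s00 : 0 < s0.
Hypothesis sdS : forall mu, mean_low E (X 0%N) <= mu <= mean_up E (X 0%N) ->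
  s0 <= sd_low_at E (X 0%N) mu /\ sd_up_at E (X 0%N) mu <= S.
Hypothesis gE : gamma_trunc H E (X 0%N) p (Num.sqrt n%:R) = g%:E.

Let rate : R := n%:R `^ ((p - 2) / (2 * p + 2)).
Let e : R := 47 / 10 * g `^ (1 / (p + 1)) * rate^-1.

Let N1 : 1 <= Num.sqrt n%:R :> R.
Proof. by rewrite -[leLHS]sqrtr1 ler_sqrt// ler1n. Qed.

Let g_ge : 23 / 27 <= g.
Proof.
rewrite -lee_fin -gE; apply: (gamma_trunc_ge sE H1 H2 p23 N1 s00) => mu.
by move=> /sdS[].
Qed.

Let e0 : 0 < e. Proof. exact: bound_gt0. Qed.

(** For e < 1 the path budget is (0.75 + 0.005 + 0.2) e < e, and the probability budget is (0.01 +
    0.1 + 0.31 + 0.371) e <= e. *)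
Lemma prokhorov_dist_le_bound : (prokhorov_dist H E X P B n <= e%:E)%E.
Proof.
apply: ereal_inf_lbound; exists e => //; split=> //.
apply: ge_ereal_sup => _ [D DC <-].
have mEn : measurable [set w | enlargement D e (B w)]
  by case: wB => *; exact: measurable_enlargement.
have PE : (fine (P [set w | enlargement D e (B w)]))%:E = P [set w | enlargement D e (B w)].
  by rewrite fineK// fin_num_measure.
set Pe := fine _ in PE.
have Pe0 : 0 <= Pe by rewrite fine_ge0.
rewrite /Delta leeBlDr; last by rewrite -PE.
rewrite -PE -EFinD.
pose eta := e / 200; have eta0 : 0 < eta.
  by apply: divr_gt0; [exact: e0|rewrite ltr0n].
pose K : R := (mean_up E (X 0%N) - mean_low E (X 0%N)) / s0 + S ^+ 2 / s0 ^+ 2.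
have K0 : 0 <= K.
  rewrite addr_ge0// divr_ge0 ?sqr_ge0 ?(ltW s00)// subr_ge0.
  exact: (mean_low_le_up sE H1).
(* Chosen so that the ramps cost at most e/10 over all n steps. *)
pose tau := e / 10 / (n%:R * (K + 1)).
have nK : 0 < n%:R * (K + 1) by rewrite mulr_gt0 ?ltr0n// ltr_wpDl.
have tau0 : 0 < tau by rewrite divr_gt0// divr_gt0.
pose A := [set a | D (broken_line n a)].
(* The cap at 1 serves the remainder bound; it is inactive once e < 1. *)
pose d8 := Num.min (3 / 8 * e) 1.
have d80 : 0 < d8 by rewrite lt_min ltr01 andbT mulr_gt0//; lra.
have d81 : 0 < d8 <= 1 by rewrite d80 ge_min lexx orbT.
have norm_mem : normalizations E X n (walk_choice E X n d8 eta tau A) :=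
  walk_choice_normalizations sE H1 H2 tau A n0 d81 eta0 s00 sdS.
have up_le := upper_prob_walk_le sE iX H1 H2 n0 p23 d81 eta0 tau0 s00 sdS gE (erefl A).
apply: (@le_trans _ _ (upper_prob H E X n (walk_choice E X n d8 eta tau A) D)).
  by apply: ereal_inf_lbound; exists (walk_choice E X n d8 eta tau A).
(* An upper probability is at most 1, so only e < 1 needs the estimates. *)
have [e1|e1] := leP 1 e.
  apply: (@le_trans _ _ 1%:E); last by rewrite lee_fin ler_wpDr.
  apply: ge_ereal_inf; exists (E (fun=> 1))%:E; last by rewrite (sle_cst sE).
  exists (fun=> 1) => //; split; first exact: (sle_memcst sE).
  by move=> w; rewrite indicE lern1 leq_b1.
apply: (le_trans up_le); rewrite lee_fin.
have dE : d8 = 3 / 8 * e by rewrite /d8 min_l//; lra.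
have er := bound_root8 n0 p23 g_ge; rewrite -/rate -/e in er.
have rE := @root8_pow R n; set r := n%:R `^ (1 / 8) in er rE.
have bad_le := @smooth_error_le R e r; rewrite e0 e1 rE in bad_le.
have {}bad_le := bad_le isT er.
pose bad : R := 2160 * n%:R / ((e / 25) ^+ 2 * n%:R / 4) ^+ 6; rewrite -/bad in bad_le.
have bad0 : 0 <= bad.
  apply: divr_ge0; first by apply: mulr_ge0; exact: ler0n.
  apply/exprn_ge0/divr_ge0; last exact: ler0n.
  by apply: mulr_ge0; [exact: sqr_ge0|exact: ler0n].
have hyb_le : hybrid (normal_prob 0 (Num.sqrt n%:R^-1)) n eta d8 A 0 (fun=> 0) <= Pe + bad.
  (* Unless the bound is at least 1 and hence trivial, it lies in [0, 1], as [hybrid0_le]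
     requires. *)
  have [le1|lt1] := leP 1 (Pe + bad).
    have /andP[_ h1] := hybrid01 (normal_prob 0 (Num.sqrt n%:R^-1)) A eta0 d80 (fun=> 0) (leq0n n).
    exact: le_trans le1.
  apply: (hybrid0_le eta0 d80); first by rewrite addr_ge0//= ltW.
  move=> y; rewrite subr0 => yd.
  pose F := near_ind n eta d8 A 0.
  have Fs := @near_ind_slip R n eta d8 A eta0 0.
  have cs := slip01_chain (normal_prob 0 (Num.sqrt n%:R^-1)) (m := n) (k := 0) Fs.
  have cE : chain (normal_prob 0 (Num.sqrt n%:R^-1)) n 0 F (upd (fun=> 0) 0 y) =
      chain (normal_prob 0 (Num.sqrt n%:R^-1)) n 0 F (fun=> y).
    by apply: (slip_ext cs.2) => i; rewrite leqn0 => /eqP ->; rewrite upd_same.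
  rewrite -/F cE; have e25 : 0 < e / 25 by rewrite divr_gt0.
  apply: (@wiener_near _ _ _ P B wB n n0 D e (e / 25) d8 eta y) => //.
  by rewrite dE /eta; lra.
have rem_le := remainder_error_le n0 p23 g_ge; rewrite -/rate -/e -dE in rem_le.
have gs_le := @gaussian_error_le R e r e0 er.
rewrite rE -(sqrt_inv_root8 n0) -dE in gs_le.
have tauK : n%:R * (tau * K) <= e / 10.
  have -> : n%:R * (tau * K) = e / 10 * (K / (K + 1)).
    by rewrite /tau; field; rewrite !gt_eqF ?ltr0n//; lra.
  apply: ler_piMr; first by apply: divr_ge0; [exact: ltW|exact: ler0n].
  by rewrite ler_pdivrMr; lra.
have arith (h a b c s : R) : h <= Pe + s -> s <= e / 100 -> a <= e / 10 ->
    b <= 31 / 100 * e -> c <= 371 / 1000 * e -> h + (a + b + c) <= e + Pe.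
  by move=> h1 h2 h3 h4 h5; have := lerD (lerD h1 h2) (lerD h3 (lerD h4 h5)); have := e0; lra.
rewrite /step_error -/K; set t := tau * K; rewrite 2!mulrDr.
exact: arith hyb_le bad_le tauK rem_le gs_le.
Qed.

End prokhorov_bound.

Lemma gamma_trunc_le_gamma {R : realType} {Omega : Type} (H : set (Omega -> R))
    (E : (Omega -> R) -> R) (X0 : Omega -> R) (p C : R) :
  (gamma_trunc H E X0 p C <= gamma H E X0 p)%E.
Proof.
apply: ge_ereal_sup => _ [mu mur <-]; apply: le_ereal_sup_tmp; eexists; first by exists mu.
apply: ereal_inf_le_tmp => _ [Y [HY YE] <-]; exists Y => //; split=> // w.
by apply: le_trans (YE w); rewrite ge_min lexx.
Qed.

Theorem corollary1 (R : realType) (Omega : Type)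
    (H : set (Omega -> R)) (E : (Omega -> R) -> R) (X : nat -> Omega -> R)
    (d : measure_display) (T : measurableType d) (P : probability T R)
    (B : T -> unit_interval R -> R) (n : nat) (p : R) :
  sublinear_expectation H E ->
  iid_with_X0 H E X ->
  H (X 0%N) ->
  H (fun w => X 0%N w ^+ 2) ->
  (0 < sd_low E (X 0%N))%E ->
  (sd_low E (X 0%N) <= sd_up E (X 0%N))%E ->
  (sd_up E (X 0%N) < +oo)%E ->
  standard_wiener P B ->
  (1 <= n)%N ->
  2 <= p <= 3 ->
  let C3 : R := 47 / 10 in
  let rate : R := n%:R `^ ((p - 2) / (2 * p + 2)) in
  (prokhorov_dist H E X P B n
     <= C3%:E * gamma_trunc H E (X 0%N) p (Num.sqrt n%:R) `^ (1 / (p + 1))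
        * (rate^-1)%:E)%E /\
  (C3%:E * gamma_trunc H E (X 0%N) p (Num.sqrt n%:R) `^ (1 / (p + 1))
        * (rate^-1)%:E
     <= C3%:E * gamma H E (X 0%N) p `^ (1 / (p + 1)) * (rate^-1)%:E)%E.
Proof.
move=> sE iX H1 H2 low0 low_up upy wB n0 p23 C3 rate.
have n1 : 1 <= n%:R :> R by rewrite ler1n.
have rate0 : 0 < rate by apply: powR_gt0; rewrite ltr0n.
have C30 : 0 < C3 by rewrite /C3; lra.
have q0 : 0 < 1 / (p + 1) by rewrite divr_gt0//; case/andP: p23; lra.
have lowE : (fine (sd_low E (X 0%N)))%:E = sd_low E (X 0%N).
  by rewrite fineK// ge0_fin_numE ?(ltW low0)// (le_lt_trans low_up).
have upE : (fine (sd_up E (X 0%N)))%:E = sd_up E (X 0%N).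
  by rewrite fineK// ge0_fin_numE// (le_trans (ltW low0)).
have s00 : 0 < fine (sd_low E (X 0%N)) by rewrite -lte_fin lowE.
have sdS mu : mean_low E (X 0%N) <= mu <= mean_up E (X 0%N) ->
    fine (sd_low E (X 0%N)) <= sd_low_at E (X 0%N) mu /\
    sd_up_at E (X 0%N) mu <= fine (sd_up E (X 0%N)).
  move=> mur; have rg : mean_range E (X 0%N) mu by rewrite /mean_range /= in_itv.
  rewrite -!lee_fin lowE upE; split; first by apply: ereal_inf_lbound; exists mu.
  by apply: ereal_sup_ubound; exists mu.
have N1 : 1 <= Num.sqrt n%:R :> R by rewrite -[leLHS]sqrtr1 ler_sqrt.
have g_ge := gamma_trunc_ge sE H1 H2 p23 N1 s00 (fun mu mur => (sdS mu mur).1).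
have g0 : (0 <= gamma_trunc H E (X 0%N) p (Num.sqrt n%:R))%E.
  by apply: le_trans g_ge; rewrite lee_fin; lra.
split.
(* An infinite truncated moment would make the right-hand side infinite. *)
- case gE : (gamma_trunc H E (X 0%N) p (Num.sqrt n%:R)) => [g| |]; last by rewrite gE in g0.
    rewrite poweR_EFin -!EFinM.
    exact: (prokhorov_dist_le_bound sE iX H1 H2 wB n0 p23 s00 sdS gE).
  rewrite poweRyr ?gt_eqF// gt0_muley ?lte_fin// gt0_mulye ?lte_fin ?invr_gt0//.
  exact: leey.
- have g_le := gamma_trunc_le_gamma H E (X 0%N) p (Num.sqrt n%:R).
  apply: lee_wpmul2r; first by rewrite lee_fin invr_ge0 ltW.
  apply: lee_wpmul2l; first by rewrite lee_fin ltW.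
  apply: gt0_ler_poweR => //; first exact: ltW.
    by rewrite in_itv/= g0 leey.
  by rewrite in_itv/= (le_trans g0 g_le) leey.
Qed.
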